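(* Let $n\ge2$ and $m\geq 1$ be integers with $m$ not divisible by $n$, let $c=\frac mn$, and let $\mathfrak h=\mathfrak h_n$ be the reflection representation of $S_n$. Then for all $0\le i\le n-2$ the space $\operatorname{Hom}(M_c(\wedge^{i+1}\mathfrak h),M_c(\wedge^i\mathfrak h))$ of homomorphisms of $H_c(S_n)$-modules is one-dimensional.
   Context: $\mathfrak h_n$ is the $(n-1)$-dimensional reflection representation of $S_n$, spanned by $y_1,\dots,y_n$ with $\sum y_i=0$; $\mathfrak h_n^*$ is spanned by $x_1,\dots,x_n$ with $\sum x_i=0$. The rational Cherednik algebra $H_c(S_n)$ is the quotient of $\mathbb CS_n\ltimes T(\mathfrak h_n\oplus\mathfrak h_n^* )$ by $[x_i,x_j]=[y_i,y_j]=0$, $[y_i,x_j]=-\frac1n+cs_{ij}$ ($i\ne j$), $[y_i,x_i]=1-\frac1n-c\sum_{j\neq i}s_{ij}$, where $s_{ij}$ are transpositions. For an $S_n$-module $\tau$, $M_c(\tau)=H_c(S_n)\otimes_{\mathbb CS_n\ltimes S\mathfrak h_n}\tau$ is the Verma module, where $\mathfrak h_n$ acts by zero on $\tau$. *)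

(* Defs.v *)
From HB Require Import structures.
From mathcomp Require Import all_boot all_order all_algebra all_fingroup.
From mathcomp Require Import generic_quotient boolp reals complex.

Set Implicit Arguments.
Unset Strict Implicit.
Unset Printing Implicit Defensive.

Import GRing.Theory.
Local Open Scope ring_scope.
Local Open Scope quotient_scope.

(* [pmod rel] is the R-module generated by X subject to [rel]: formal linear  *)
(* combinations modulo the least congruence that contains [rel] and the       *)
(* module axioms.                                                             *)

Section PresentedModule.
Variables (R : pzRingType) (X : Type).

Inductive mterm : Type :=
| MZero
| MGen of X
| MAdd of mterm & mterm
| MScale of R & mterm.

HB.instance Definition _ := gen_eqMixin mterm.
HB.instance Definition _ := gen_choiceMixin mterm.

Section Quotient.
Variable rel : mterm -> mterm -> Prop.

Inductive mcong : mterm -> mterm -> Prop :=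
| mc_rel s t : rel s t -> mcong s t
| mc_refl t : mcong t t
| mc_sym s t : mcong s t -> mcong t s
| mc_trans s t u : mcong s t -> mcong t u -> mcong s u
| mc_add s s' t t' : mcong s s' -> mcong t t' -> mcong (MAdd s t) (MAdd s' t')
| mc_scale a t t' : mcong t t' -> mcong (MScale a t) (MScale a t')
| mc_addA s t u : mcong (MAdd s (MAdd t u)) (MAdd (MAdd s t) u)
| mc_addC s t : mcong (MAdd s t) (MAdd t s)
| mc_add0 t : mcong (MAdd MZero t) t
| mc_addN t : mcong (MAdd (MScale (-1) t) t) MZero
| mc_scaleA a b t : mcong (MScale a (MScale b t)) (MScale (a * b) t)
| mc_scale1 t : mcong (MScale 1 t) t
| mc_scaleDr a s t :
    mcong (MScale a (MAdd s t)) (MAdd (MScale a s) (MScale a t))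
| mc_scaleDl a b t :
    mcong (MScale (a + b) t) (MAdd (MScale a t) (MScale b t)).

Definition mcongb : Equality.sort mterm -> Equality.sort mterm -> bool :=
  fun s t => `[< mcong s t >].

Lemma mcongb_equiv : equiv_class_of mcongb.
Proof.
split=> [t|s t|t s u].
- exact/asboolP/mc_refl.
- by apply/asboolP/asboolP => /mc_sym.
- by move=> /asboolP h1 /asboolP h2; apply/asboolP/(mc_trans h1).
Qed.
Canonical mcong_equivRel := EquivRelPack mcongb_equiv.

Definition pmod : Type := {eq_quot mcong_equivRel}.
HB.instance Definition _ := Choice.on pmod.
HB.instance Definition _ := Quotient.on pmod.

Definition pmod_class (t : mterm) : pmod := \pi_pmod t.

Lemma pmod_classP s t : mcong s t <-> pmod_class s = pmod_class t.
Proof.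
split=> [h|/eqquotP/asboolP //]; exact/eqquotP/asboolP.
Qed.

Lemma pmod_reprP t : mcong (repr (pmod_class t)) t.
Proof. by apply/pmod_classP; rewrite /pmod_class reprK. Qed.

Lemma pmod_ind (P : pmod -> Prop) : (forall t, P (pmod_class t)) -> forall p, P p.
Proof. by move=> h p; rewrite -[p]reprK; apply: h. Qed.

Definition pmod_zero : pmod := pmod_class MZero.
Definition pmod_add (p q : pmod) : pmod := pmod_class (MAdd (repr p) (repr q)).
Definition pmod_scale (a : R) (p : pmod) : pmod :=
  pmod_class (MScale a (repr p)).
Definition pmod_opp (p : pmod) : pmod := pmod_scale (-1) p.

Lemma pmod_addE s t :
  pmod_add (pmod_class s) (pmod_class t) = pmod_class (MAdd s t).
Proof. by apply/pmod_classP/mc_add; apply: pmod_reprP. Qed.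

Lemma pmod_scaleE a t : pmod_scale a (pmod_class t) = pmod_class (MScale a t).
Proof. by apply/pmod_classP/mc_scale/pmod_reprP. Qed.

Lemma pmod_addA : associative pmod_add.
Proof.
elim/pmod_ind=> s; elim/pmod_ind=> t; elim/pmod_ind=> u.
by rewrite !pmod_addE; apply/pmod_classP/mc_addA.
Qed.

Lemma pmod_addC : commutative pmod_add.
Proof.
elim/pmod_ind=> s; elim/pmod_ind=> t.
by rewrite !pmod_addE; apply/pmod_classP/mc_addC.
Qed.

Lemma pmod_add0 : left_id pmod_zero pmod_add.
Proof. by elim/pmod_ind=> t; rewrite pmod_addE; apply/pmod_classP/mc_add0. Qed.

Lemma pmod_addN : left_inverse pmod_zero pmod_opp pmod_add.
Proof.
elim/pmod_ind=> t.
by rewrite /pmod_opp pmod_scaleE pmod_addE; apply/pmod_classP/mc_addN.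
Qed.

HB.instance Definition _ :=
  GRing.isZmodule.Build pmod pmod_addA pmod_addC pmod_add0 pmod_addN.

Lemma pmod_scaleA a b p : pmod_scale a (pmod_scale b p) = pmod_scale (a * b) p.
Proof.
by elim/pmod_ind: p => t; rewrite !pmod_scaleE; apply/pmod_classP/mc_scaleA.
Qed.

Lemma pmod_scale1 : left_id 1 pmod_scale.
Proof.
by elim/pmod_ind=> t; rewrite !pmod_scaleE; apply/pmod_classP/mc_scale1.
Qed.

Lemma pmod_scaleDr : right_distributive pmod_scale +%R.
Proof.
move=> a; elim/pmod_ind=> s; elim/pmod_ind=> t.
rewrite /GRing.add/= !(pmod_scaleE, pmod_addE).
by apply/pmod_classP/mc_scaleDr.
Qed.

Lemma pmod_scaleDl p : {morph pmod_scale^~ p : a b / a + b}.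
Proof.
elim/pmod_ind: p => t a b.
rewrite [RHS]/GRing.add/= !(pmod_scaleE, pmod_addE).
by apply/pmod_classP/mc_scaleDl.
Qed.

HB.instance Definition _ := GRing.Zmodule_isLmodule.Build R pmod
  pmod_scaleA pmod_scale1 pmod_scaleDr pmod_scaleDl.

Definition pmod_gen (x : X) : pmod := pmod_class (MGen x).

End Quotient.

Fixpoint meval (V : lmodType R) (f : X -> V) (t : mterm) : V :=
  match t with
  | MZero => 0
  | MGen x => f x
  | MAdd s t => meval f s + meval f t
  | MScale a t => a *: meval f t
  end.

(* The linear map out of [pmod rel] that sends the generator x to [f x]; it   *)
(* is meaningful when [f] satisfies the relations.                            *)
Definition pmod_lift rel (V : lmodType R) (f : X -> V) (p : pmod rel) : V :=
  meval f (repr p).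

Section Lift.
Variables (rel : mterm -> mterm -> Prop) (V : lmodType R) (f : X -> V).
Hypothesis fP : forall s t, rel s t -> meval f s = meval f t.

Lemma meval_cong s t : mcong rel s t -> meval f s = meval f t.
Proof.
elim=> {s t} //=.
- by move=> s t u _ -> _ ->.
- by move=> s s' t t' _ -> _ ->.
- by move=> a t t' _ ->.
- by move=> s t u; rewrite addrA.
- by move=> s t; rewrite addrC.
- by move=> t; rewrite add0r.
- by move=> t; rewrite scaleN1r addNr.
- by move=> a b t; rewrite scalerA.
- by move=> t; rewrite scale1r.
- by move=> a s t; rewrite scalerDr.
- by move=> a b t; rewrite scalerDl.
Qed.

Lemma pmod_liftE t : pmod_lift f (pmod_class rel t) = meval f t.
Proof. exact/meval_cong/pmod_reprP. Qed.

Lemma pmod_lift_gen x : pmod_lift f (pmod_gen rel x) = f x.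
Proof. exact: pmod_liftE. Qed.

Lemma pmod_lift_linear : linear (@pmod_lift rel V f).
Proof.
move=> a; elim/pmod_ind=> s; elim/pmod_ind=> t.
rewrite {1}/GRing.scale/= {1}/GRing.add/= pmod_scaleE pmod_addE.
by rewrite !pmod_liftE.
Qed.

End Lift.

Lemma pmod_hom_ext rel (V : lmodType R) (f g : pmod rel -> V) :
    linear f -> linear g ->
  (forall x, f (pmod_gen rel x) = g (pmod_gen rel x)) -> f =1 g.
Proof.
move=> lf lg fg.
have f0 h : linear h -> h (0 : pmod rel) = 0 :> V.
  by move=> /(_ (-1) 0 0); rewrite scaler0 addr0 scaleN1r addNr.
elim/pmod_ind; elim=> [|x|s IHs t IHt|a t IHt].
- by rewrite -[pmod_class _ _]/(0 : pmod rel) !f0.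
- exact: fg.
- have -> : pmod_class rel (MAdd s t) = 1 *: pmod_class rel s + pmod_class rel t.
    by rewrite scale1r [RHS]/GRing.add/= pmod_addE.
  by rewrite lf lg IHs IHt.
- have -> : pmod_class rel (MScale a t) = a *: pmod_class rel t + 0.
    by rewrite addr0 [RHS]/GRing.scale/= pmod_scaleE.
  by rewrite lf lg IHt !f0.
Qed.

End PresentedModule.

Arguments MZero {R X}.
Arguments MGen {R X}.
Arguments pmod {R X}.
Arguments pmod_gen {R X}.

(* [palg rel] is the associative unital K-algebra generated by X subject to   *)
(* [rel], i.e. the quotient of the free algebra on X by the two-sided ideal   *)
(* generated by the differences of related terms. It is a pzRing, not an      *)
(* algType, since 1 != 0 is not known for arbitrary relations; its K-algebra  *)
(* structure is the central ring morphism [palg_cst : K -> palg rel].         *)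

Section PresentedAlgebra.
Variables (K : comPzRingType) (X : Type).

Inductive aterm : Type :=
| ACst of K
| AGen of X
| AAdd of aterm & aterm
| AMul of aterm & aterm.

HB.instance Definition _ := gen_eqMixin aterm.
HB.instance Definition _ := gen_choiceMixin aterm.

Section Quotient.
Variable rel : aterm -> aterm -> Prop.

Inductive acong : aterm -> aterm -> Prop :=
| ac_rel s t : rel s t -> acong s t
| ac_refl t : acong t t
| ac_sym s t : acong s t -> acong t s
| ac_trans s t u : acong s t -> acong t u -> acong s u
| ac_add s s' t t' : acong s s' -> acong t t' -> acong (AAdd s t) (AAdd s' t')
| ac_mul s s' t t' : acong s s' -> acong t t' -> acong (AMul s t) (AMul s' t')
| ac_addA s t u : acong (AAdd s (AAdd t u)) (AAdd (AAdd s t) u)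
| ac_addC s t : acong (AAdd s t) (AAdd t s)
| ac_add0 t : acong (AAdd (ACst 0) t) t
| ac_addN t : acong (AAdd (AMul (ACst (-1)) t) t) (ACst 0)
| ac_mulA s t u : acong (AMul s (AMul t u)) (AMul (AMul s t) u)
| ac_mul1 t : acong (AMul (ACst 1) t) t
| ac_mulDl s t u : acong (AMul (AAdd s t) u) (AAdd (AMul s u) (AMul t u))
| ac_mulDr s t u : acong (AMul s (AAdd t u)) (AAdd (AMul s t) (AMul s u))
| ac_cstD a b : acong (ACst (a + b)) (AAdd (ACst a) (ACst b))
| ac_cstM a b : acong (ACst (a * b)) (AMul (ACst a) (ACst b))
| ac_cstC a t : acong (AMul (ACst a) t) (AMul t (ACst a)).

Definition acongb : Equality.sort aterm -> Equality.sort aterm -> bool :=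
  fun s t => `[< acong s t >].

Lemma acongb_equiv : equiv_class_of acongb.
Proof.
split=> [t|s t|t s u].
- exact/asboolP/ac_refl.
- by apply/asboolP/asboolP => /ac_sym.
- by move=> /asboolP h1 /asboolP h2; apply/asboolP/(ac_trans h1).
Qed.
Canonical acong_equivRel := EquivRelPack acongb_equiv.

Definition palg : Type := {eq_quot acong_equivRel}.
HB.instance Definition _ := Choice.on palg.
HB.instance Definition _ := Quotient.on palg.

Definition palg_class (t : aterm) : palg := \pi_palg t.

Lemma palg_classP s t : acong s t <-> palg_class s = palg_class t.
Proof.
split=> [h|/eqquotP/asboolP //]; exact/eqquotP/asboolP.
Qed.

Lemma palg_reprP t : acong (repr (palg_class t)) t.
Proof. by apply/palg_classP; rewrite /palg_class reprK. Qed.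

Lemma palg_ind (P : palg -> Prop) : (forall t, P (palg_class t)) -> forall p, P p.
Proof. by move=> h p; rewrite -[p]reprK; apply: h. Qed.

Definition palg_zero : palg := palg_class (ACst 0).
Definition palg_one : palg := palg_class (ACst 1).
Definition palg_add (p q : palg) : palg := palg_class (AAdd (repr p) (repr q)).
Definition palg_mul (p q : palg) : palg := palg_class (AMul (repr p) (repr q)).
Definition palg_opp (p : palg) : palg := palg_mul (palg_class (ACst (-1))) p.

Lemma palg_addE s t :
  palg_add (palg_class s) (palg_class t) = palg_class (AAdd s t).
Proof. by apply/palg_classP/ac_add; apply: palg_reprP. Qed.

Lemma palg_mulE s t :
  palg_mul (palg_class s) (palg_class t) = palg_class (AMul s t).
Proof. by apply/palg_classP/ac_mul; apply: palg_reprP. Qed.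

Lemma palg_addA : associative palg_add.
Proof.
elim/palg_ind=> s; elim/palg_ind=> t; elim/palg_ind=> u.
by rewrite !palg_addE; apply/palg_classP/ac_addA.
Qed.

Lemma palg_addC : commutative palg_add.
Proof.
elim/palg_ind=> s; elim/palg_ind=> t.
by rewrite !palg_addE; apply/palg_classP/ac_addC.
Qed.

Lemma palg_add0 : left_id palg_zero palg_add.
Proof. by elim/palg_ind=> t; rewrite palg_addE; apply/palg_classP/ac_add0. Qed.

Lemma palg_addN : left_inverse palg_zero palg_opp palg_add.
Proof.
elim/palg_ind=> t.
by rewrite /palg_opp palg_mulE palg_addE; apply/palg_classP/ac_addN.
Qed.

HB.instance Definition _ :=
  GRing.isZmodule.Build palg palg_addA palg_addC palg_add0 palg_addN.

Lemma palg_mulA : associative palg_mul.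
Proof.
elim/palg_ind=> s; elim/palg_ind=> t; elim/palg_ind=> u.
by rewrite !palg_mulE; apply/palg_classP/ac_mulA.
Qed.

Lemma palg_mul1 : left_id palg_one palg_mul.
Proof. by elim/palg_ind=> t; rewrite palg_mulE; apply/palg_classP/ac_mul1. Qed.

Lemma palg_mulr1 : right_id palg_one palg_mul.
Proof.
elim/palg_ind=> t; rewrite palg_mulE; apply/palg_classP.
exact: ac_trans (ac_sym (ac_cstC _ _)) (ac_mul1 _).
Qed.

Lemma palg_mulDl : left_distributive palg_mul +%R.
Proof.
elim/palg_ind=> s; elim/palg_ind=> t; elim/palg_ind=> u.
rewrite /GRing.add/= !(palg_addE, palg_mulE).
by apply/palg_classP/ac_mulDl.
Qed.

Lemma palg_mulDr : right_distributive palg_mul +%R.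
Proof.
elim/palg_ind=> s; elim/palg_ind=> t; elim/palg_ind=> u.
rewrite /GRing.add/= !(palg_addE, palg_mulE).
by apply/palg_classP/ac_mulDr.
Qed.

HB.instance Definition _ := GRing.Zmodule_isPzRing.Build palg
  palg_mulA palg_mul1 palg_mulr1 palg_mulDl palg_mulDr.

Definition palg_cst (a : K) : palg := palg_class (ACst a).

Lemma palg_cst_zmod_morphism : zmod_morphism palg_cst.
Proof.
move=> a b; rewrite -[in LHS]mulN1r.
rewrite [in RHS]/GRing.opp/= [in RHS]/GRing.add/= /palg_opp palg_mulE palg_addE.
apply/palg_classP; apply: ac_trans (ac_cstD _ _) _.
exact: ac_add (ac_refl _) (ac_cstM _ _).
Qed.

Lemma palg_cst_monoid_morphism : monoid_morphism palg_cst.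
Proof.
split=> // a b; rewrite /GRing.mul/= palg_mulE; exact/palg_classP/ac_cstM.
Qed.

HB.instance Definition _ :=
  GRing.isZmodMorphism.Build K palg palg_cst palg_cst_zmod_morphism.
HB.instance Definition _ :=
  GRing.isMonoidMorphism.Build K palg palg_cst palg_cst_monoid_morphism.

Lemma palg_cst_central a p : palg_cst a * p = p * palg_cst a.
Proof.
elim/palg_ind: p => t; rewrite /GRing.mul/= !palg_mulE.
exact/palg_classP/ac_cstC.
Qed.

Definition palg_gen (x : X) : palg := palg_class (AGen x).

End Quotient.

Section Eval.
Variables (A : pzRingType) (eta : {rmorphism K -> A}) (f : X -> A).

Fixpoint aeval (t : aterm) : A :=
  match t with
  | ACst a => eta a
  | AGen x => f x
  | AAdd s t => aeval s + aeval t
  | AMul s t => aeval s * aeval t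
  end.

Lemma aeval_sum I (r : seq I) (P : pred I) (F : I -> aterm) :
  aeval (\big[AAdd/ACst 0]_(i <- r | P i) F i) = \sum_(i <- r | P i) aeval (F i).
Proof.
by apply: (big_ind2 (fun t p => aeval t = p)); rewrite /= ?rmorph0// => ? ? ? ? -> ->.
Qed.

(* The algebra morphism from [palg rel] to the K-algebra A, with structure    *)
(* morphism eta, that sends the generator x to [f x]; it is meaningful when   *)
(* [f] satisfies the relations.                                               *)
Definition palg_lift rel (p : palg rel) : A := aeval (repr p).

Section Lift.
Variable rel : aterm -> aterm -> Prop.
Hypothesis eta_central : forall a u, eta a * u = u * eta a.
Hypothesis fP : forall s t, rel s t -> aeval s = aeval t.

Lemma aeval_cong s t : acong rel s t -> aeval s = aeval t.
Proof.
elim=> {s t} //=.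
- by move=> s t u _ -> _ ->.
- by move=> s s' t t' _ -> _ ->.
- by move=> s s' t t' _ -> _ ->.
- by move=> s t u; rewrite addrA.
- by move=> s t; rewrite addrC.
- by move=> t; rewrite rmorph0 add0r.
- by move=> t; rewrite rmorph0 rmorphN1 mulN1r addNr.
- by move=> s t u; rewrite mulrA.
- by move=> t; rewrite rmorph1 mul1r.
- by move=> s t u; rewrite mulrDl.
- by move=> s t u; rewrite mulrDr.
- by move=> a b; rewrite rmorphD.
- by move=> a b; rewrite rmorphM.
Qed.

Lemma palg_liftE t : palg_lift (palg_class rel t) = aeval t.
Proof. exact/aeval_cong/palg_reprP. Qed.

Lemma palg_lift_gen x : palg_lift (palg_gen rel x) = f x.
Proof. exact: palg_liftE. Qed.

Lemma palg_lift_cst a : palg_lift (palg_cst rel a) = eta a.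
Proof. exact: palg_liftE. Qed.

Lemma palg_lift_zmod_morphism : zmod_morphism (@palg_lift rel).
Proof.
elim/palg_ind=> s; elim/palg_ind=> t.
rewrite {1}/GRing.opp/= {1}/GRing.add/= /palg_opp palg_mulE palg_addE.
by rewrite !palg_liftE/= rmorphN1 mulN1r.
Qed.

Lemma palg_lift_monoid_morphism : monoid_morphism (@palg_lift rel).
Proof.
split; first by rewrite palg_liftE/= rmorph1.
elim/palg_ind=> s; elim/palg_ind=> t.
by rewrite {1}/GRing.mul/= palg_mulE !palg_liftE.
Qed.

End Lift.
End Eval.

Lemma palg_classE rel t :
  palg_class rel t = aeval (palg_cst rel) (palg_gen rel) t.
Proof.
elim: t => //= s <- t <-; first by rewrite [RHS]/GRing.add/= palg_addE.
by rewrite [RHS]/GRing.mul/= palg_mulE.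
Qed.

Lemma palg_relE rel s t : rel s t ->
  aeval (palg_cst rel) (palg_gen rel) s = aeval (palg_cst rel) (palg_gen rel) t.
Proof. by move=> st; rewrite -!palg_classE; apply/palg_classP/ac_rel. Qed.

Fixpoint aact (V : lmodType K) (rho : X -> V -> V) (t : aterm) (v : V) : V :=
  match t with
  | ACst a => a *: v
  | AGen x => rho x v
  | AAdd s t => aact rho s v + aact rho t v
  | AMul s t => aact rho s (aact rho t v)
  end.

(* The action of [palg rel] on V in which the generator x acts by [rho x].    *)
Definition palg_act rel (V : lmodType K) (rho : X -> V -> V)
    (p : palg rel) (v : V) : V :=
  aact rho (repr p) v.

Section Act.
Variables (rel : aterm -> aterm -> Prop) (V : lmodType K) (rho : X -> V -> V).
Hypothesis rho_linear : forall x, linear (rho x).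
Hypothesis rhoP : forall s t, rel s t -> aact rho s =1 aact rho t.

Lemma aact_linear t : linear (aact rho t).
Proof.
elim: t => [a|x|s IHs t IHt|s IHs t IHt] //= b u v.
- by rewrite scalerDr !scalerA mulrC.
- by rewrite IHs IHt scalerDr addrACA.
- by rewrite IHt IHs.
Qed.

Lemma aactD t u v : aact rho t (u + v) = aact rho t u + aact rho t v.
Proof. by rewrite -{1}[u]scale1r aact_linear scale1r. Qed.

Lemma aactZ t a v : aact rho t (a *: v) = a *: aact rho t v.
Proof.
have t0 : aact rho t 0 = 0.
  by rewrite -{1}[0](addNr (0 : V)) -scaleN1r aact_linear scaleN1r addNr.
by rewrite -[a *: v]addr0 aact_linear t0 addr0.
Qed.

Lemma aact_cong s t : acong rel s t -> aact rho s =1 aact rho t.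
Proof.
elim=> {s t} //=.
- by move=> s t _ h v; rewrite h.
- by move=> s t u _ h _ h' v; rewrite h h'.
- by move=> s s' t t' _ h _ h' v; rewrite h h'.
- by move=> s s' t t' _ h _ h' v; rewrite h' h.
- by move=> s t u v; rewrite addrA.
- by move=> s t v; rewrite addrC.
- by move=> t v; rewrite scale0r add0r.
- by move=> t v; rewrite scale0r scaleN1r addNr.
- by move=> t v; rewrite scale1r.
- by move=> s t u v; rewrite aactD.
- by move=> a b v; rewrite scalerDl.
- by move=> a b v; rewrite scalerA.
- by move=> a t v; rewrite aactZ.
Qed.

Lemma palg_actE t v : palg_act rho (palg_class rel t) v = aact rho t v.
Proof. exact/aact_cong/palg_reprP. Qed.

Lemma palg_actA p q v :
  palg_act rho p (palg_act rho q v) = @palg_act rel V rho (p * q) v.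
Proof.
elim/palg_ind: p => s; elim/palg_ind: q => t.
by rewrite [in RHS]/GRing.mul/= palg_mulE !palg_actE.
Qed.

Lemma palg_act1 : left_id 1 (@palg_act rel V rho).
Proof. by move=> v; rewrite palg_actE/= scale1r. Qed.

Lemma palg_actDr : right_distributive (@palg_act rel V rho) +%R.
Proof. by elim/palg_ind=> t u v; rewrite !palg_actE aactD. Qed.

Lemma palg_actDl v : {morph (@palg_act rel V rho)^~ v : p q / p + q}.
Proof.
elim/palg_ind=> s; elim/palg_ind=> t.
by rewrite {1}/GRing.add/= palg_addE !palg_actE.
Qed.

End Act.

End PresentedAlgebra.

Arguments ACst {K X}.
Arguments AGen {K X}.
Arguments palg {K X}.
Arguments palg_gen {K X}.
Arguments palg_cst {K X}.

(* [tensor phi M] is the left A-module A (x)_B M, where A is a right B-module *)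
(* through phi : B -> A.                                                      *)

Section Tensor.
Variables (A B : pzRingType) (phi : {rmorphism B -> A}) (M : lmodType B).

Local Notation pure a t := (MGen (a, t)).

Inductive tensor_rel : mterm A (A * M) -> mterm A (A * M) -> Prop :=
| tensor_Dl a a' t : tensor_rel (pure (a + a') t) (MAdd (pure a t) (pure a' t))
| tensor_Dr a t t' : tensor_rel (pure a (t + t')) (MAdd (pure a t) (pure a t'))
| tensor_bal a b t : tensor_rel (pure (a * phi b) t) (pure a (b *: t))
| tensor_scale a a' t : tensor_rel (MScale a' (pure a t)) (pure (a' * a) t).

Definition tensor : lmodType A := pmod tensor_rel.

End Tensor.

(* In MathComp (u * w)%g is the permutation i |-> w (u i), so the product     *)
(* "w u" (apply u, then w) of the symmetric group is written (u * w)%g below. *)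

Record snModule (K : pzRingType) (n : nat) := SnModule {
  sn_car :> lmodType K;
  sn_act : 'S_n -> sn_car -> sn_car;
  sn_act_linear : forall w, linear (sn_act w);
  sn_act1 : forall v, sn_act 1%g v = v;
  sn_actM : forall u w v, sn_act (u * w)%g v = sn_act w (sn_act u v) }.

(* The vectors y_1, ..., y_n are indexed from 0 here.                         *)
Section Reflection.
Variables (K : pzRingType) (n : nat).

Inductive refl_rel : mterm K 'I_n -> mterm K 'I_n -> Prop :=
| refl_sum0 : refl_rel (\big[@MAdd K 'I_n/MZero]_(i < n) MGen i) MZero.

Definition refl_car : lmodType K := pmod refl_rel.
Definition refl_y (i : 'I_n) : refl_car := pmod_gen refl_rel i.

Lemma refl_y_sum0 : \sum_(i < n) refl_y i = 0.
Proof.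
transitivity
    (pmod_class refl_rel (\big[@MAdd K 'I_n/MZero]_(i < n) MGen i)); last first.
  exact: (pmod_classP refl_rel _ MZero).1 (mc_rel refl_sum0).
apply: (big_ind2 (fun (p : refl_car) t => p = pmod_class refl_rel t)) => //.
by move=> p s q t -> ->; rewrite [LHS]/GRing.add/= pmod_addE.
Qed.

Definition refl_act (w : 'S_n) : refl_car -> refl_car :=
  @pmod_lift K 'I_n refl_rel refl_car (fun i => refl_y (w i)).

Lemma refl_actP (w : 'S_n) s t : refl_rel s t ->
  meval (fun i => refl_y (w i)) s = meval (fun i => refl_y (w i)) t.
Proof.
case=> /=; rewrite -refl_y_sum0 [RHS](reindex_inj (@perm_inj _ w))/=.
by apply: (big_ind2 (fun t (p : refl_car) =>
  meval (fun i => refl_y (w i)) t = p)) => //= s1 p s2 q -> ->.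
Qed.

Lemma refl_act_linear w : linear (refl_act w).
Proof. exact/pmod_lift_linear/refl_actP. Qed.

Lemma refl_act_y w i : refl_act w (refl_y i) = refl_y (w i).
Proof. exact: (pmod_lift_gen (@refl_actP w)). Qed.

Lemma refl_act1 v : refl_act 1%g v = v.
Proof.
move: v; apply: (pmod_hom_ext (refl_act_linear 1%g)) => // i.
by rewrite refl_act_y perm1.
Qed.

Lemma refl_actM u w v : refl_act (u * w)%g v = refl_act w (refl_act u v).
Proof.
move: v; apply: (pmod_hom_ext (refl_act_linear (u * w)%g)) => [a p q|i].
  by rewrite !refl_act_linear.
by rewrite !refl_act_y permM.
Qed.

Definition reflection : snModule K n :=
  SnModule refl_act_linear refl_act1 refl_actM.

End Reflection.

(* The generator [v : {ffun 'I_k -> V}] stands for v_0 /\ ... /\ v_{k-1}.     *)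
Section Exterior.
Variables (K : comPzRingType) (n k : nat) (V : snModule K n).

Definition set_slot (v : {ffun 'I_k -> V}) (j : 'I_k) (x : V) :
    {ffun 'I_k -> V} :=
  [ffun l => if l == j then x else v l].

Inductive ext_rel : mterm K {ffun 'I_k -> V} -> mterm K {ffun 'I_k -> V} -> Prop :=
| ext_linear v j a x y :
    ext_rel (MGen (set_slot v j (a *: x + y)))
            (MAdd (MScale a (MGen (set_slot v j x))) (MGen (set_slot v j y)))
| ext_alternating (v : {ffun 'I_k -> V}) (i j : 'I_k) :
    i != j -> v i = v j -> ext_rel (MGen v) MZero.

Definition ext_car : lmodType K := pmod ext_rel.
Definition wedge (v : {ffun 'I_k -> V}) : ext_car := pmod_gen ext_rel v.

Definition ext_map (w : 'S_n) (v : {ffun 'I_k -> V}) : {ffun 'I_k -> V} :=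
  [ffun l => sn_act w (v l)].

Definition ext_act (w : 'S_n) : ext_car -> ext_car :=
  @pmod_lift K _ ext_rel ext_car (fun v => wedge (ext_map w v)).

Lemma ext_map_slot w v j x :
  ext_map w (set_slot v j x) = set_slot (ext_map w v) j (sn_act w x).
Proof. by apply/ffunP=> l; rewrite !ffunE; case: eqP. Qed.

Lemma ext_actP (w : 'S_n) s t : ext_rel s t ->
  meval (fun v => wedge (ext_map w v)) s = meval (fun v => wedge (ext_map w v)) t.
Proof.
case=> [v j a x y|v i j ij vij] /=.
  rewrite !ext_map_slot sn_act_linear [in RHS]/GRing.scale/= [in RHS]/GRing.add/=.
  rewrite pmod_scaleE pmod_addE.
  exact/pmod_classP/mc_rel/ext_linear.
apply/pmod_classP/mc_rel/(ext_alternating ij).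
by rewrite !ffunE vij.
Qed.

Lemma ext_act_linear w : linear (ext_act w).
Proof. exact/pmod_lift_linear/ext_actP. Qed.

Lemma ext_act_wedge w v : ext_act w (wedge v) = wedge (ext_map w v).
Proof. exact: (pmod_lift_gen (@ext_actP w)). Qed.

Lemma ext_act1 v : ext_act 1%g v = v.
Proof.
move: v; apply: (pmod_hom_ext (ext_act_linear 1%g)) => // v.
rewrite ext_act_wedge; congr wedge.
by apply/ffunP=> l; rewrite ffunE sn_act1.
Qed.

Lemma ext_actM u w v : ext_act (u * w)%g v = ext_act w (ext_act u v).
Proof.
move: v; apply: (pmod_hom_ext (ext_act_linear (u * w)%g)) => [a p q|v].
  by rewrite !ext_act_linear.
rewrite !ext_act_wedge; congr wedge.
by apply/ffunP=> l; rewrite !ffunE sn_actM.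
Qed.

Definition exterior : snModule K n := SnModule ext_act_linear ext_act1 ext_actM.

End Exterior.

(* [smash_rel] presents CS_n |x T(V), where V is a direct sum, indexed by L,  *)
(* of copies of the module spanned by n permuted vectors with sum 0; both h   *)
(* (spanned by the y_i) and its dual (spanned by the x_i) are of that form.   *)
Section Smash.
Variables (K : comPzRingType) (n : nat) (L : Type).

Inductive smash_gen : Type := SPerm of 'S_n | SVec of L & 'I_n.

Definition sperm (w : 'S_n) : aterm K smash_gen := AGen (SPerm w).
Definition avec (l : L) (i : 'I_n) : aterm K smash_gen := AGen (SVec l i).

Inductive smash_rel : aterm K smash_gen -> aterm K smash_gen -> Prop :=
| smash_1 : smash_rel (sperm 1%g) (ACst 1)
| smash_M u w : smash_rel (AMul (sperm w) (sperm u)) (sperm (u * w)%g)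
| smash_conj w l i :
    smash_rel (AMul (sperm w) (avec l i)) (AMul (avec l (w i)) (sperm w))
| smash_sum0 l :
    smash_rel (\big[@AAdd K smash_gen/ACst 0]_(i < n) avec l i) (ACst 0).

Definition acomm (s t : aterm K smash_gen) : aterm K smash_gen :=
  AAdd (AMul s t) (AMul (ACst (-1)) (AMul t s)).

End Smash.

Arguments SPerm {n L}.
Arguments SVec {n L}.
Arguments sperm {K n L}.
Arguments avec {K n L}.

Section Cherednik.
Variables (K : fieldType) (n : nat) (c : K).

Inductive xy : Type := LX | LY.

Local Notation term := (aterm K (smash_gen n xy)).
Local Notation x := (avec LX).
Local Notation y := (avec LY).
Local Notation s i j := (sperm (tperm i j)).

Inductive cherednik_rel : term -> term -> Prop :=
| cher_smash t t' : smash_rel t t' -> cherednik_rel t t'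
| cher_xx i j : cherednik_rel (acomm (x i) (x j)) (ACst 0)
| cher_yy i j : cherednik_rel (acomm (y i) (y j)) (ACst 0)
| cher_yx i j : i != j ->
    cherednik_rel (acomm (y i) (x j))
      (AAdd (ACst (- n%:R^-1)) (AMul (ACst c) (s i j)))
| cher_yx_diag i :
    cherednik_rel (acomm (y i) (x i))
      (AAdd (ACst (1 - n%:R^-1))
            (AMul (ACst (- c))
                  (\big[@AAdd K _/ACst 0]_(j < n | j != i) s i j))).

Definition cherednik : pzRingType := palg cherednik_rel.

Definition cher_cst (a : K) : cherednik := palg_cst cherednik_rel a.
Definition cher_s (w : 'S_n) : cherednik := palg_gen cherednik_rel (SPerm w).
Definition cher_x (i : 'I_n) : cherednik := palg_gen cherednik_rel (SVec LX i).
Definition cher_y (i : 'I_n) : cherednik := palg_gen cherednik_rel (SVec LY i).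

Lemma cher_acomm0 t t' : cherednik_rel (acomm t t') (ACst 0) ->
  palg_class cherednik_rel t * palg_class cherednik_rel t' =
  palg_class cherednik_rel t' * palg_class cherednik_rel t.
Proof.
move=> /palg_relE/=; rewrite -!palg_classE rmorphN1 mulN1r rmorph0.
exact: subr0_eq.
Qed.

Lemma cher_sM u w : cher_s w * cher_s u = cher_s (u * w)%g.
Proof. exact: (palg_relE (cher_smash (smash_M _ _ u w))). Qed.

Lemma cher_s1 : cher_s 1%g = 1.
Proof. by have /= := palg_relE (cher_smash (smash_1 K n xy)); rewrite rmorph1. Qed.

Lemma cher_sx w i : cher_s w * cher_x i = cher_x (w i) * cher_s w.
Proof. exact: (palg_relE (cher_smash (smash_conj _ w LX i))). Qed.

Lemma cher_sy w i : cher_s w * cher_y i = cher_y (w i) * cher_s w.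
Proof. exact: (palg_relE (cher_smash (smash_conj _ w LY i))). Qed.

Lemma cher_vec_sum0 l : \sum_(i < n) palg_gen cherednik_rel (SVec l i) = 0.
Proof.
by have := palg_relE (cher_smash (smash_sum0 K n l)); rewrite aeval_sum/= rmorph0.
Qed.

Lemma cher_x_sum0 : \sum_(i < n) cher_x i = 0. Proof. exact: cher_vec_sum0. Qed.
Lemma cher_y_sum0 : \sum_(i < n) cher_y i = 0. Proof. exact: cher_vec_sum0. Qed.

Lemma cher_xC i j : cher_x i * cher_x j = cher_x j * cher_x i.
Proof. exact/cher_acomm0/cher_xx. Qed.

Lemma cher_yC i j : cher_y i * cher_y j = cher_y j * cher_y i.
Proof. exact/cher_acomm0/cher_yy. Qed.

Lemma cher_yxE i j : i != j ->
  cher_y i * cher_x j - cher_x j * cher_y i =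
  cher_cst (- n%:R^-1) + cher_cst c * cher_s (tperm i j).
Proof. by move=> /cher_yx/palg_relE/=; rewrite rmorphN1 mulN1r. Qed.

Lemma cher_yx_diagE i :
  cher_y i * cher_x i - cher_x i * cher_y i =
  cher_cst (1 - n%:R^-1) - cher_cst c * \sum_(j < n | j != i) cher_s (tperm i j).
Proof.
have /= := palg_relE (cher_yx_diag i).
by rewrite aeval_sum/= rmorphN1 mulN1r rmorphN mulNr.
Qed.

(* CS_n |x S(h) *)
Inductive parabolic_rel :
  aterm K (smash_gen n unit) -> aterm K (smash_gen n unit) -> Prop :=
| para_smash t t' : smash_rel t t' -> parabolic_rel t t'
| para_yy i j : parabolic_rel (acomm (avec tt i) (avec tt j)) (ACst 0).

Definition parabolic : pzRingType := palg parabolic_rel.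

Definition para_incl_gen (g : smash_gen n unit) : cherednik :=
  match g with
  | SPerm w => cher_s w
  | SVec _ i => cher_y i
  end.

Definition para_incl : parabolic -> cherednik :=
  @palg_lift K _ cherednik (palg_cst cherednik_rel) para_incl_gen parabolic_rel.

Fixpoint para_term (t : aterm K (smash_gen n unit)) : term :=
  match t with
  | ACst a => ACst a
  | AGen (SPerm w) => AGen (SPerm w)
  | AGen (SVec _ i) => AGen (SVec LY i)
  | AAdd s t => AAdd (para_term s) (para_term t)
  | AMul s t => AMul (para_term s) (para_term t)
  end.

Lemma para_termE t : aeval (palg_cst cherednik_rel) para_incl_gen t = palg_class cherednik_rel (para_term t).
Proof.
elim: t => [a|[w|l i]|s /= -> t ->|s /= -> t ->] //=.
- by rewrite [LHS]/GRing.add/= palg_addE.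
- by rewrite [LHS]/GRing.mul/= palg_mulE.
Qed.

Lemma para_inclP t t' : parabolic_rel t t' ->
  aeval (palg_cst cherednik_rel) para_incl_gen t = aeval (palg_cst cherednik_rel) para_incl_gen t'.
Proof.
move=> tt'; rewrite !para_termE; apply/palg_classP/ac_rel.
case: tt' => [{}t {}t'|i j]; last exact: cher_yy.
case=> [|u w|w l i|l] /=.
- exact/cher_smash/smash_1.
- exact/cher_smash/smash_M.
- exact/cher_smash/smash_conj.
- rewrite (_ : para_term _ = \big[@AAdd K _/ACst 0]_(i < n) y i).
    exact/cher_smash/smash_sum0.
  by apply: (big_ind2 (fun t t' => para_term t = t')) => //= ? ? ? ? -> ->.
Qed.

HB.instance Definition _ := GRing.isZmodMorphism.Build parabolic cherednik
  para_incl (palg_lift_zmod_morphism (@palg_cst_central _ _ _) para_inclP).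
HB.instance Definition _ := GRing.isMonoidMorphism.Build parabolic cherednik
  para_incl (palg_lift_monoid_morphism (@palg_cst_central _ _ _) para_inclP).

Section Inflation.
Variable tau : snModule K n.

Definition infl_gen (g : smash_gen n unit) (v : tau) : tau :=
  match g with
  | SPerm w => sn_act w v
  | SVec _ _ => 0
  end.

Definition inflation : Type := tau.
HB.instance Definition _ := GRing.Zmodule.on inflation.

Lemma infl_gen_linear g : linear (infl_gen g).
Proof.
case: g => [w|l i] a u v /=; first exact: sn_act_linear.
by rewrite scaler0 addr0.
Qed.

Lemma infl_genP t t' : parabolic_rel t t' -> aact infl_gen t =1 aact infl_gen t'.
Proof.
have act0 w : sn_act w (0 : tau) = 0.
  by rewrite -{1}[0](addNr (0 : tau)) -scaleN1r sn_act_linear scaleN1r addNr.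
case=> [{}t {}t'|i j v] /=; last by rewrite scale0r scaler0 addr0.
case=> [|u w|w l i|l] v /=.
- by rewrite sn_act1 scale1r.
- by rewrite sn_actM.
- by rewrite act0.
- rewrite scale0r.
  apply: (big_ind (fun t => aact infl_gen t v = 0)) => //=.
    by rewrite scale0r.
  by move=> s1 s2 -> ->; rewrite addr0.
Qed.

HB.instance Definition _ := @GRing.Zmodule_isLmodule.Build parabolic inflation
  (@palg_act K _ parabolic_rel tau infl_gen)
  (palg_actA infl_gen_linear infl_genP)
  (palg_act1 infl_gen_linear infl_genP)
  (palg_actDr infl_gen_linear infl_genP)
  (palg_actDl infl_gen_linear infl_genP).

End Inflation.

Definition verma (tau : snModule K n) : lmodType cherednik :=
  tensor para_incl (inflation tau).

End Cherednik.

Arguments verma {K n}.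
Arguments exterior {K n}.

(* The K-vector space Hom_A(M, N) has dimension 1, for A a K-algebra with     *)
(* structure morphism eta.                                                    *)
Definition hom_one_dimensional (K : fieldType) (A : pzRingType)
    (eta : {rmorphism K -> A}) (M N : lmodType A) : Prop :=
  exists f : {linear M -> N},
    (exists v, f v != 0) /\
    forall g : {linear M -> N}, exists a : K, forall v, g v = eta a *: f v.

(* Main.v *)
(* A Verma module M_c(tau) embeds into polynomials with values in a permutation
   module on tuples, where the y_i act by Dunkl operators; a homomorphism
   M_c(sigma) -> M_c(tau) becomes an equivariant polynomial F in
   C[x] (x) Hom(sigma, tau) that satisfies the KZ equations
   d_a F = c sum_(j <> a) (s_aj F - F s_aj) / (x_a - x_j).

   Existence. The coefficients f_j of z^m in prod_k (1 - x_k z)^c / (1 - x_j z)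
   are killed by the Dunkl operators and sum to 0 because c n = m, so y_j |-> f_j
   is a singular copy of h; the Koszul differential of the f_j solves the KZ
   equations, since the reflection terms it adds to those of the f_j cancel.

   Uniqueness. Euler's identity makes F homogeneous of degree m. Expand F in one
   variable x_o. Its leading exponent is c times an eigenvalue (n, 1 or 2 - n) of
   the difference of the Jucys-Murphy elements of o; as c is not an integer the
   exponent is m, so the leading coefficient is a constant matrix. It commutes
   with the stabilizer of o and lies in the eigenspace for n, which Schur's lemma
   makes one-dimensional. *)

(* The algebra and its Verma modules are given by generators and relations, so nothing in them is
   visibly nonzero. The Dunkl model makes them concrete: [to_dunkl] maps a Verma module into it, and
   [of_dunkl] is a module map back with [of_dunkl \o to_dunkl] the identity. This retraction plays
   the part of a PBW basis. To keep all formulas symmetric, polynomials have n variables and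
   exterior powers are indexed by all tuples. The price is a projection: images consist of
   translation-invariant polynomials, and factors 1/n and 1/k! appear. The numbers n, 1, 2 - n come
   from branching. Over the stabilizer of o, with reflection representation h', the k-th exterior
   power of h is the sum of the k-th and (k-1)-st ones of h', on which the Jucys-Murphy element of o
   acts by n - 1 - k and - k. The difference for k = i and k = i + 1 is n exactly on maps from the
   i-th exterior power of h' to itself, where Schur's lemma applies; in coordinates this is the case
   of o in A and not in B. *)
From HB Require Import structures.
Require Import Defs.
From mathcomp Require Import all_boot all_order all_algebra all_fingroup.
From mathcomp Require Import boolp reals complex.
From mathcomp Require Import ssrcomplements mpoly.
From mathcomp Require Import ring.

Set Implicit Arguments.
Unset Strict Implicit.
Unset Printing Implicit Defensive.

Import Order.TTheory GRing.Theory Num.Theory.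
Local Open Scope ring_scope.

(** * Divided differences *)

Section DividedDifference.
Variables (K : fieldType) (n : nat).
Implicit Types (p q : {mpoly K[n]}) (i j k : 'I_n) (w : 'S_n).

Lemma mpoly_gen_ind (P : {mpoly K[n]} -> Prop) :
    (forall a, P a%:MP) -> (forall p q, P p -> P q -> P (p + q)) ->
    (forall i p, P p -> P ('X_i * p)) ->
  forall p, P p.
Proof.
move=> Pc PD PX; apply: mpolyind => [|a m p _ _ Pp]; first exact: Pc.
apply: PD => //; rewrite -mul_mpolyC mpolyXE_id mulrC.
elim: (index_enum _) => [|i r IHr]; first by rewrite big_nil mul1r; apply: Pc.
rewrite big_cons -mulrA; elim: (m i) => [|d IHd]; first by rewrite expr0 mul1r.
by rewrite exprS -mulrA; apply: PX.
Qed.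

Lemma mpolyX_inj i j : 'X_i = 'X_j :> {mpoly K[n]} -> i = j.
Proof.
move=> /(congr1 (mcoeff U_(j))); rewrite !mcoeffXU eqxx.
by case: (i =P j) => // _ /eqP; rewrite eq_sym oner_eq0.
Qed.

Lemma mpolyXB_neq0 i j : i != j -> 'X_i - 'X_j != 0 :> {mpoly K[n]}.
Proof. by move=> ij; rewrite subr_eq0; apply: contra ij => /eqP/mpolyX_inj->. Qed.

Lemma msymXU w i : msym w 'X_i = 'X_(w i) :> {mpoly K[n]}.
Proof. by rewrite /msym mmapX mmap1U. Qed.

Lemma msymC w a : msym w a%:MP = a%:MP :> {mpoly K[n]}.
Proof. by rewrite /msym mmapC. Qed.

Lemma msym_sum (I : finType) (P : pred I) (F : I -> {mpoly K[n]}) w :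
  msym w (\sum_(i | P i) F i) = \sum_(i | P i) msym w (F i).
Proof. exact: (raddf_sum (msym w)). Qed.

Lemma subm_self (m : 'X_{1..n}) : (m - m)%MM = 0%MM.
Proof. by rewrite -{1}[m]add0m addmK. Qed.

Lemma mderiv_msym w i p : msym w p^`M(i) = (msym w p)^`M(w i).
Proof.
elim/mpoly_gen_ind: p => [a|p q IHp IHq|k p IHp].
- by rewrite msymC !mderivC msym0.
- by rewrite !(mderivD, msymD) IHp IHq.
- rewrite msymM !mderivM !(msymD, msymM) IHp !msymXU.
  congr (_ * _ + _).
  rewrite !mderivX !mnm1E msymZ (inj_eq perm_inj).
  have [<-|_] := eqVneq k i; last by rewrite !scale0r.
  by rewrite !subm_self !mpolyX0 msym1.
Qed.

Lemma mderivXU i j : ('X_j : {mpoly K[n]})^`M(i) = (j == i)%:R.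
Proof.
rewrite mderivX mnm1E; have [->|_] := eqVneq j i; last by rewrite scale0r.
by rewrite subm_self mpolyX0 scale1r.
Qed.

(** The reflection formula for the root X_i - X_j; the difference of Kronecker symbols is the
    pairing of X_k with the coroot. *)
Lemma mpolyXB_tperm i j k :
  ('X_i - 'X_j) * ((k == i)%:R - (k == j)%:R) =
  'X_k - 'X_(tperm i j k) :> {mpoly K[n]}.
Proof.
case: tpermP => [->|->|/eqP/negPf-> /eqP/negPf->]; last by ring.
- by rewrite eqxx; have [->|_] := eqVneq i j => /=; ring.
- by rewrite eqxx eq_sym; have [->|_] := eqVneq i j => /=; ring.
Qed.

(** Divisibility spreads from p to X_k p by the twisted Leibniz rule x p - s(x p) = x (p - s p) + (x
    - s x) s p, which also dictates the witness. *)
Lemma ddiff_exists i j p :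
  exists q, ('X_i - 'X_j) * q = p - msym (tperm i j) p.
Proof.
elim/mpoly_gen_ind: p => [a|p q [u Eu] [v Ev]|k p [u Eu]].
- by exists 0; rewrite msymC subrr mulr0.
- by exists (u + v); rewrite msymD mulrDr Eu Ev; ring.
- exists ('X_k * u + ((k == i)%:R - (k == j)%:R) * msym (tperm i j) p).
  rewrite mulrDr mulrCA Eu msymM msymXU mulrA.
  by rewrite mpolyXB_tperm; ring.
Qed.

End DividedDifference.

(** A quotient obtained by choice. Cancellation determines it when i != j; for i = j the divisor is
    0, whence the condition i != j in most lemmas. *)
HB.lock Definition ddiff (K : fieldType) (n : nat) (i j : 'I_n)
    (p : {mpoly K[n]}) : {mpoly K[n]} :=
  sval (cid (ddiff_exists i j p)).

Section DividedDifferenceTheory.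
Variables (K : fieldType) (n : nat).
Implicit Types (p q : {mpoly K[n]}) (i j k : 'I_n) (w : 'S_n).

Lemma ddiffE i j p : ('X_i - 'X_j) * ddiff i j p = p - msym (tperm i j) p.
Proof. by rewrite ddiff.unlock (svalP (cid (ddiff_exists i j p))). Qed.

Lemma ddiff_uniq i j p q : i != j ->
  ('X_i - 'X_j) * q = p - msym (tperm i j) p -> ddiff i j p = q.
Proof. by move=> /mpolyXB_neq0/mulfI Iij; rewrite -ddiffE => /Iij. Qed.

Lemma ddiff_linear i j : i != j -> linear (@ddiff K n i j).
Proof.
move=> ij a p q; apply: (ddiff_uniq ij).
by rewrite mulrDr -scalerAr !ddiffE msymD msymZ scalerBr; ring.
Qed.

Lemma ddiff_fix i j p : i != j -> msym (tperm i j) p = p -> ddiff i j p = 0.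
Proof. by move=> ij sp; apply: (ddiff_uniq ij); rewrite sp subrr mulr0. Qed.

Lemma ddiffC i j (a : K) : i != j -> ddiff i j a%:MP = 0.
Proof. by move=> ij; rewrite (ddiff_fix ij)// msymC. Qed.

Lemma ddiff_swap i j p : i != j -> ddiff j i p = - ddiff i j p.
Proof.
move=> ij; apply: ddiff_uniq; first by rewrite eq_sym.
by rewrite mulrN -mulNr opprB ddiffE tpermC.
Qed.

Lemma ddiff_sym i j p : i != j ->
  ddiff i j (msym (tperm i j) p) = - ddiff i j p.
Proof.
move=> ij; apply: ddiff_uniq => //.
by rewrite -msymMm tperm2 msym1m mulrN ddiffE opprB.
Qed.

Lemma mulg_tperm_act w i j : (w * tperm (w i) (w j) = tperm i j * w)%g.
Proof. by rewrite -tpermJ conjgE !mulgA mulgV mul1g. Qed.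

Lemma msym_ddiff w i j p : i != j ->
  msym w (ddiff i j p) = ddiff (w i) (w j) (msym w p).
Proof.
move=> ij; apply/esym/ddiff_uniq; first by rewrite (inj_eq perm_inj).
rewrite -!msymXU -msymB -msymM ddiffE msymB; congr (_ - _).
by rewrite -!msymMm mulg_tperm_act.
Qed.

Lemma ddiffX i j k p : i != j ->
  ddiff i j ('X_k * p) =
  'X_k * ddiff i j p + ((k == i)%:R - (k == j)%:R) * msym (tperm i j) p.
Proof.
move=> ij; apply: (ddiff_uniq ij).
rewrite mulrDr mulrCA ddiffE msymM msymXU mulrA.
by rewrite mpolyXB_tperm; ring.
Qed.

Lemma mmapXU (S : nzRingType) (h : {rmorphism K -> S}) (g : 'I_n -> S) i :
  mmap h g 'X_i = g i.
Proof. by rewrite mmapX mmap1U. Qed.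

End DividedDifferenceTheory.

Section Tuples.
Variables (n k : nat).

Definition tact (w : 'S_n) (B : {ffun 'I_k -> 'I_n}) : {ffun 'I_k -> 'I_n} :=
  [ffun p => w (B p)].

Lemma tact1 B : tact 1%g B = B.
Proof. by apply/ffunP=> p; rewrite ffunE perm1. Qed.

Lemma tactM u w B : tact (u * w)%g B = tact w (tact u B).
Proof. by apply/ffunP=> p; rewrite !ffunE permM. Qed.

Lemma tactK w : cancel (tact w) (tact w^-1%g).
Proof. by move=> B; rewrite -tactM mulgV tact1. Qed.

Lemma tactVK w : cancel (tact w^-1%g) (tact w).
Proof. by move=> B; rewrite -tactM mulVg tact1. Qed.

Lemma tact_inj w : injective (tact w).
Proof. exact: can_inj (tactK w). Qed.

End Tuples.

(** * Dunkl operators *)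

HB.lock Definition usym (K : numFieldType) n k (w : 'S_n)
    (u : {ffun {ffun 'I_k -> 'I_n} -> {mpoly K[n]}}) :
    {ffun {ffun 'I_k -> 'I_n} -> {mpoly K[n]}} :=
  [ffun B => msym w (u (tact w^-1%g B))].

HB.lock Definition umul (K : numFieldType) n k (p : {mpoly K[n]})
    (u : {ffun {ffun 'I_k -> 'I_n} -> {mpoly K[n]}}) :
    {ffun {ffun 'I_k -> 'I_n} -> {mpoly K[n]}} :=
  [ffun B => p * u B].

(** The operator d_a - c sum_j (1 - s_aj) / (X_a - X_j) (x) s_aj: the divided difference acts on
    polynomials, and the argument [tact (tperm a j) B] is the action of s_aj on the values. *)
HB.lock Definition dunkl (K : numFieldType) n (c : K) k (a : 'I_n)
    (u : {ffun {ffun 'I_k -> 'I_n} -> {mpoly K[n]}}) :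
    {ffun {ffun 'I_k -> 'I_n} -> {mpoly K[n]}} :=
  [ffun B => (u B)^`M(a) -
     c *: \sum_(j | j != a) ddiff a j (u (tact (tperm a j) B))].

Section Dunkl.
Variables (K : numFieldType) (n : nat) (c : K) (k : nat).

Local Notation U := {ffun {ffun 'I_k -> 'I_n} -> {mpoly K[n]}}.
Local Notation usym := (@usym K n k).
Local Notation umul := (@umul K n k).
Local Notation dunkl := (@dunkl K n c k).
Implicit Types (u v : U) (p q : {mpoly K[n]}) (a b j l : 'I_n) (w : 'S_n).

Lemma usymE w u B : usym w u B = msym w (u (tact w^-1%g B)).
Proof. by rewrite unlock ffunE. Qed.

Lemma umulE p u B : umul p u B = p * u B.
Proof. by rewrite unlock ffunE. Qed.

Lemma dunklE a u B :
  dunkl a u B = (u B)^`M(a) -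
     c *: \sum_(j | j != a) ddiff a j (u (tact (tperm a j) B)).
Proof. by rewrite unlock ffunE. Qed.

Lemma uaddE u v B : (u + v) B = u B + v B.
Proof. by rewrite ffunE. Qed.

Lemma uoppE u B : (- u) B = - u B.
Proof. by rewrite ffunE. Qed.

Lemma uscaleE r u B : (r *: u) B = r *: u B.
Proof. by rewrite ffunE. Qed.

Lemma usym_linear w : linear (usym w).
Proof.
by move=> r u v; apply/ffunP=> B; rewrite !(uaddE, uscaleE, usymE) msymD msymZ.
Qed.

Lemma umul_linear p : linear (umul p).
Proof.
move=> r u v; apply/ffunP=> B.
by rewrite !(uaddE, uscaleE, umulE) mulrDr scalerAr.
Qed.

Lemma dunkl_linear a : linear (dunkl a).
Proof.
move=> r u v; apply/ffunP=> B.
rewrite !(uaddE, uscaleE, dunklE) mderivD mderivZ.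
rewrite [X in _ - c *: X](_ : _ =
   r *: (\sum_(j | j != a) ddiff a j (u (tact (tperm a j) B))) +
   \sum_(j | j != a) ddiff a j (v (tact (tperm a j) B))).
  by rewrite scalerDr scalerBr !scalerA [c * r]mulrC opprD addrACA.
rewrite scaler_sumr -big_split; apply: eq_bigr => j ja /=.
by rewrite !(uaddE, uscaleE) ddiff_linear // eq_sym.
Qed.

HB.instance Definition _ w :=
  GRing.isLinear.Build K U U _ (usym w) (usym_linear w).
HB.instance Definition _ p :=
  GRing.isLinear.Build K U U _ (umul p) (umul_linear p).
HB.instance Definition _ a :=
  GRing.isLinear.Build K U U _ (dunkl a) (dunkl_linear a).

Lemma umulBr p u v : umul p (u - v) = umul p u - umul p v.
Proof. exact: linearB. Qed.

Lemma umulZr p r u : umul p (r *: u) = r *: umul p u.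
Proof. exact: linearZ. Qed.

Lemma dunklB a u v : dunkl a (u - v) = dunkl a u - dunkl a v.
Proof. exact: linearB. Qed.

Lemma dunklZ a r u : dunkl a (r *: u) = r *: dunkl a u.
Proof. exact: linearZ. Qed.

Lemma usym1 u : usym 1%g u = u.
Proof. by apply/ffunP=> B; rewrite usymE invg1 tact1 msym1m. Qed.

Lemma usymM w w' u : usym (w * w')%g u = usym w' (usym w u).
Proof.
by apply/ffunP=> B; rewrite !usymE invMg tactM msymMm.
Qed.

Lemma usym_mul w p u : usym w (umul p u) = umul (msym w p) (usym w u).
Proof. by apply/ffunP=> B; rewrite !(usymE, umulE) msymM. Qed.

Lemma usym_dunkl w a u : usym w (dunkl a u) = dunkl (w a) (usym w u).
Proof.
apply/ffunP=> B; rewrite usymE !dunklE usymE msymB msymZ mderiv_msym;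
  congr (_ - _ *: _).
rewrite raddf_sum [RHS](reindex_inj (@perm_inj _ w))/=.
rewrite [RHS](eq_bigl (fun j => j != a)); last first.
  by move=> j; rewrite (inj_eq perm_inj).
apply: eq_bigr => j; rewrite eq_sym => aj.
rewrite (msym_ddiff _ _ aj) usymE.
rewrite -!tactM; congr (ddiff _ _ (msym _ (u (tact _ B)))).
by apply: (mulgI w); rewrite !mulgA mulgV mul1g mulg_tperm_act -mulgA mulgV mulg1.
Qed.

Lemma dunkl_mulX a l u :
  dunkl a (umul 'X_l u) = umul 'X_l (dunkl a u) +
    if l == a then u - c *: \sum_(j | j != a) usym (tperm a j) u
    else c *: usym (tperm a l) u.
Proof.
apply/ffunP=> B; rewrite uaddE !umulE !dunklE umulE mderivM mderivXU.
have -> : \sum_(j | j != a) ddiff a j (umul 'X_l u (tact (tperm a j) B)) =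
  'X_l * \sum_(j | j != a) ddiff a j (u (tact (tperm a j) B)) +
  \sum_(j | j != a) ((l == a)%:R - (l == j)%:R) * usym (tperm a j) u B.
  rewrite mulr_sumr -big_split; apply: eq_bigr => j.
  by rewrite eq_sym => aj /=; rewrite umulE usymE (ddiffX _ _ aj) tpermV.
rewrite scalerDr mulrBr -scalerAr.
have [->|la] := eqVneq l a.
  rewrite uaddE uoppE uscaleE sum_ffunE /= mul1r.
  rewrite [X in _ - (_ + _ *: X)](_ : _ = \sum_(j | j != a) usym (tperm a j) u B).
    by ring.
  by apply: eq_bigr => j ja; rewrite eq_sym (negPf ja) subr0 mul1r.
rewrite [X in _ - (_ + _ *: X)](_ : _ = - usym (tperm a l) u B).
  by rewrite uscaleE mul0r scalerN add0r opprD opprK addrA.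
rewrite (bigD1 l)//= eqxx sub0r mulN1r big1 ?addr0//.
by move=> j /andP[_ jl]; rewrite eq_sym (negPf jl) subr0 mul0r.
Qed.

Lemma dunkl_const a (r : {ffun 'I_k -> 'I_n} -> K) :
  dunkl a [ffun B => (r B)%:MP] = 0.
Proof.
apply/ffunP=> B; rewrite dunklE !ffunE mderivC big1 ?scaler0 ?subr0// => j ja.
by rewrite ffunE ddiffC// eq_sym.
Qed.

Lemma umulA p q u : umul p (umul q u) = umul (p * q) u.
Proof. by apply/ffunP=> B; rewrite !umulE mulrA. Qed.

Lemma umulDl p q u : umul (p + q) u = umul p u + umul q u.
Proof. by apply/ffunP=> B; rewrite uaddE !umulE mulrDl. Qed.

Lemma umulZl r p u : umul (r *: p) u = r *: umul p u.
Proof. by apply/ffunP=> B; rewrite uscaleE !umulE scalerAl. Qed.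

Lemma u_gen_ind (P : U -> Prop) :
    (forall r : {ffun 'I_k -> 'I_n} -> K, P [ffun B => (r B)%:MP]) ->
    (forall u v, P u -> P v -> P (u + v)) ->
    (forall l u, P u -> P (umul 'X_l u)) ->
  forall u, P u.
Proof.
move=> Pc PD PX u.
have -> : u = \sum_B [ffun B' => if B' == B then u B else 0].
  apply/ffunP=> B; rewrite sum_ffunE (bigD1 B)//= ffunE eqxx big1 ?addr0//.
  by move=> B' /negPf; rewrite ffunE eq_sym => ->.
have P0 : P 0.
  have -> : 0 = [ffun B => ((fun=> 0) B)%:MP] :> U by apply/ffunP=> B;
    rewrite [RHS]ffunE mpolyC0 ffunE.
  exact: Pc.
apply: big_ind => // B _; elim/mpoly_gen_ind: (u B) => [r|p q Pp Pq|l p Pp].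
- have -> : [ffun B' => if B' == B then r%:MP else 0] =
     [ffun B' => (if B' == B then r else 0)%:MP] :> U; last exact: Pc.
  by apply/ffunP=> B'; rewrite !ffunE; case: eqP.
- have -> : [ffun B' => if B' == B then p + q else 0] =
    [ffun B' => if B' == B then p else 0] +
    [ffun B' => if B' == B then q else 0] :> U; last exact: PD.
  by apply/ffunP=> B'; rewrite !ffunE; case: eqP; rewrite ?addr0.
- have -> : [ffun B' => if B' == B then 'X_l * p else 0] =
    umul 'X_l [ffun B' => if B' == B then p else 0] :> U; last exact: PX.
  by apply/ffunP=> B'; rewrite umulE !ffunE; case: eqP; rewrite ?mulr0.
Qed.

(* The commutator of two Dunkl operators kills the constants and commutes     *)
(* with every X_l, so it vanishes on everything these generate.               *)
Lemma dunklC a b u : dunkl a (dunkl b u) = dunkl b (dunkl a u).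
Proof.
have [->//|ab] := eqVneq a b.
elim/u_gen_ind: u => [r|u v IHu IHv|l u IH].
- by rewrite !dunkl_const ?linear0.
- by rewrite !linearD/= IHu IHv.
have tp x y z : z != x -> z != y -> tperm x y z = z.
  by move=> zx zy; rewrite tpermD // eq_sym.
have key x y : x != y ->
    dunkl x (\sum_(j | j != y) usym (tperm y j) u) =
    \sum_(j | (j != y) && (j != x)) usym (tperm y j) (dunkl x u) +
    usym (tperm y x) (dunkl y u).
  move=> xy; rewrite linear_sum (bigD1 x)//= addrC; congr (_ + _).
    apply: eq_bigr => j /andP[jy jx].
    by rewrite usym_dunkl tp // eq_sym.
  by rewrite usym_dunkl tpermL.
have main x y : x != y -> l != y ->
  dunkl x (dunkl y u) = dunkl y (dunkl x u) ->
  dunkl x (dunkl y (umul 'X_l u)) = dunkl y (dunkl x (umul 'X_l u)).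
  move=> xy ly {}IH.
  rewrite (dunkl_mulX y) (negPf ly) linearD linearZ /= dunkl_mulX.
  rewrite (dunkl_mulX x l u) linearD /= dunkl_mulX (negPf ly) IH -!addrA.
  congr (_ + _); have [->|lx] := eqVneq l x; last first.
    have yl : y != l by rewrite eq_sym.
    have yx : y != x by rewrite eq_sym.
    have xl : x != l by rewrite eq_sym.
    by rewrite !linearZ/= !usym_dunkl (tp _ _ _ _ xy xl) (tp _ _ _ _ yx yl) addrC.
  have yx : y != x by rewrite eq_sym.
  rewrite linearB /= [dunkl y (c *: _)]linearZ/= (key _ _ yx).
  rewrite (bigD1 y)//= [tperm y x]tpermC !usym_dunkl tpermL tpermR.
  set S := \sum_(_ < _ | _) _; rewrite !scalerDr [c *: _ + c *: S]addrC.
  by rewrite !(opprD (c *: S)) [dunkl y u + _]addrA addrNK [RHS]addrC addrA addrNK.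
(* [main] covers every l other than its second index; as a != b, one of the two orders applies. *)
have [lb|lb] := eqVneq l b; last exact: main.
have ba : b != a by rewrite eq_sym.
by apply/esym/(main b a ba); [rewrite lb | rewrite IH].
Qed.

(** The reflection terms of (a, j) and (j, a) cancel, because the transposition is the same and the
    divided difference changes sign. What is left is the derivative along (1, ..., 1). *)
Lemma sum_dunklE u B : (\sum_a dunkl a u) B = \sum_a (u B)^`M(a).
Proof.
rewrite sum_ffunE; under eq_bigr do rewrite dunklE.
rewrite sumrB -scaler_sumr.
rewrite [X in c *: X](_ : _ = 0) ?scaler0 ?subr0//.
set S := (X in X = _); suff /eqP : S = - S.
  by rewrite -addr_eq0 -mulr2n -scaler_nat scaler_eq0 pnatr_eq0 => /eqP.
rewrite {1}/S (exchange_big_dep xpredT)//= -sumrN; apply: eq_bigr => j _.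
rewrite -sumrN; apply: eq_big => [a|a ja]; first by rewrite eq_sym.
by rewrite (ddiff_swap _ ja) tpermC.
Qed.

Lemma umul_sum (I : finType) (p : I -> {mpoly K[n]}) u :
  umul (\sum_i p i) u = \sum_i umul (p i) u.
Proof. by apply/ffunP=> B; rewrite sum_ffunE umulE mulr_suml;
  apply: eq_bigr => i _; rewrite umulE. Qed.

End Dunkl.

Section DunklModule.
Variables (K : numFieldType) (n : nat) (c : K) (k : nat).

Local Notation U := {ffun {ffun 'I_k -> 'I_n} -> {mpoly K[n]}}.
Local Notation usym := (@usym K n k).
Local Notation umul := (@umul K n k).
Local Notation dunkl := (@dunkl K n c k).

(* The reflection representation acts through its embedding in the
   permutation representation: X_i and the Dunkl operators are projected along
   their sums. *)
Definition xbar (i : 'I_n) : {mpoly K[n]} := 'X_i - n%:R^-1 *: \sum_j 'X_j.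

Definition ybar (i : 'I_n) (u : U) : U :=
  dunkl i u - n%:R^-1 *: \sum_j dunkl j u.

Definition dunkl_gen (g : smash_gen n xy) : U -> U :=
  match g with
  | SPerm w => usym w
  | SVec LX i => umul (xbar i)
  | SVec LY i => ybar i
  end.

Lemma ybar_linear i : linear (ybar i).
Proof.
move=> r u v; rewrite /ybar linearD linearZ/=.
under eq_bigr do rewrite linearD linearZ/=.
rewrite big_split/= -scaler_sumr !scalerDr scalerN !scalerA [_^-1 * r]mulrC.
by rewrite opprD addrACA.
Qed.

HB.instance Definition _ i :=
  GRing.isLinear.Build K U U _ (ybar i) (ybar_linear i).

Lemma ybarD i u v : ybar i (u + v) = ybar i u + ybar i v.
Proof. exact: linearD. Qed.

Lemma dunkl_gen_linear g : linear (dunkl_gen g).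
Proof. by case: g => [w|[] i]; apply: linearP. Qed.

Lemma msym_xbar w i : msym w (xbar i) = xbar (w i).
Proof.
rewrite /xbar msymB msymZ msymXU msym_sum/= [in RHS](reindex_inj (@perm_inj _ w)).
by under eq_bigr do rewrite msymXU.
Qed.

Lemma usym_ybar w i u : usym w (ybar i u) = ybar (w i) (usym w u).
Proof.
rewrite /ybar linearB linearZ/= usym_dunkl; congr (_ - _ *: _).
rewrite linear_sum [in RHS](reindex_inj (@perm_inj _ w)).
by apply: eq_bigr => j _; apply: usym_dunkl.
Qed.

Lemma xbar_sum0 : \sum_i xbar i = 0.
Proof.
have [n0|n0] := posnP n.
  by apply: big1 => i _; have := ltn_ord i; rewrite {2}n0.
rewrite /xbar sumrB sumr_const card_ord -scaler_nat scalerA divff ?pnatr_eq0 -?lt0n//.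
by rewrite scale1r subrr.
Qed.

Lemma ybar_sum0 u : \sum_i ybar i u = 0.
Proof.
have [n0|n0] := posnP n.
  by apply: big1 => i _; have := ltn_ord i; rewrite {2}n0.
rewrite /ybar sumrB sumr_const card_ord -scaler_nat scalerA divff ?pnatr_eq0 -?lt0n//.
by rewrite scale1r subrr.
Qed.

Lemma ybarC i j u : ybar i (ybar j u) = ybar j (ybar i u).
Proof.
pose E v : U := \sum_a dunkl a v.
have dB l v v' : dunkl l (v - n%:R^-1 *: v') = dunkl l v - n%:R^-1 *: dunkl l v'.
  by rewrite dunklB dunklZ.
have dE l v : dunkl l (E v) = E (dunkl l v).
  by rewrite /E linear_sum; apply: eq_bigr => a _; apply: dunklC.
have EB v v' : E (v - n%:R^-1 *: v') = E v - n%:R^-1 *: E v'.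
  by rewrite /E scaler_sumr -sumrB; apply: eq_bigr => a _; apply: dB.
have yE l v : ybar l v = dunkl l v - n%:R^-1 *: E v by [].
have yy l l' v : ybar l (ybar l' v) = dunkl l (dunkl l' v) -
    (n%:R^-1 *: E (dunkl l v) + n%:R^-1 *: E (dunkl l' v)) +
    n%:R^-1 *: (n%:R^-1 *: E (E v)).
  rewrite (yE l') (yE l) dB EB dE scalerBr opprB opprD.
  by rewrite -!addrA; congr (_ + (_ + _)); rewrite addrC.
by rewrite (yy i j) (yy j i) (dunklC c i j) [n%:R^-1 *: E (dunkl i u) + _]addrC.
Qed.

Definition yx_term i l u : U :=
  (if l == i then u - c *: \sum_(j | j != i) usym (tperm i j) u
   else c *: usym (tperm i l) u) - n%:R^-1 *: u.

Lemma sum_dunkl_mulX l u :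
  \sum_a dunkl a (umul 'X_l u) = umul 'X_l (\sum_a dunkl a u) + u.
Proof.
apply/ffunP=> B; rewrite !(uaddE, umulE, sum_dunklE).
under eq_bigr do rewrite mderivM mderivXU.
rewrite big_split/= addrC mulr_sumr; congr (_ + _).
rewrite (bigD1 l)//= eqxx mul1r big1 ?addr0// => a al.
by rewrite eq_sym (negPf al) mul0r.
Qed.

Lemma ybar_mulX i l u :
  ybar i (umul 'X_l u) = umul 'X_l (ybar i u) + yx_term i l u.
Proof.
rewrite /ybar sum_dunkl_mulX dunkl_mulX umulBr umulZr /yx_term.
by rewrite scalerDr opprD addrACA.
Qed.

(** Replacing X_l by its projection subtracts the mean over l of the commutators [yx_term]. That
    mean is 0: the reflections of l = i cancel those of l != i, and u cancels against n copies of u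
    / n. *)
Lemma ybar_mul_xbar i l u :
  ybar i (umul (xbar l) u) = umul (xbar l) (ybar i u) + yx_term i l u.
Proof.
have n0 : n%:R != 0 :> K by rewrite pnatr_eq0 -lt0n (leq_trans _ (ltn_ord i)).
have mB v : umul (xbar l) v = umul 'X_l v - n%:R^-1 *: \sum_j umul 'X_j v.
  by rewrite /xbar -scaleNr umulDl umulZl umul_sum scaleNr.
rewrite !mB.
have -> : ybar i (umul 'X_l u - n%:R^-1 *: \sum_j umul 'X_j u) =
    ybar i (umul 'X_l u) - n%:R^-1 *: \sum_j ybar i (umul 'X_j u).
  by rewrite linearB linearZ/= linear_sum.
rewrite ybar_mulX; under eq_bigr do rewrite ybar_mulX.
rewrite big_split/= scalerDr opprD addrACA; congr (_ + _).
rewrite [X in _ *: X](_ : _ = 0) ?scaler0 ?subr0// /yx_term sumrB.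
rewrite [X in _ - X](_ : _ = u).
  rewrite (bigD1 i)//= eqxx [X in _ + X - u](_ : _ =
      c *: \sum_(j | j != i) usym (tperm i j) u) ?subrK ?subrr//.
  by rewrite scaler_sumr; apply: eq_bigr => j /negPf->.
by rewrite sumr_const card_ord -scaler_nat scalerA divff// scale1r.
Qed.

Lemma dunkl_genP s t : cherednik_rel c s t ->
  aact dunkl_gen s =1 aact dunkl_gen t.
Proof.
have aact_sum (I : finType) (P : pred I) (F : I -> aterm K (smash_gen n xy)) u :
    aact dunkl_gen (\big[@AAdd K _/ACst 0]_(j | P j) F j) u =
    \sum_(j | P j) aact dunkl_gen (F j) u.
  apply: (big_ind2 (fun t v => aact dunkl_gen t u = v)) => //=.
    by rewrite scale0r.
  by move=> ? ? ? ? -> ->.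
case=> {s t} [s t|i j|i j|i j ij|i] => [[|w w'|w l i|l] u|u|u|u|u] /=.
- by rewrite usym1 scale1r.
- by rewrite usymM.
- by case: l => /=; [rewrite usym_mul msym_xbar | rewrite usym_ybar].
- rewrite scale0r aact_sum; case: l => /=; last exact: ybar_sum0.
  rewrite -umul_sum xbar_sum0; apply/ffunP=> B; rewrite umulE mul0r ffunE//.
- by rewrite !umulA [xbar i * _]mulrC scaleN1r subrr scale0r.
- by rewrite ybarC scaleN1r subrr scale0r.
- rewrite ybar_mul_xbar scaleN1r [LHS]addrC addKr /yx_term eq_sym (negPf ij).
  by rewrite scaleNr addrC.
- rewrite ybar_mul_xbar scaleN1r [LHS]addrC addKr /yx_term eqxx.
  rewrite aact_sum/= scalerBl scale1r scaleNr.
  by rewrite addrAC.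
Qed.

(** The argument is a tag. The underlying space is the same for all [c], but its structure of module
    over [cherednik n c] depends on [c], which instance inference reads off from the tag. *)
Definition dunklmod (_ : K) : Type := U.
HB.instance Definition _ := GRing.Zmodule.on (dunklmod c).
HB.instance Definition _ := @GRing.Zmodule_isLmodule.Build (cherednik n c) (dunklmod c)
  (@palg_act K _ (cherednik_rel c) U dunkl_gen)
  (palg_actA dunkl_gen_linear dunkl_genP)
  (palg_act1 dunkl_gen_linear dunkl_genP)
  (palg_actDr dunkl_gen_linear dunkl_genP)
  (palg_actDl dunkl_gen_linear dunkl_genP).

Lemma dunklmodE (t : aterm K (smash_gen n xy)) (u : dunklmod c) :
  (palg_class (cherednik_rel c) t : cherednik n c) *: u = aact dunkl_gen t u.
Proof. exact: (palg_actE dunkl_gen_linear dunkl_genP). Qed.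

Lemma dunklmod_sE w (u : dunklmod c) : cher_s c w *: u = usym w u.
Proof. exact: dunklmodE. Qed.

Lemma dunklmod_xE i (u : dunklmod c) : cher_x c i *: u = umul (xbar i) u.
Proof. exact: dunklmodE. Qed.

Lemma dunklmod_yE i (u : dunklmod c) : cher_y c i *: u = ybar i u.
Proof. exact: dunklmodE. Qed.

Lemma dunklmod_cstE r (u : dunklmod c) : cher_cst n c r *: u = r *: (u : U).
Proof. exact: dunklmodE. Qed.

End DunklModule.

Arguments dunklmod {K} n k c.

Lemma pmod_classE (R : pzRingType) X (rel : mterm R X -> mterm R X -> Prop) t :
  pmod_class rel t = Defs.meval (pmod_gen rel) t.
Proof.
elim: t => //= [s <- t <-|a t <-].
- by rewrite [RHS]/GRing.add/= pmod_addE.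
- by rewrite [RHS]/GRing.scale/= pmod_scaleE.
Qed.

Lemma pmod_relE (R : pzRingType) X (rel : mterm R X -> mterm R X -> Prop) s t :
  rel s t -> Defs.meval (pmod_gen rel) s = Defs.meval (pmod_gen rel) t.
Proof. by move=> st; rewrite -!pmod_classE; apply/pmod_classP/mc_rel. Qed.

Section LinearFunction.
Variables (R : pzRingType) (V W : lmodType R) (g : V -> W).
Hypothesis lg : linear g.

Lemma linear_fun0 : g 0 = 0.
Proof. by have := lg (-1) 0 0; rewrite scaler0 addr0 scaleN1r addNr. Qed.

Lemma linear_funD x y : g (x + y) = g x + g y.
Proof. by rewrite -[x]scale1r lg !scale1r. Qed.

Lemma linear_funZ a x : g (a *: x) = a *: g x.
Proof. by rewrite -[a *: x]addr0 lg linear_fun0 addr0. Qed.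

End LinearFunction.

(** * Verma modules *)

Section Verma.
Variables (K : numFieldType) (n : nat) (c : K).
Local Notation H := (cherednik n c).
Local Notation cst := (cher_cst n c).

Lemma cher_linear (V W : lmodType H) (f : V -> W) :
    (forall u v, f (u + v) = f u + f v) ->
    (forall a u, f (cst a *: u) = cst a *: f u) ->
    (forall w u, f (cher_s c w *: u) = cher_s c w *: f u) ->
    (forall i u, f (cher_x c i *: u) = cher_x c i *: f u) ->
    (forall i u, f (cher_y c i *: u) = cher_y c i *: f u) ->
  linear f.
Proof.
move=> fD fc fs fx fy h u v; rewrite fD; congr (_ + _).
elim/palg_ind: h u => t u; rewrite palg_classE.
elim: t u => [a|[w|[] i]|s IHs t IHt|s IHs t IHt] u /=.
- exact: fc.
- exact: fs.
- exact: fx.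
- exact: fy.
- by rewrite !scalerDl fD IHs IHt.
- by rewrite -!scalerA IHs IHt.
Qed.

Section Tau.
Variable tau : snModule K n.

Definition vpure (a : H) (t : tau) : verma c tau :=
  pmod_gen (@tensor_rel H (parabolic K n) (@para_incl K n c) (inflation tau)) (a, t).

Lemma vpureM a b t : vpure (a * b) t = a *: vpure b t.
Proof. exact/esym/(pmod_relE (tensor_scale _ _ _ _)). Qed.

Lemma vpureDr a t t' : vpure a (t + t') = vpure a t + vpure a t'.
Proof. exact: (pmod_relE (tensor_Dr _ _ _ _)). Qed.

Lemma vpure_bal t (b : aterm K (smash_gen n unit)) :
  palg_class (cherednik_rel c) (para_term b) *: vpure 1 t =
  vpure 1 (aact (@infl_gen K n tau) b t).
Proof.
rewrite -vpureM mulr1 -para_termE.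
have -> : aact (@infl_gen K n tau) b t =
   (palg_class (@parabolic_rel K n) b : parabolic K n) *: (t : inflation tau).
  exact/esym/(palg_actE (@infl_gen_linear _ _ tau) (@infl_genP _ _ tau)).
have := pmod_relE (tensor_bal (@para_incl K n c) 1
  (palg_class (@parabolic_rel K n) b : parabolic K n) (t : inflation tau)).
rewrite /= -[RHS]/(vpure _ _) => <-; rewrite mul1r /para_incl palg_liftE//.
- exact: palg_cst_central.
- exact: para_inclP.
Qed.

Lemma vpure_cst a t : cst a *: vpure 1 t = vpure 1 (a *: t).
Proof. exact: (vpure_bal t (ACst a)). Qed.

Lemma vpure_s w t : cher_s c w *: vpure 1 t = vpure 1 (sn_act w t).
Proof. exact: (vpure_bal t (sperm w)). Qed.

Lemma vpure_y i t : cher_y c i *: vpure 1 t = 0.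
Proof.
rewrite (vpure_bal t (avec tt i))/= -[0 : tau](scale0r (0 : tau)) -vpure_cst.
by rewrite /cher_cst rmorph0 scale0r.
Qed.

Lemma vpure_sum (I : finType) (P : pred I) (F : I -> tau) :
  vpure 1 (\sum_(i | P i) F i) = \sum_(i | P i) vpure 1 (F i).
Proof.
apply: (big_morph (vpure 1) (vpureDr 1)).
by rewrite -[0 : tau](scale0r (0 : tau)) -vpure_cst /cher_cst rmorph0 scale0r.
Qed.

Lemma verma_ext (V : lmodType H) (f g : verma c tau -> V) :
  linear f -> linear g ->
  (forall t, f (vpure 1 t) = g (vpure 1 t)) -> f =1 g.
Proof.
move=> lf lg fg; apply: pmod_hom_ext => // -[a t].
rewrite -[pmod_gen _ _]/(vpure a t) -[a]mulr1 vpureM.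
by rewrite (linear_funZ lf) (linear_funZ lg) fg.
Qed.

Section Lift.
Variables (V : lmodType H) (th : tau -> V).
Hypothesis thD : forall t t', th (t + t') = th t + th t'.
Hypothesis thZ : forall a t, th (a *: t) = cst a *: th t.
Hypothesis th_s : forall w t, th (sn_act w t) = cher_s c w *: th t.
Hypothesis th_y : forall i t, cher_y c i *: th t = 0.

(** Frobenius reciprocity: an S_n-map from [tau] into the vectors killed by all y_i extends to the
    induced module. Uniqueness of the extension is [verma_ext]. *)
Definition verma_lift : verma c tau -> V :=
  pmod_lift (fun at_ : H * tau => at_.1 *: th at_.2).

Lemma verma_liftP s t :
    @tensor_rel H (parabolic K n) (@para_incl K n c) (inflation tau) s t ->
  Defs.meval (fun at_ : H * tau => at_.1 *: th at_.2) s =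
  Defs.meval (fun at_ : H * tau => at_.1 *: th at_.2) t.
Proof.
case=> {s t} [a a' t|a t t'|a b t|a a' t] /=.
- exact: scalerDl.
- by rewrite -scalerDr -thD.
- rewrite -scalerA; congr (_ *: _).
  elim/palg_ind: b => b; rewrite [_ *: t](palg_actE
    (@infl_gen_linear _ _ tau) (@infl_genP _ _ tau)).
  rewrite /para_incl palg_liftE; [|exact: palg_cst_central|exact: para_inclP].
  elim: b t => [a'|[w|l i]|s IHs s' IHs'|s IHs s' IHs'] t /=.
  + exact/esym/thZ.
  + exact/esym/th_s.
  + have koszul0 : th 0 = 0.
      by rewrite -[0 : tau](scale0r (0 : tau)) thZ /cher_cst rmorph0 scale0r.
    by rewrite th_y koszul0.
  + by rewrite scalerDl IHs IHs' -thD.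
  + by rewrite -scalerA IHs' IHs.
- exact: scalerA.
Qed.

Lemma verma_lift_linear : linear verma_lift.
Proof. exact/pmod_lift_linear/verma_liftP. Qed.

Lemma verma_lift_pure a t : verma_lift (vpure a t) = a *: th t.
Proof. exact: (pmod_lift_gen verma_liftP). Qed.

End Lift.
End Tau.
End Verma.

Arguments vpure {K n} c {tau}.

Section PolynomialAction.
Variables (K : numFieldType) (n : nat) (c : K) (V : lmodType (cherednik n c)).
Local Notation cst := (cher_cst n c).
Implicit Types (p q : {mpoly K[n]}) (v : V).

(** Substitution of [cher_x c i] for X_i. The target ring is noncommutative, so each monomial is a
    product in a fixed order; [cher_xC] makes this compatible with multiplication, in [xevalX]. *)
Definition xeval p v : V :=
  \sum_(m <- msupp p)
    (cst p@_m * \prod_(i < n) cher_x c i ^+ m i) *: v.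

Lemma xevalE d p v : (msize p <= d)%N ->
  xeval p v = \sum_(m : 'X_{1..n < d})
    (cst p@_m * \prod_(i < n) cher_x c i ^+ (m : 'X_{1..n}) i) *: v.
Proof.
move=> le_pd; set I : subFinType _ := 'X_{1..n < d}.
rewrite /xeval (big_mksub I) ?msupp_uniq //=; first last.
  by move=> x /msize_mdeg_lt /leq_trans; apply.
rewrite big_rmcond //= => j /memN_msupp_eq0 ->.
by rewrite /cher_cst rmorph0 mul0r scale0r.
Qed.

Lemma xevalD p q v : xeval (p + q) v = xeval p v + xeval q v.
Proof.
pose d := maxn (msize (p + q)) (maxn (msize p) (msize q)).
rewrite !(@xevalE d) ?leq_max ?leqnn ?orbT// -big_split; apply: eq_bigr => m _ /=.
by rewrite mcoeffD /cher_cst rmorphD mulrDl scalerDl.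
Qed.

Lemma xevalCX a m v :
  xeval (a *: 'X_[m]) v = (cst a * \prod_(i < n) cher_x c i ^+ m i) *: v.
Proof.
rewrite /xeval; have [->|a0] := eqVneq a 0.
  by rewrite scale0r msupp0 big_nil /cher_cst rmorph0 mul0r scale0r.
by rewrite (perm_big _ (msuppZ _ a0)) msuppX big_seq1 mcoeffZ mcoeffX eqxx mulr1.
Qed.

Lemma xevalC a v : xeval a%:MP v = cst a *: v.
Proof.
rewrite -[a%:MP]mulr1 mul_mpolyC -mpolyX0 xevalCX big1 ?mulr1// => i _.
by rewrite mnm0E expr0.
Qed.

Lemma xevalX i p v : xeval ('X_i * p) v = cher_x c i *: xeval p v.
Proof.
elim/mpolyind: p => [|a m p _ _ IHp].
  rewrite mulr0 -mpolyC0 xevalC /cher_cst rmorph0 !scale0r.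
  by rewrite scaler0.
rewrite mulrDr !xevalD scalerDr IHp; congr (_ + _).
rewrite -scalerAr -mpolyXD !xevalCX scalerA; congr (_ *: _).
rewrite mulrA -[cher_x c i * _]palg_cst_central -mulrA; congr (_ * _).
have comm j d : cher_x c i * cher_x c j ^+ d = cher_x c j ^+ d * cher_x c i.
  exact/commrX/cher_xC.
have: uniq (index_enum 'I_n) by exact: index_enum_uniq.
have: i \in index_enum 'I_n by exact: mem_index_enum.
elim: (index_enum 'I_n) => [//|j r IHr]; rewrite inE !big_cons /= mnmDE mnm1E.
have [<-{j} _ /andP[ir _]|ij /= ir /andP[_ ur]] := eqVneq i j.
  rewrite add1n exprS -mulrA; congr (_ * (_ * _)).
  rewrite !big_seq; apply: eq_bigr => j jr; rewrite mnmDE mnm1E.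
  by case: (i =P j) ir jr => [->|//] /negPf->.
by rewrite add0n IHr// mulrA -comm -mulrA.
Qed.

Lemma xeval_msym w p v : cher_s c w *: xeval p v = xeval (msym w p) (cher_s c w *: v).
Proof.
elim/mpoly_gen_ind: p => [a|p q IHp IHq|i p IHp].
- by rewrite msymC !xevalC !scalerA palg_cst_central.
- by rewrite msymD !xevalD scalerDr IHp IHq.
- by rewrite msymM msymXU !xevalX scalerA cher_sx -scalerA IHp.
Qed.

Lemma xevalZ a p v : xeval (a *: p) v = cst a *: xeval p v.
Proof.
elim/mpoly_gen_ind: p => [b|p q IHp IHq|i p IHp].
- by rewrite -mul_mpolyC -mpolyCM !xevalC scalerA /cher_cst rmorphM.
- by rewrite scalerDr !xevalD scalerDr IHp IHq.
- by rewrite scalerAr !xevalX IHp !scalerA palg_cst_central.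
Qed.

End PolynomialAction.

Lemma xeval_morph (K : numFieldType) (n : nat) (c : K)
    (V W : lmodType (cherednik n c)) (f : V -> W) p v :
  linear f -> f (xeval p v) = xeval p (f v).
Proof.
move=> lf; rewrite /xeval (big_morph f (linear_funD lf) (linear_fun0 lf)).
by apply: eq_bigr => m _; rewrite (linear_funZ lf).
Qed.

(** * Embedding of Verma modules into Dunkl modules *)

Section Frame.
Variables (K : numFieldType) (n : nat) (c : K) (k : nat) (tau : snModule K n).
Local Notation Om := {ffun 'I_k -> 'I_n}.
Local Notation U := {ffun {ffun 'I_k -> 'I_n} -> {mpoly K[n]}}.
Local Notation cst := (cher_cst n c).
Variables (ell : Om -> tau -> K) (fr : Om -> tau).
Hypothesis ellD : forall B t t', ell B (t + t') = ell B t + ell B t'.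
Hypothesis ellZ : forall B a t, ell B (a *: t) = a * ell B t.
Hypothesis ell_act : forall w B t, ell (tact w B) (sn_act w t) = ell B t.
Hypothesis fr_act : forall w B, fr (tact w B) = sn_act w (fr B).
Hypothesis frame : forall t, t = \sum_B ell B t *: fr B.

(** [ell] and [fr] make [tau] an equivariant direct summand of the permutation module on tuples,
    [frame] being the splitting. Dunkl operators kill constants, so [tau] lands in singular
    vectors. *)
Definition to_dunkl0 (t : tau) : dunklmod n k c := [ffun B => (ell B t)%:MP].

Definition to_dunkl : verma c tau -> dunklmod n k c := verma_lift to_dunkl0.

Let to_dunkl0D t t' : to_dunkl0 (t + t') = to_dunkl0 t + to_dunkl0 t'.
Proof.
apply/ffunP=> B; rewrite [RHS]uaddE /to_dunkl0 !ffunE ellD.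
exact: mpolyCD.
Qed.

Let to_dunkl0Z a t : to_dunkl0 (a *: t) = cst a *: to_dunkl0 t.
Proof.
rewrite dunklmod_cstE; apply/ffunP=> B.
by rewrite uscaleE /to_dunkl0 !ffunE ellZ mpolyCM mul_mpolyC.
Qed.

Let to_dunkl0_s w t : to_dunkl0 (sn_act w t) = cher_s c w *: to_dunkl0 t.
Proof.
rewrite dunklmod_sE; apply/ffunP=> B; rewrite usymE /to_dunkl0 !ffunE msymC.
by rewrite -{1}[B](tactVK w) ell_act.
Qed.

Let to_dunkl0_y i t : cher_y c i *: to_dunkl0 t = 0.
Proof.
rewrite dunklmod_yE /ybar; have d0 a : dunkl c a (to_dunkl0 t) = 0.
  exact: (@dunkl_const _ _ c k a (fun B => ell B t)).
by rewrite d0 big1 ?scaler0 ?subr0.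
Qed.

Lemma to_dunkl_linear : linear to_dunkl.
Proof. exact: verma_lift_linear. Qed.

Lemma to_dunkl_pure h t : to_dunkl (vpure c h t) = h *: to_dunkl0 t.
Proof. exact: verma_lift_pure. Qed.

(** X_i becomes x_i and the tuple B becomes [fr B]. Multiples of the sum of all X_i go to 0, since
    the x_i sum to 0. *)
Definition of_dunkl (u : dunklmod n k c) : verma c tau :=
  \sum_B xeval (u B) (vpure c 1 (fr B)).

Lemma of_dunklD u v : of_dunkl (u + v) = of_dunkl u + of_dunkl v.
Proof.
rewrite /of_dunkl -big_split; apply: eq_bigr => B _ /=.
by rewrite [(u + v) B]uaddE xevalD.
Qed.

Lemma of_dunklZ a (u : U) : of_dunkl (a *: u : U) = cst a *: of_dunkl u.
Proof.
rewrite /of_dunkl scaler_sumr; apply: eq_bigr => B _ /=.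
by rewrite uscaleE xevalZ.
Qed.

Lemma of_dunklB (u v : U) : of_dunkl (u - v : U) = of_dunkl u - of_dunkl v.
Proof.
apply: (addIr (of_dunkl v)); rewrite subrK -of_dunklD; congr of_dunkl.
exact: (subrK (v : U)).
Qed.

Lemma of_dunkl_sum (I : finType) (P : pred I) (F : I -> U) :
  of_dunkl (\sum_(i | P i) F i : U) = \sum_(i | P i) of_dunkl (F i).
Proof.
apply: (big_morph of_dunkl of_dunklD).
by apply: (addrI (of_dunkl 0)); rewrite -of_dunklD !addr0.
Qed.

Lemma of_dunkl_s w (u : U) : of_dunkl (usym w u) = cher_s c w *: of_dunkl u.
Proof.
rewrite /of_dunkl (reindex_inj (@tact_inj _ _ w)) scaler_sumr.
apply: eq_bigr => B _ /=.
by rewrite xeval_msym usymE tactK vpure_s -fr_act.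
Qed.

Lemma of_dunkl_X i (u : U) : of_dunkl (umul 'X_i u) = cher_x c i *: of_dunkl u.
Proof.
rewrite /of_dunkl scaler_sumr; apply: eq_bigr => B _ /=.
by rewrite umulE xevalX.
Qed.

Lemma of_dunkl_x i (u : U) : of_dunkl (umul (xbar K i) u) = cher_x c i *: of_dunkl u.
Proof.
rewrite /xbar -scaleNr umulDl umulZl umul_sum of_dunklD of_dunklZ of_dunkl_sum.
rewrite of_dunkl_X; under eq_bigr do rewrite of_dunkl_X.
by rewrite -scaler_suml cher_x_sum0 scale0r scaler0 addr0.
Qed.

Lemma of_dunkl_yx i l (u : U) :
  of_dunkl (yx_term c i l u) =
  (cher_y c i * cher_x c l - cher_x c l * cher_y c i) *: of_dunkl u.
Proof.
rewrite /yx_term of_dunklB of_dunklZ.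
have [->|li] := eqVneq l i.
  rewrite cher_yx_diagE of_dunklB of_dunklZ of_dunkl_sum.
  under eq_bigr do rewrite of_dunkl_s.
  rewrite -scaler_suml scalerA /cher_cst rmorphB rmorph1.
  by rewrite -[X in X - _ - _]scale1r -!scalerBl addrAC.
rewrite cher_yxE 1?eq_sym// of_dunklZ of_dunkl_s scalerA -scalerBl.
by rewrite /cher_cst rmorphN addrC.
Qed.

(** Both sides vanish on constants, and y_i has the same commutator with multiplication by X_l on
    either side, so the equality spreads from the constants to all of [U]. *)
Lemma of_dunkl_y i (u : U) : of_dunkl (ybar c i u) = cher_y c i *: of_dunkl u.
Proof.
elim/u_gen_ind: u => [r|u v IHu IHv|l u IHu].
- rewrite [ybar _ _ _](_ : _ = 0); last first.
    rewrite /ybar dunkl_const big1 ?scaler0 ?subr0// => j _.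
    exact: dunkl_const.
  rewrite [LHS](_ : _ = 0); last first.
    by apply: (addrI (of_dunkl 0)); rewrite -of_dunklD !addr0.
  rewrite /of_dunkl scaler_sumr big1// => B _.
  rewrite ffunE xevalC scalerA -[cher_y _ _ * _]palg_cst_central -scalerA.
  by rewrite vpure_y scaler0.
- by rewrite ybarD of_dunklD IHu IHv -scalerDr -of_dunklD.
- rewrite ybar_mulX of_dunklD !of_dunkl_X of_dunkl_yx IHu !scalerA -scalerDl.
  by rewrite addrC subrK.
Qed.

Lemma of_dunkl_linear : linear of_dunkl.
Proof.
apply: cher_linear => [|a u|w u|i u|i u]; first exact: of_dunklD.
- by rewrite dunklmod_cstE of_dunklZ.
- by rewrite dunklmod_sE of_dunkl_s.
- by rewrite dunklmod_xE of_dunkl_x.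
- by rewrite dunklmod_yE of_dunkl_y.
Qed.

(** The composite is a module map that fixes every 1 (x) t. Elements of a Verma module can hence be
    compared through their polynomial coordinates. *)
Lemma to_dunklK : cancel to_dunkl of_dunkl.
Proof.
apply: (@verma_ext _ _ _ _ _ (of_dunkl \o to_dunkl) id) => [a u v|a u v|t] //=.
  by rewrite to_dunkl_linear of_dunkl_linear.
rewrite to_dunkl_pure scale1r {2}[t]frame vpure_sum; apply: eq_bigr => B _.
by rewrite ffunE xevalC vpure_cst.
Qed.

Definition xsubst (p : {mpoly K[n]}) : {mpoly K[n]} := mmap (@mpolyC n K) (@xbar K n) p.

Lemma xeval_dunkl p (u : dunklmod n k c) : xeval p u = umul (xsubst p) u.
Proof.
rewrite /xsubst; elim/mpoly_gen_ind: p => [a|p q IHp IHq|i p IHp].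
- rewrite xevalC mmapC dunklmod_cstE; apply/ffunP=> B.
  by rewrite uscaleE umulE mul_mpolyC.
- by rewrite xevalD IHp IHq mmapD umulDl.
- by rewrite xevalX IHp rmorphM/= mmapXU dunklmod_xE umulA.
Qed.

(** The opposite composite is a projection onto the image: polynomials become translation invariant
    under X_i |-> X_i - mean, and values are projected to [tau]. *)
Lemma of_dunklK (u : dunklmod n k c) B :
  to_dunkl (of_dunkl u) B = \sum_B' ell B (fr B') *: xsubst (u B').
Proof.
rewrite /of_dunkl.
rewrite (big_morph to_dunkl (linear_funD to_dunkl_linear)
  (linear_fun0 to_dunkl_linear)).
rewrite [LHS](_ : _ = \sum_B' (to_dunkl (xeval (u B') (vpure c 1 (fr B'))) B)).
  apply: eq_bigr => B' _; rewrite (xeval_morph _ _ to_dunkl_linear).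
  rewrite to_dunkl_pure scale1r xeval_dunkl umulE ffunE mulrC.
  exact: mul_mpolyC.
exact: sum_ffunE.
Qed.

End Frame.

Lemma ord_natr_neq0 (K : numFieldType) n (i : 'I_n) : n%:R != 0 :> K.
Proof. by rewrite pnatr_eq0 -lt0n (leq_trans _ (ltn_ord i)). Qed.

Lemma sum_delta_avg (K : numFieldType) n (j : 'I_n) :
  \sum_i ((j == i)%:R - n%:R^-1) = 0 :> K.
Proof.
rewrite sumrB (bigD1 j)//= eqxx big1 ?addr0.
  by rewrite sumr_const card_ord -[_ *+ n]mulr_natr mulVf ?subrr// (ord_natr_neq0 _ j).
by move=> i /negPf; rewrite eq_sym => ->.
Qed.

(** * Exterior powers of the reflection representation *)

Section ReflectionCoordinates.
Variables (K : numFieldType) (n : nat).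
Local Notation h := (reflection K n).
Implicit Types (i j : 'I_n) (v : h) (w : 'S_n).

(** The coordinate x_j. The shift by 1/n makes its values on the y_i sum to 0, as the relation of h
    requires. *)
Definition rcoord j (v : h) : K :=
  @pmod_lift K 'I_n (@refl_rel K n) K^o (fun i => (j == i)%:R - n%:R^-1) v.

Lemma rcoordP j s t : @refl_rel K n s t ->
  Defs.meval (fun i => (j == i)%:R - n%:R^-1 : K^o) s =
  Defs.meval (fun i => (j == i)%:R - n%:R^-1 : K^o) t.
Proof.
case=> /=; rewrite -[RHS](sum_delta_avg K j).
by apply: (big_ind2 (fun t (a : K^o) => Defs.meval _ t = a)) => //= ? ? ? ? -> ->.
Qed.

Lemma rcoord_linear j : linear (rcoord j : h -> K^o).
Proof. exact/pmod_lift_linear/rcoordP. Qed.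

Lemma rcoord_y j i : rcoord j (refl_y K i) = (j == i)%:R - n%:R^-1.
Proof. exact: (pmod_lift_gen (@rcoordP j)). Qed.

Lemma rcoord_act w j v : rcoord (w j) (sn_act w v) = rcoord j v.
Proof.
move: v; apply: (@pmod_hom_ext _ _ _ K^o) => [a u v|a u v|i].
- by rewrite -rcoord_linear -sn_act_linear.
- exact: rcoord_linear.
- by rewrite [sn_act _ _]refl_act_y !rcoord_y (inj_eq perm_inj).
Qed.

Lemma rcoord_frame v : v = \sum_j rcoord j v *: refl_y K j.
Proof.
move: v; apply: pmod_hom_ext => // [a u v|i].
  rewrite scaler_sumr -big_split; apply: eq_bigr => j _ /=.
  by rewrite rcoord_linear scalerDl scalerA.
under eq_bigr do rewrite rcoord_y scalerBl.
rewrite sumrB -scaler_sumr refl_y_sum0 scaler0 subr0 (bigD1 i)//= eqxx scale1r.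
by rewrite big1 ?addr0// => j /negPf->; rewrite scale0r.
Qed.

Lemma rcoord_sum0 v : \sum_j rcoord j v = 0.
Proof.
move: v; apply: (@pmod_hom_ext _ _ _ K^o (fun v => \sum_j rcoord j v) (fun=> 0))
  => [a u v|a u v|i].
- rewrite scaler_sumr -big_split; apply: eq_bigr => j _ /=.
  by rewrite rcoord_linear.
- by rewrite scaler0 addr0.
- under eq_bigr do rewrite rcoord_y.
  by rewrite -[RHS](sum_delta_avg K i); apply: eq_bigr => j _; rewrite eq_sym.
Qed.

End ReflectionCoordinates.

Section Multilinear.
Variables (K : numFieldType) (n k : nat).
Local Notation h := (reflection K n).
Local Notation Om := {ffun 'I_k -> 'I_n}.

Definition set_entry (B : Om) (p : 'I_k) (j : 'I_n) : Om :=
  [ffun q => if q == p then j else B q].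

(** The involution of the pairs (B, j) that exchanges j with the entry of B at p shows that each
    tuple is met n times. *)
Lemma sum_set_entry (W : lmodType K) (f : Om -> W) (p : 'I_k) :
  \sum_B \sum_j f (set_entry B p j) = n%:R *: \sum_B f B.
Proof.
rewrite pair_big /= (reindex_inj (h := fun x : Om * 'I_n => (set_entry x.1 p x.2,
  x.1 p))) /=.
  rewrite -(pair_big xpredT xpredT (fun B j => f (set_entry (set_entry B p j)
    p (B p))))/=.
  rewrite scaler_sumr; apply: eq_bigr => B _.
  under eq_bigr => j _.
    rewrite (_ : set_entry _ _ _ = B).
      over.
    by apply/ffunP=> q; rewrite !ffunE; case: eqP => // ->.
  by rewrite sumr_const card_ord scaler_nat.
apply: (can_inj (g := fun x : Om * 'I_n => (set_entry x.1 p x.2, x.1 p))).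
case=> B j /=; congr (_, _); last by rewrite ffunE eqxx.
by apply/ffunP=> q; rewrite !ffunE; case: eqP => // ->.
Qed.

Variables (W : lmodType K) (g : {ffun 'I_k -> h} -> W).
Hypothesis g_slot : forall v p a x y,
  g (set_slot v p (a *: x + y)) = a *: g (set_slot v p x) + g (set_slot v p y).

Lemma slot_sum v p (x : h) :
  g (set_slot v p x) = \sum_j rcoord j x *: g (set_slot v p (refl_y K j)).
Proof.
have g0 : g (set_slot v p 0) = 0.
  have := g_slot v p (-1) 0 0; rewrite scaler0 addr0 scaleN1r => /eqP.
  by rewrite addNr => /eqP.
have gD u u' : g (set_slot v p (u + u')) = g (set_slot v p u) + g (set_slot v p u').
  by have := g_slot v p 1 u u'; rewrite !scale1r.
rewrite {1}[x]rcoord_frame (big_morph (fun u => g (set_slot v p u)) gD g0).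
by apply: eq_bigr => j _; rewrite -[_ *: refl_y _ _]addr0 g_slot g0 addr0.
Qed.

Lemma multilinear_expand v : (0 < n)%N ->
  g v = \sum_(B : Om) (\prod_p rcoord (B p) (v p)) *:
          g [ffun p => refl_y K (B p)].
Proof.
move=> n0; pose mix d (B : Om) : {ffun 'I_k -> h} :=
  [ffun p : 'I_k => if (p < d)%N then refl_y K (B p) else v p].
pose T d := \sum_(B : Om) (\prod_(p : 'I_k | (p < d)%N) rcoord (B p) (v p))
  *: g (mix d B).
(* [T d] expands the first d slots only. The entries of B from d on are free, so [T d] counts g v
   with multiplicity n^(k - d); the powers of n balance this and are cancelled at the end. *)
have nT d : (d <= k)%N -> n%:R ^+ d *: T d = n%:R ^+ k *: g v.
  elim: d => [_|d IHd dk].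
    rewrite expr0 scale1r /T (eq_bigr (fun=> g v)) => [|B _].
      by rewrite sumr_const card_ffun !card_ord -natrX scaler_nat.
    rewrite big1 ?scale1r => [|p]; last by rewrite ltn0.
    by congr g; apply/ffunP=> p; rewrite ffunE ltn0.
  rewrite -(IHd (ltnW dk)) exprSr -scalerA; congr (_ *: _).
  pose q := Ordinal dk; rewrite -(sum_set_entry _ q); apply: eq_bigr => B _.
  have lt_d (p : 'I_k) : (p < d.+1)%N = (p == q) || (p < d)%N.
    by rewrite ltnS leq_eqVlt.
  have -> : mix d B = set_slot (mix d B) q (v q).
    by apply/ffunP=> p; rewrite !ffunE; case: eqP => // ->; rewrite ltnn.
  rewrite slot_sum scaler_sumr; apply: eq_bigr => j _.
  rewrite (bigD1 q)//= ffunE eqxx mulrC -scalerA.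
  congr (_ *: (_ *: _)).
    apply: eq_big => [p|p /andP[_ /negPf pq]]; last by rewrite ffunE pq.
    by rewrite lt_d; case: (p =P q) => [->|_] /=; rewrite ?ltnn ?andbT.
  congr g; apply/ffunP=> p; rewrite !ffunE lt_d.
  by case: eqP.
have nk : n%:R ^+ k != 0 :> K by rewrite expf_neq0// pnatr_eq0 -lt0n.
have /(scalerI nk)<- := nT k (leqnn k).
rewrite /T; apply: eq_bigr => B _; congr (_ *: g _).
  by apply: eq_bigl => p; rewrite ltn_ord.
by apply/ffunP=> p; rewrite !ffunE ltn_ord.
Qed.

End Multilinear.

Section AlternatingSumZero.
Variables (n k : nat) (W : zmodType).
Local Notation Om := {ffun 'I_k -> 'I_n}.

(** The properties that the wedge of the y's indexed by B and the coordinates [ell B t] share as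
    functions of B. The third one reflects the relation sum_j y_j = 0 and its dual. *)
Definition altsum (f : Om -> W) :=
  [/\ forall (B : Om) p q, p != q -> B p = B q -> f B = 0,
      forall (B : Om) p q, p != q -> f [ffun r => B (tperm p q r)] = - f B &
      forall B p, \sum_j f (set_entry B p j) = 0].

End AlternatingSumZero.

Section ExteriorFrame.
Variables (K : numFieldType) (n k : nat).
Local Notation h := (reflection K n).
Local Notation E := (exterior k h).
Local Notation Om := {ffun 'I_k -> 'I_n}.
Implicit Types (v : {ffun 'I_k -> h}) (B : Om) (p q : 'I_k) (w : 'S_n).

Lemma wedge_slot v p a x y :
  wedge (set_slot v p (a *: x + y)) =
  a *: wedge (set_slot v p x) + wedge (set_slot v p y).
Proof. exact: (pmod_relE (ext_linear _ _ _ _ _)). Qed.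

Lemma wedge_alt v p q : p != q -> v p = v q -> wedge v = 0.
Proof. by move=> pq vpq; apply: (pmod_relE (ext_alternating pq vpq)). Qed.

Lemma set_slotC v p q x y : p != q ->
  set_slot (set_slot v p x) q y = set_slot (set_slot v q y) p x.
Proof.
move=> pq; apply/ffunP=> r; rewrite !ffunE.
by case: (r =P q) => // ->; rewrite eq_sym (negPf pq).
Qed.

Lemma wedge_slotD v p x y :
  wedge (set_slot v p (x + y)) = wedge (set_slot v p x) + wedge (set_slot v p y).
Proof. by have := wedge_slot v p 1 x y; rewrite !scale1r. Qed.

Lemma wedge_tperm v p q : p != q -> wedge [ffun r => v (tperm p q r)] = - wedge v.
Proof.
move=> pq; pose u x y := set_slot (set_slot v p x) q y.
have uxx x : wedge (u x x) = 0.
  by apply: (wedge_alt pq); rewrite !ffunE !eqxx; case: eqP.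
have uDl x x' y : wedge (u (x + x') y) = wedge (u x y) + wedge (u x' y).
  by rewrite /u !(set_slotC _ _ _ pq) wedge_slotD.
have uDr x y y' : wedge (u x (y + y')) = wedge (u x y) + wedge (u x y').
  exact: wedge_slotD.
have := uxx (v p + v q); rewrite uDl !uDr !uxx addr0 add0r.
have -> : u (v p) (v q) = v.
  by apply/ffunP=> r; rewrite !ffunE; case: eqP => [->|_]//; case: eqP => [->|].
have -> : u (v q) (v p) = [ffun r => v (tperm p q r)].
  apply/ffunP=> r; rewrite !ffunE; case: tpermP => [->|->|/eqP/negPf-> /eqP/negPf->]//.
    by rewrite eqxx (negPf pq).
  by rewrite eqxx.
by move=> /eqP; rewrite addrC addr_eq0 => /eqP.
Qed.

Lemma wedge_perm v (s : 'S_k) : wedge [ffun r => v (s r)] = (-1) ^+ s *: wedge v.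
Proof.
have [ts -> ] := prod_tpermP s.
elim: ts v => [|[p q] ts IHts] v /=.
  move=> _; rewrite big_nil odd_perm1 expr0 scale1r.
  by rewrite [X in wedge X](_ : _ = v)//; apply/ffunP=> r; rewrite ffunE perm1.
move=> /andP[pq dts]; rewrite big_cons odd_mul_tperm pq.
have -> : [ffun r => v ((tperm p q * \prod_(t <- ts) tperm t.1 t.2)%g r)] =
   [ffun r => [ffun r' => v ((\prod_(t <- ts) tperm t.1 t.2)%g r')] (tperm p q r)].
  by apply/ffunP=> r; rewrite !ffunE permM.
by rewrite wedge_tperm// IHts// signr_addb mulN1r scaleNr.
Qed.

Definition yvec B : {ffun 'I_k -> h} := [ffun p => refl_y K (B p)].

Lemma wedge_expand v : (0 < n)%N ->
  wedge v = \sum_(B : Om) (\prod_p rcoord (B p) (v p)) *: wedge (yvec B) :> E.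
Proof. by apply: (multilinear_expand (g := fun v => wedge v : E)) => *;
  exact: wedge_slot. Qed.

(** The pairing of t with the wedge of the coordinates x indexed by B. *)
Definition ell B (t : E) : K :=
  @pmod_lift K _ (@ext_rel K n k h) K^o
    (fun v => \det (\matrix_(a, b) rcoord (B b) (v a))) t.

Lemma ellP B s t : @ext_rel K n k h s t ->
  Defs.meval (fun v : {ffun 'I_k -> h} => \det (\matrix_(a,
    b) rcoord (B b) (v a)) : K^o) s =
  Defs.meval (fun v : {ffun 'I_k -> h} => \det (\matrix_(a,
    b) rcoord (B b) (v a)) : K^o) t.
Proof.
case=> [v j a x y|v i j ij vij] /=.
  rewrite -[RHS]/(a * _ + _) -[\det _ in X in _ = _ + X]mul1r.
  apply: (@determinant_multilinear _ _ _ _ _ j).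
  - apply/rowP=> b; rewrite !mxE !ffunE eqxx mul1r rcoord_linear //.
  - by apply/matrixP=> l b; rewrite !mxE !ffunE eq_sym (negPf (neq_lift _ _)).
  - by apply/matrixP=> l b; rewrite !mxE !ffunE eq_sym (negPf (neq_lift _ _)).
by apply: (determinant_alternate ij) => b; rewrite !mxE vij.
Qed.

Lemma ell_linear B : linear (ell B : E -> K^o).
Proof. exact/pmod_lift_linear/ellP. Qed.

Lemma ell_wedge B v : ell B (wedge v) = \det (\matrix_(a, b) rcoord (B b) (v a)).
Proof. exact: (pmod_lift_gen (@ellP B)). Qed.

Lemma ellD B t t' : ell B (t + t') = ell B t + ell B t'.
Proof. by have := ell_linear B 1 t t'; rewrite !scale1r. Qed.

Lemma ell0 B : ell B 0 = 0.
Proof. by apply: (addrI (ell B 0)); rewrite -ellD !addr0. Qed.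

Lemma ellZ B a t : ell B (a *: t) = a * ell B t.
Proof. by rewrite -[a *: t]addr0 ell_linear ell0 addr0. Qed.

Lemma ell_act w B t : ell (tact w B) (sn_act w t) = ell B t.
Proof.
move: t; apply: (@pmod_hom_ext _ _ _ K^o) => [a u v|a u v|v].
- by rewrite -ell_linear -sn_act_linear.
- exact: ell_linear.
- rewrite [sn_act _ _]ext_act_wedge !ell_wedge; congr (\det _).
  by apply/matrixP=> a b; rewrite !mxE !ffunE rcoord_act.
Qed.

(** The factor 1/k! compensates for the k! orderings in which a sum over all tuples meets the same
    wedge. *)
Definition yframe B : E := (k`!%:R)^-1 *: wedge (yvec B).

Lemma wedge_yvec_act w B : wedge (yvec (tact w B)) = sn_act w (wedge (yvec B) : E).
Proof.
rewrite [RHS]ext_act_wedge; congr (wedge _); apply/ffunP=> p.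
by rewrite !ffunE [RHS]refl_act_y.
Qed.

Lemma sn_actZ (tau : snModule K n) w a (t : tau) : sn_act w (a *: t) = a *: sn_act w t.
Proof.
have t0 : sn_act w (0 : tau) = 0.
  by rewrite -{1}[0](addNr (0 : tau)) -scaleN1r sn_act_linear scaleN1r addNr.
by rewrite -[a *: t]addr0 sn_act_linear t0 addr0.
Qed.

Lemma yframe_act w B : yframe (tact w B) = sn_act w (yframe B).
Proof. by rewrite /yframe sn_actZ wedge_yvec_act. Qed.

Lemma ell_frame t : (0 < n)%N -> t = \sum_B ell B t *: yframe B.
Proof.
move=> n0; move: t; apply: pmod_hom_ext => // [a u v|v].
  rewrite scaler_sumr -big_split; apply: eq_bigr => B _ /=.
  rewrite ellD ellZ scalerDl; congr (_ + _); exact: (esym (scalerA _ _ _)).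
rewrite -[pmod_gen _ _]/(wedge v).
under eq_bigr => B _.
  rewrite ell_wedge /determinant scaler_suml.
  over.
rewrite exchange_big /= (eq_bigr (fun=> (k`!%:R)^-1 *: wedge v)) => [|s _].
  rewrite sumr_const card_Sn -scaler_nat scalerA divff ?scale1r//.
  by rewrite pnatr_eq0 -lt0n fact_gt0.
rewrite (reindex_inj (h := fun B : Om => [ffun p => B (s^-1%g p)])) /=; last first.
  apply: (can_inj (g := fun B : Om => [ffun p => B (s p)])) => B.
  by apply/ffunP=> p; rewrite !ffunE permK.
rewrite [in RHS](wedge_expand v n0) scaler_sumr; apply: eq_bigr => B _.
have -> : yframe [ffun p => B (s^-1%g p)] = (-1) ^+ s *: yframe B.
  rewrite /yframe scalerA [_ * _^-1]mulrC -scalerA -[in RHS]odd_permV -wedge_perm.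
  congr (_ *: wedge _); apply/ffunP=> p; by rewrite !ffunE.
rewrite scalerA mulrAC -signr_addb addbb mul1r /yframe !scalerA [in LHS]mulrC;
  congr (_ * _ *: _); apply: eq_bigr => p _.
by rewrite mxE ffunE permK.
Qed.

End ExteriorFrame.

(** * Jucys-Murphy elements *)

Section AltSumTheory.
Variables (K : numFieldType) (n k : nat) (W : lmodType K).
Local Notation Om := {ffun 'I_k -> 'I_n}.
Variable f : Om -> W.
Hypothesis fP : altsum f.
Implicit Types (B : Om) (p q : 'I_k) (a b j : 'I_n).

Lemma altsum_ninj B : ~~ injectiveb B -> f B = 0.
Proof. by move=> /injectivePn[p [q pq Bpq]]; case: fP => f1 _ _; apply: f1 pq Bpq. Qed.

Lemma tact_injectiveb w B : injectiveb (tact w B) = injectiveb B.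
Proof.
apply/injectiveP/injectiveP => Bi p q; last by rewrite !ffunE => /perm_inj/Bi.
by move=> Bpq; apply: Bi; rewrite !ffunE Bpq.
Qed.

Lemma altsum_tact B p q : p != q -> f (tact (tperm (B p) (B q)) B) = - f B.
Proof.
move=> pq; have [Bi|nBi] := boolP (injectiveb B); last first.
  by rewrite !altsum_ninj ?oppr0// tact_injectiveb.
case: fP => _ f2 _; rewrite -(f2 B _ _ pq); congr f; apply/ffunP=> r.
rewrite !ffunE; apply/esym/inj_tperm; exact/injectiveP.
Qed.

Lemma altsum_set_entry0 B p j : j \in codom B -> j != B p -> f (set_entry B p j) = 0.
Proof.
case/codomP=> q -> Bqp; case: fP => f1 _ _.
have qp : q != p by apply: contra Bqp => /eqP->.
by apply: (f1 _ _ _ qp); rewrite !ffunE eqxx (negPf qp).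
Qed.

Lemma set_entry_id B p : set_entry B p (B p) = B.
Proof. by apply/ffunP=> q; rewrite !ffunE; case: eqP => [->|]. Qed.

Lemma tact_set_entry B p a : injective B -> a \notin codom B ->
  tact (tperm a (B p)) B = set_entry B p a.
Proof.
move=> Bi aB; apply/ffunP=> q; rewrite !ffunE; case: eqP => [->|/eqP qp].
  by rewrite tpermR.
by rewrite tpermD// 1?(inj_eq Bi) 1?eq_sym//; apply: contraNneq aB => <-;
  apply: codom_f.
Qed.

Lemma tact_id B a b : a \notin codom B -> b \notin codom B ->
  tact (tperm a b) B = B.
Proof.
move=> aB bB; apply/ffunP=> q; rewrite !ffunE tpermD//.
  by apply: contraNneq aB => ->; apply: codom_f.
by apply: contraNneq bB => ->; apply: codom_f.
Qed.

Lemma card_codomB B : injective B -> #|codom B| = k.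
Proof. by move=> Bi; rewrite card_codom// card_ord. Qed.

Lemma card_ncodomB B : injective B -> (k + #|[predC codom B]|)%N = n.
Proof. by move=> Bi; have := cardC (mem (codom B));
  rewrite card_ord (card_codomB Bi). Qed.

Lemma sum_codom (F : 'I_n -> W) B : injective B ->
  \sum_(j in codom B) F j = \sum_p F (B p).
Proof.
move=> Bi; rewrite -[LHS]big_uniq/=; last by rewrite -/(injectiveb B); apply/injectiveP.
by rewrite big_image.
Qed.

(** With a at position p, compare with the sum over all j of [f (set_entry B p j)], which is 0. The
    terms agree for j outside B, and each of the k values j in B accounts for a difference of - f
    B. *)
Lemma jucys_murphy_in B a : injective B -> a \in codom B ->
  \sum_(j | j != a) f (tact (tperm a j) B) = - k%:R *: f B.
Proof.
move=> Bi /codomP[p ->]; have [f1 f2 f3] := fP.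
transitivity (\sum_j (f (set_entry B p j) - (j \in codom B)%:R *: f B)).
  rewrite [RHS](bigD1 (B p))//= set_entry_id codom_f scale1r subrr add0r.
  apply: eq_bigr => j jp; have [jB|jB] := boolP (j \in codom B).
    rewrite altsum_set_entry0// sub0r scale1r; case/codomP: jB jp => q -> qp.
    by apply: altsum_tact; apply: contra qp => /eqP->.
  by rewrite tpermC tact_set_entry// scale0r subr0.
rewrite sumrB f3 sub0r -scaler_suml -natr_sum -big_mkcond/= scaleNr.
by rewrite sum1_card card_codomB.
Qed.

(** The n - 1 - k other indices outside B leave B unchanged, and the indices in B are replaced by a.
    The operator is thus triangular: its correction terms live on tuples containing a. *)
Lemma jucys_murphy_out B a : injective B -> a \notin codom B ->
  \sum_(j | j != a) f (tact (tperm a j) B) =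
  (n%:R - 1 - k%:R) *: f B + \sum_p f (set_entry B p a).
Proof.
move=> Bi aB; rewrite (bigID (fun j => j \in codom B))/= addrC; congr (_ + _).
  rewrite (eq_bigr (fun=> f B)) => [|j /andP[_ jB]]; last by rewrite tact_id.
  rewrite sumr_const -scaler_nat; congr (_ *: _).
  have nE : #|[predC codom B]| =
      #|[pred j | (j != a) && (j \notin codom B)]|.+1.
    rewrite (cardD1 a) inE aB add1n; apply: congr1.
    by apply: eq_card => j; rewrite !inE.
  rewrite -[n in RHS](card_ncodomB Bi) nE natrD -[_.+1%:R]natr1; ring.
rewrite (eq_bigl (fun j => j \in codom B)) => [|j]; last first.
  by rewrite andbC; case: eqP => [->|]; rewrite ?(negPf aB) ?andbT.
by rewrite (sum_codom _ Bi); apply: eq_bigr => p _; rewrite tact_set_entry.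
Qed.

(** The scalar is twice the sum of the contents of the hook (n - k, 1^k), since every transposition
    is counted twice. *)
Lemma casimir B :
  \sum_a \sum_(j | j != a) f (tact (tperm a j) B) =
  (n%:R * (n%:R - 1 - 2 * k%:R)) *: f B.
Proof.
have [/injectiveP Bi|nBi] := boolP (injectiveb B); last first.
  rewrite (altsum_ninj nBi) scaler0 big1// => a _; rewrite big1// => j _.
  by rewrite altsum_ninj// tact_injectiveb.
have [f1 f2 f3] := fP.
pose S a := \sum_(j | j != a) f (tact (tperm a j) B).
have Sin : \sum_(a in codom B) S a = (- k%:R * k%:R) *: f B.
  rewrite (sum_codom _ Bi) (eq_bigr (fun=> - k%:R *: f B)) => [|p _]; last first.
    exact/jucys_murphy_in/codom_f.
  by rewrite sumr_const card_ord -[(_ *: f B) *+ k]scaler_nat scalerA mulrC.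
(* The last - k: for each position p the replacements by indices outside B sum to - f B, as the sum
   over all replacements is 0. *)
have Sout : \sum_(a | a \notin codom B) S a =
    ((n%:R - k%:R) * (n%:R - 1 - k%:R) - k%:R) *: f B.
  rewrite (eq_bigr (fun a => (n%:R - 1 - k%:R)
    *: f B + \sum_p f (set_entry B p a))); last first.
    by move=> a; apply: jucys_murphy_out.
  rewrite big_split/= sumr_const exchange_big/= (eq_bigr (fun=> - f B)) => [|p _].
    rewrite sumr_const card_ord -[- f B *+ k]scaler_nat.
    rewrite -[(_ *: f B) *+ _]scaler_nat scalerA scalerN -scaleNr -scalerDl.
    have nE : n%:R = k%:R + #|[predC codom B]|%:R :> K.
      by rewrite -natrD card_ncodomB.
    by rewrite nE; congr (_ *: _); ring.
  have := f3 B p; rewrite (bigID (fun a => a \in codom B))/= addrC.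
  move=> /eqP; rewrite addr_eq0 => /eqP->; congr (- _).
  rewrite (bigD1 (B p)) ?codom_f//= set_entry_id big1 ?addr0// => j /andP[jB jp].
  exact: altsum_set_entry0.
rewrite (bigID (fun a => a \in codom B))/= Sin Sout -scalerDl; congr (_ *: _).
ring.
Qed.

End AltSumTheory.

Lemma altsum_additive (n k : nat) (V W : zmodType) (g : V -> W)
  (f : {ffun 'I_k -> 'I_n} -> V) :
  (forall x y, g (x + y) = g x + g y) -> altsum f -> altsum (g \o f).
Proof.
move=> gD [f1 f2 f3]; have g0 : g 0 = 0 by apply: (addrI (g 0)); rewrite -gD !addr0.
split=> [B p q pq Bpq|B p q pq|B p] /=; first by rewrite (f1 _ _ _ pq Bpq).
  by rewrite (f2 _ _ _ pq); apply/eqP; rewrite -addr_eq0 -gD addNr g0.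
by rewrite -(big_morph g gD g0) f3.
Qed.

Section AltSumExterior.
Variables (K : numFieldType) (n k : nat).
Local Notation h := (reflection K n).
Local Notation E := (exterior k h).
Local Notation Om := {ffun 'I_k -> 'I_n}.

Lemma wedge_altsum : altsum (fun B : Om => wedge (yvec K B) : E).
Proof.
split=> [B p q pq Bpq|B p q pq|B p] /=.
- by apply: (wedge_alt pq); rewrite !ffunE Bpq.
- by rewrite -(wedge_tperm _ pq); congr (wedge _ : E); apply/ffunP=> r; rewrite !ffunE.
- have yu j : yvec K (set_entry B p j) = set_slot (yvec K B) p (refl_y K j).
    by apply/ffunP=> q; rewrite !ffunE; case: eqP.
  under eq_bigr do rewrite yu.
  have W0 : wedge (set_slot (yvec K B) p 0) = 0 :> E.
    have := wedge_slot (yvec K B) p (-1) 0 0.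
    by rewrite scaler0 addr0 scaleN1r addNr.
  by rewrite -(big_morph _ (wedge_slotD (yvec K B) p) W0) refl_y_sum0.
Qed.

Lemma ell_hom_ext (f g : E -> K^o) : linear f -> linear g ->
  (forall v, f (wedge v) = g (wedge v)) -> f =1 g.
Proof. exact: pmod_hom_ext. Qed.

Lemma ell_altsum (t : E) : altsum (fun B : Om => ell B t).
Proof.
split=> [B p q pq Bpq|B p q pq|B p] /=.
- apply: (ell_hom_ext (g := fun=> 0)) => [||v]; first exact: ell_linear.
    by move=> a u v; rewrite scaler0 addr0.
  rewrite ell_wedge -det_tr; apply: (determinant_alternate pq) => a.
  by rewrite !mxE Bpq.
- apply: (ell_hom_ext (g := fun t => - ell B t)) => [||v]; first exact: ell_linear.
    by move=> a u v; rewrite ell_linear opprD scalerN.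
  rewrite !ell_wedge [X in \det X](_ : _ =
    xcol p q (\matrix_(a, b) rcoord (B b) (v a))).
    by rewrite xcolE det_mulmx det_perm odd_tperm pq mulrN1.
  by apply/matrixP=> a b; rewrite !mxE !ffunE.
- apply: (ell_hom_ext (f := fun t => \sum_j ell (set_entry B p j) t) (g :=
  fun=> 0)) => [a u v|a u v|v].
  + rewrite scaler_sumr -big_split; apply: eq_bigr => j _ /=; exact: ell_linear.
  + by rewrite scaler0 addr0.
  under eq_bigr => j _ do rewrite ell_wedge (expand_det_col _ p).
  rewrite exchange_big big1//= => a _.
  pose M j : 'M[K]_k := \matrix_(a, b) rcoord (set_entry B p j b) (v a).
  rewrite [LHS](_ : _ = \sum_j rcoord j (v a) * cofactor (M (B p)) a p).
    by rewrite -mulr_suml rcoord_sum0 mul0r.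
  apply: eq_bigr => j _; rewrite mxE ffunE eqxx; congr (_ * (_ * \det _)).
  by apply/matrixP=> b d; rewrite !mxE !ffunE eq_sym (negPf (neq_lift _ _)).
Qed.

End AltSumExterior.

Definition tcons n k (j : 'I_n) (B : {ffun 'I_k -> 'I_n}) : {ffun 'I_k.+1 -> 'I_n} :=
  [ffun p => if unlift ord0 p is Some q then B q else j].

Lemma ell_tcons (K : numFieldType) n k (j : 'I_n) (B : {ffun 'I_k -> 'I_n})
    (v : {ffun 'I_k.+1 -> reflection K n}) :
  ell (tcons j B) (wedge v) =
  \sum_a rcoord j (v a) * ((-1) ^+ a * ell B (wedge [ffun p => v (lift a p)])).
Proof.
rewrite ell_wedge (expand_det_col _ ord0); apply: eq_bigr => a _.
rewrite mxE ffunE unlift_none ell_wedge; congr (_ * _).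
rewrite /cofactor addn0; congr (_ * \det _).
by apply/matrixP=> b d; rewrite !mxE !ffunE liftK.
Qed.

(** * Uniqueness of polynomial solutions of the KZ equations *)

(* W is the coefficient of X_o^r in a solution of the KZ equations of degree at
   most r in X_o: it is an eigenvector of eigenvalue r / c for the difference of
   the Jucys-Murphy elements of o acting on its two arguments. On linear
   maps from the (i+1)-st to the i-th exterior power that difference has the
   eigenvalues n, 1 and 2 - n, so r is m, c or (2 - n) c. *)
Section LeadingTerm.
Variables (K : numFieldType) (n i m : nat) (c : K) (V : lmodType K).
Hypothesis i_lt : (i.+2 <= n)%N.
Hypothesis cn : c * n%:R = m%:R.
Hypothesis c_nat : forall r : nat, c != r%:R.
Variables (o : 'I_n) (r : nat).
Implicit Types (A : {ffun 'I_i.+1 -> 'I_n}) (B : {ffun 'I_i -> 'I_n}).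
Variable W : {ffun 'I_i.+1 -> 'I_n} -> {ffun 'I_i -> 'I_n} -> V.
Hypothesis WA : forall B, altsum (W^~ B).
Hypothesis WB : forall A, altsum (W A).
Hypothesis Weq : forall (A : {ffun 'I_i.+1 -> 'I_n}) (B : {ffun 'I_i -> 'I_n}),
  r%:R *: W A B =
  c *: (\sum_(j | j != o) W A (tact (tperm o j) B) -
        \sum_(j | j != o) W (tact (tperm o j) A) B).

Let WA_ninj A B : ~~ injectiveb A -> W A B = 0.
Proof. exact: (@altsum_ninj _ _ _ _ (W^~ B) (WA B) A). Qed.

Let WB_ninj A B : ~~ injectiveb B -> W A B = 0.
Proof. exact: (@altsum_ninj _ _ _ _ (W A) (WB A) B). Qed.

Let jucys_murphyA_in A B : injective A -> o \in codom A ->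
  \sum_(j | j != o) W (tact (tperm o j) A) B = - i.+1%:R *: W A B.
Proof. exact: (jucys_murphy_in (WA B)). Qed.

Let jucys_murphyA_out A B : injective A -> o \notin codom A ->
  \sum_(j | j != o) W (tact (tperm o j) A) B =
  (n%:R - 1 - i.+1%:R) *: W A B + \sum_p W (set_entry A p o) B.
Proof. exact: (jucys_murphy_out (W^~ B)). Qed.

(** The two Jucys-Murphy elements act by - i and - (i + 1) here. Their difference 1 would force r =
    c. *)
Lemma lead_in_in A B : injective A -> injective B ->
  o \in codom A -> o \in codom B -> W A B = 0.
Proof.
move=> Ai Bi oA oB; have := Weq A B.
rewrite (jucys_murphy_in (WB A) Bi oB) (jucys_murphyA_in B Ai oA).
rewrite -scalerBl scalerA => /eqP; rewrite -subr_eq0 -scalerBl scaler_eq0.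
case/orP=> [|/eqP//]; rewrite -natr1 opprK addrA addNr add0r mulr1 subr_eq0.
by rewrite eq_sym (negPf (c_nat r)).
Qed.

(** The correction terms put o into B and vanish by [lead_in_in]. The remaining eigenvalue is n, so
    a nonzero value would force r = c n = m. *)
Lemma lead_in_out A B : injective A -> injective B ->
  o \in codom A -> o \notin codom B -> r != m -> W A B = 0.
Proof.
move=> Ai Bi oA oB rm; have := Weq A B.
rewrite (jucys_murphy_out (W A) Bi oB) [X in _ + X - _]big1 => [|p _]; last first.
  have [/injectiveP ui|ui] := boolP (injectiveb (set_entry B p o)).
    apply: lead_in_in => //; apply/codomP; exists p; by rewrite ffunE eqxx.
  exact: WB_ninj ui.
rewrite (jucys_murphyA_in B Ai oA) addr0.
rewrite -scalerBl scalerA -natr1 => /eqP; rewrite -subr_eq0 -scalerBl scaler_eq0.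
case/orP=> [|/eqP//].
have -> : r%:R - c * (n%:R - 1 - i%:R - - (i%:R + 1)) = r%:R - m%:R :> K.
  by rewrite -cn; ring.
by rewrite subr_eq0 eqr_nat (negPf rm).
Qed.

Lemma c_gt0 : 0 < c.
Proof.
have n0 : 0 < n%:R :> K by rewrite ltr0n; case: n i_lt.
rewrite -(pmulr_lgt0 _ n0) cn ltr0n lt0n; apply/eqP => m0.
move: (c_nat 0); rewrite -(mulfK (lt0r_neq0 n0) c) cn m0 mul0r.
by rewrite eqxx.
Qed.

(** Triangular elimination: once all A containing o are settled, the correction terms of an A
    without o vanish. The eigenvalue is then 2 - n if o lies in B and 1 otherwise, and neither is
    compatible with r. *)
Lemma lead_eq0 :
  (forall A B, injective A -> injective B -> o \in codom A -> o \notin codom B ->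
    W A B = 0) ->
  forall A B, W A B = 0.
Proof.
move=> W0 A B.
have [/injectiveP Ai|Ai] := boolP (injectiveb A); last exact: WA_ninj Ai.
have [/injectiveP Bi|Bi] := boolP (injectiveb B); last exact: WB_ninj Bi.
have W1 A' B' : injective B' -> o \in codom A' -> W A' B' = 0.
  move=> Bi' oA; have [/injectiveP Ai'|Ai'] := boolP (injectiveb A'); last first.
    exact: WA_ninj Ai'.
  by have [oB|oB] := boolP (o \in codom B'); [exact: lead_in_in | exact: W0].
have [oA|oA] := boolP (o \in codom A); first exact: W1.
have Weq' B' : r%:R *: W A B' =
    c *: (\sum_(j | j != o) W A (tact (tperm o j) B') -
          (n%:R - 1 - i.+1%:R) *: W A B').
  rewrite Weq (jucys_murphyA_out B' Ai oA) [X in _ - (_ + X)]big1 ?addr0// => p _.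
  have [/injectiveP Bi'|Bi'] := boolP (injectiveb B'); last exact: WB_ninj Bi'.
  by apply: W1 => //; apply/codomP; exists p; rewrite ffunE eqxx.
have W2 B' : o \in codom B' -> W A B' = 0.
  have [/injectiveP Bi'|Bi'] := boolP (injectiveb B'); last first.
    by move=> _; exact: WB_ninj Bi'.
  move=> oB'; have := Weq' B'; rewrite (jucys_murphy_in (WB A) Bi' oB').
  rewrite -scalerBl scalerA => /eqP; rewrite -subr_eq0 -scalerBl scaler_eq0.
  case/orP=> [|/eqP//]; rewrite -natr1.
  have -> : r%:R - c * (- i%:R - (n%:R - 1 - (i%:R + 1))) =
            r%:R + c * (n - 2)%:R :> K.
    by rewrite natrB; [ring | apply: leq_trans i_lt].
  (* Strict even for r = 0: o is an entry of B', so i >= 1 and n >= 3. *)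
  have : 0 < r%:R + c * (n - 2)%:R :> K.
    rewrite ltr_wpDl ?ler0n// mulr_gt0 ?c_gt0// ltr0n subn_gt0.
    by apply: leq_trans i_lt; rewrite !ltnS; case/codomP: oB' => -[q qi] _;
      apply: leq_ltn_trans qi.
  by move=> /lt0r_neq0/negPf->.
have [oB|oB] := boolP (o \in codom B); first exact: W2.
have := Weq' B; rewrite (jucys_murphy_out (W A) Bi oB)
  [X in _ + X - _]big1 ?addr0 => [|p _].
  rewrite -scalerBl scalerA => /eqP; rewrite -subr_eq0 -scalerBl scaler_eq0.
  case/orP=> [|/eqP//]; rewrite -natr1.
  have -> : r%:R - c * (n%:R - 1 - i%:R - (n%:R - 1 - (i%:R + 1))) = r%:R - c :> K.
    by ring.
  by rewrite subr_eq0 eq_sym (negPf (c_nat r)).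
by apply: W2; apply/codomP; exists p; rewrite ffunE eqxx.
Qed.

End LeadingTerm.

(** * Schur's lemma for the stabilizer of one index *)

Section Schur.
Variables (K : numFieldType) (n i : nat) (o : 'I_n).
Variable w : {ffun 'I_i.+1 -> 'I_n} -> {ffun 'I_i -> 'I_n} -> K^o.
Implicit Types (A : {ffun 'I_i.+1 -> 'I_n}) (B : {ffun 'I_i -> 'I_n}).
Hypothesis wA : forall B, altsum (w^~ B).
Hypothesis wB : forall A, altsum (w A).
Hypothesis w_act : forall (s : 'S_n) A B, s o = o -> w (tact s A) (tact s B) = w A B.
Hypothesis w_in_in : forall A B, injective A -> injective B ->
  o \in codom A -> o \in codom B -> w A B = 0.

Lemma altsum_perm0 k (V : zmodType) (f : {ffun 'I_k -> 'I_n} -> V)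
    (C : {ffun 'I_k -> 'I_n}) (s : 'S_k) :
  altsum f -> f C = 0 -> f [ffun p => C (s p)] = 0.
Proof.
move=> [_ f2 _]; have [ts -> ] := prod_tpermP s.
elim: ts C => [|[p q] ts IHts] C /=.
  by move=> _ fC; rewrite big_nil -[RHS]fC; congr f; apply/ffunP=> r;
    rewrite ffunE perm1.
move=> /andP[pq dts] fC; rewrite big_cons /=.
rewrite [X in f X](_ : _ = [ffun r => [ffun r' =>
    C ((\prod_(t <- ts) tperm t.1 t.2)%g r')] (tperm p q r)]); last first.
  by apply/ffunP=> r; rewrite !ffunE permM.
by rewrite (f2 _ _ _ pq) IHts ?oppr0.
Qed.

Lemma perm_extend k (C D : 'I_k -> 'I_n) : injective C -> injective D ->
  exists s : 'S_n, forall p, s (C p) = D p.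
Proof.
move=> Ci Di.
have : forall d, (d <= k)%N -> exists s : 'S_n, forall p : 'I_k,
  (p < d)%N -> s (C p) = D p.
  elim=> [_|d IHd dk]; first by exists 1%g.
  have [s sP] := IHd (ltnW dk); pose q := Ordinal dk.
  exists (s * tperm (s (C q)) (D q))%g => p; rewrite permM ltnS leq_eqVlt.
  case/orP=> [/eqP pd|pd].
    have -> : p = q by apply: val_inj.
    by rewrite tpermL.
  have pq : q != p by rewrite -val_eqE /= gtn_eqF.
  by rewrite (sP p pd) tpermD ?(inj_eq Di)// -(sP p pd) (inj_eq perm_inj) (inj_eq Ci).
move=> /(_ k (leqnn k))[s sP]; exists s => p; exact/sP/ltn_ord.
Qed.

Lemma eqrN0 (x : K) : x = - x -> x = 0.
Proof.
by move/eqP; rewrite -addr_eq0 -mulr2n mulrn_eq0 /= => /eqP.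
Qed.

Variable B0 : {ffun 'I_i -> 'I_n}.
Hypothesis B0_inj : injective B0.
Hypothesis oB0 : o \notin codom B0.
Hypothesis w0 : w (tcons o B0) B0 = 0.

Lemma codom_tcons j : (j \in codom (tcons o B0)) = (j == o) || (j \in codom B0).
Proof.
apply/codomP/orP=> [[p ->]|[/eqP->|/codomP[p ->]]].
- by rewrite ffunE; case: unliftP => [q _|_]; [right; apply: codom_f | left].
- by exists ord0; rewrite ffunE unlift_none.
- by exists (lift ord0 p); rewrite ffunE liftK.
Qed.

Lemma tcons_inj : injective (tcons o B0).
Proof.
move=> p q; rewrite !ffunE; case: unliftP => [p' ->|->]; case: unliftP => [q' ->|->] //.
- by move=> /B0_inj->.
- by move=> e; case/negP: oB0; rewrite -e codom_f.
- by move=> e; case/negP: oB0; rewrite e codom_f.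
Qed.

(** Permutations of the indices outside [tcons o B0] fix that tuple. With the alternating and
    sum-zero rules this reduces every value to [w (tcons o B0) B0], which is 0. *)
Lemma schur_base B : injective B -> o \notin codom B -> w (tcons o B0) B = 0.
Proof.
move=> Bi oB; set A0 := tcons o B0.
(* Such a B' is a rearrangement of B0, so only a sign is at stake. *)
have c0 B' : injective B' -> {subset codom B' <= codom B0} -> w A0 B' = 0.
  move=> Bi' sub; have sP p : exists q, B' p == B0 q.
    by have /codomP[q ->] := sub _ (codom_f B' p); exists q.
  pose f p := xchoose (sP p); have fP p : B' p = B0 (f p)
    by exact/eqP/(xchooseP (sP p)).
  have fi : injective f by move=> p q fpq; apply: Bi'; rewrite !fP fpq.
  rewrite (_ : B' = [ffun p => B0 (perm fi p)]); last first.
    by apply/ffunP=> p; rewrite ffunE permE.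
  exact: altsum_perm0.
have [/allP sub|] := boolP (all (mem (codom B0)) (codom B)); first exact: c0.
case/allPn=> j /codomP[p jp] jB0'; have jB0 : j \notin codom B0 by [].
have jo : j != o by apply: contraNneq oB => <-; rewrite jp codom_f.
(* Two entries outside B0: their transposition fixes A0 and changes the sign at B. *)
have [/existsP[q /andP[qp qB0]]|/existsPn nq] :=
    boolP [exists q, (q != p) && (B q \notin codom B0)].
  have qo : B q != o by apply: contraNneq oB => <-; rewrite codom_f.
  apply: eqrN0; rewrite -(altsum_tact (wB A0) B qp).
  rewrite -[LHS](@w_act (tperm (B q) (B p))); last by rewrite tpermD// -jp.
  by rewrite (@tact_id _ _ A0)// codom_tcons negb_or ?qo ?qB0 -?jp ?jo.
(* Now j is the only entry of B outside B0. In the zero sum over that entry, [P] selects the b whose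
   term equals w A0 B by a transposition fixing A0. The other terms vanish, so a positive multiple
   of w A0 B is 0. *)
have sumB : \sum_b w A0 (set_entry B p b) = 0 by case: (wB A0).
pose P b := (b \notin codom B0) && (b != o) && ((b == j) || (b \notin codom B)).
move: sumB; rewrite (bigID P)/= [X in _ + X]big1 ?addr0 => [|b].
  rewrite (eq_bigr (fun=> w A0 B)) => [|b /andP[/andP[bB0 bo] bj]].
    rewrite sumr_const => /eqP; rewrite mulrn_eq0 => /orP[|/eqP//].
    rewrite -leqn0 leqNgt; case/negP; apply/card_gt0P; exists j.
    by rewrite unfold_in /P jB0 jo eqxx.
  have [->|nbj] := eqVneq b j; first by rewrite jp set_entry_id.
  move: bj; rewrite (negPf nbj) /= => bB.
  rewrite -(tact_set_entry p Bi bB) -[in RHS](@w_act (tperm b (B p))) -?jp ?tpermD//.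
  by rewrite (@tact_id _ _ A0)// codom_tcons negb_or ?bo ?bB0 -?jp ?jo.
rewrite /P !negb_and negb_or !negbK => bP.
have [bB|bB] := boolP (b \in codom B).
  have [bj|bj] := eqVneq b (B p); last exact: (altsum_set_entry0 (wB A0)).
  by move: bP; rewrite bB bj -jp (negPf jB0) eqxx (negPf jo).
have ui : injective (set_entry B p b).
  rewrite -(tact_set_entry p Bi bB) => x y; rewrite !ffunE; by move=> /perm_inj/Bi.
move: bP; rewrite (negPf bB) andbF orbF => /orP[bB0|/eqP bo]; last first.
  apply: w_in_in => //; first exact: tcons_inj.
    by rewrite codom_tcons eqxx.
  by apply/codomP; exists p; rewrite ffunE eqxx bo.
apply: c0 => // x /codomP[q ->]; rewrite ffunE; case: eqP => [//|/eqP qp].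
by move: (nq q); rewrite qp /= negbK.
Qed.

(** At the cost of a sign o moves to slot 0. A permutation fixing o then carries [tcons o B0] to A,
    and [schur_base] applies. *)
Lemma schur_in_out A B : injective A -> injective B ->
  o \in codom A -> o \notin codom B -> w A B = 0.
Proof.
move=> Ai Bi /codomP[p op] oB.
wlog p0 : A p Ai op / p = ord0 => [IH|].
  have [p0|p0] := eqVneq p ord0; first exact: (IH A p).
  have [_ f2 _] := wA B; apply/eqP; rewrite -oppr_eq0 -(f2 A p ord0 p0); apply/eqP.
  apply: (IH _ ord0) => // [x y|]; last by rewrite ffunE tpermR.
  by rewrite !ffunE => /Ai/perm_inj.
have [s sP] := perm_extend tcons_inj Ai.
have so : s o = o by rewrite {2}op p0 -sP ffunE unlift_none.
have -> : A = tact s (tcons o B0) by apply/ffunP=> q; rewrite ffunE sP.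
rewrite -[B](tactVK s) w_act//; apply: schur_base => [x y|].
  by rewrite !ffunE => /perm_inj/Bi.
apply: contra oB => /codomP[q oq]; apply/codomP; exists q.
by move: oq; rewrite ffunE => /(congr1 s); rewrite permKV so.
Qed.

End Schur.

(** * Expansion in powers of one variable *)

Section Expansion.
Variables (K : numFieldType) (n : nat).
Implicit Types p q : {mpoly K[n]}.

Lemma mcoeff_euler p mu :
  (\sum_a 'X_a * p^`M(a))@_mu = (mdeg mu)%:R * p@_mu.
Proof.
elim/mpolyind: p => [|a m p _ _ IHp].
  by rewrite big1 ?mcoeff0 ?mulr0// => a _; rewrite mderiv0 mulr0.
under eq_bigr do rewrite mderivD mulrDr.
rewrite big_split /= !mcoeffD mulrDr IHp; congr (_ + _).
rewrite (_ : \sum_j _ = (mdeg m)%:R *: (a *: 'X_[m])).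
  by rewrite !mcoeffZ mcoeffX; case: eqP => [->//|]; rewrite !mulr0.
rewrite mdegE natr_sum scaler_suml; apply: eq_bigr => j _.
rewrite mderivZ mderivX -!scalerAr -mpolyXD !scalerA mulrC.
have [->|mj] := eqVneq (m j) 0%N; first by rewrite mul0r !scale0r.
by rewrite addmC submK// lep1mP.
Qed.

End Expansion.

(** Coefficients stay in the ring of n variables, though X_o no longer occurs in them; evaluating
    the new variable at X_o then gives the polynomial back. *)
Definition univar_gen (K : numFieldType) n (o a : 'I_n) : {poly {mpoly K[n]}} :=
  if a == o then 'X else ('X_a)%:P.

HB.lock Definition univar (K : numFieldType) n (o : 'I_n) (p : {mpoly K[n]}) :
    {poly {mpoly K[n]}} :=
  mmap (polyC \o @mpolyC n K) (@univar_gen K n o) p.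

Section LastVariable.
Variables (K : numFieldType) (n : nat) (o : 'I_n).
Implicit Types p q : {mpoly K[n]}.
Local Notation texp := (@univar_gen K n o).
Local Notation univar := (@univar K n o).

Lemma univarD p q : univar (p + q) = univar p + univar q.
Proof. by rewrite univar.unlock; apply: mmapD. Qed.
Lemma univarB p q : univar (p - q) = univar p - univar q.
Proof. by rewrite univar.unlock; apply: mmapB. Qed.
Lemma univarM p q : univar (p * q) = univar p * univar q.
Proof. by rewrite univar.unlock; apply: rmorphM. Qed.
Lemma univarX a : univar 'X_a = texp a.
Proof. by rewrite univar.unlock; apply: mmapXU. Qed.
Lemma univarC (a : K) : univar a%:MP = a%:MP%:P.
Proof. by rewrite univar.unlock; apply: mmapC. Qed.
Lemma univarZ (a : K) p : univar (a *: p) = a%:MP *: univar p.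
Proof. by rewrite -mul_mpolyC univarM univarC mul_polyC. Qed.
Lemma univar_sum (I : finType) (P : pred I) (F : I -> {mpoly K[n]}) :
  univar (\sum_(i | P i) F i) = \sum_(i | P i) univar (F i).
Proof.
apply: (big_morph univar univarD).
by rewrite -mpolyC0 univarC polyC0.
Qed.

Lemma univarK p : (univar p).['X_o] = p.
Proof.
elim/mpoly_gen_ind: p => [a|p q IHp IHq|j p IHp].
- by rewrite univarC hornerC.
- by rewrite univarD hornerD IHp IHq.
- rewrite univarM univarX hornerM IHp /univar_gen.
  by case: eqP => [->|_]; rewrite ?hornerX ?hornerC.
Qed.

Lemma univar_deriv p : (univar p)^`() = univar p^`M(o).
Proof.
elim/mpoly_gen_ind: p => [a|p q IHp IHq|j p IHp].
- by rewrite mderivC -mpolyC0 !univarC derivC.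
- by rewrite mderivD !univarD derivD IHp IHq.
- rewrite mderivM mderivXU univarD !univarM derivM IHp univarX; congr (_ * _ + _).
  rewrite /univar_gen; case: eqP => _; last by rewrite derivC mulr0n -mpolyC0 univarC.
  by rewrite derivX mulr1n -mpolyC1 univarC.
Qed.

Lemma univar_mono mu : mmap1 texp mu =
  (\prod_(a | a != o) 'X_a ^+ mu a)%:P * 'X^(mu o) :> {poly {mpoly K[n]}}.
Proof.
rewrite /mmap1 (bigD1 o)//= {1}/univar_gen eqxx mulrC rmorph_prod/=; congr (_ * _).
by apply: eq_bigr => a ao; rewrite /univar_gen (negPf ao) rmorphXn.
Qed.

(** All monomials have degree m, so only the pure power X_o^m contributes and its coefficient is a
    constant. *)
Lemma univar_coef_top m p : (forall mu, p@_mu != 0 -> mdeg mu = m) ->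
  (univar p)`_m = (p@_(U_(o) *+ m)%MM)%:MP.
Proof.
move=> pm; rewrite univar.unlock /mmap coef_sum.
rewrite (eq_big_seq (fun mu => (p@_mu * (mu == (U_(o) *+ m)%MM)%:R)%:MP)); last first.
  move=> mu; rewrite mcoeff_msupp => /pm mum.
  rewrite /= coefCM univar_mono coefCM coefXn mpolyCM.
  congr (_ * _); have [muE|/eqP muo] := eqVneq mu (U_(o) *+ m)%MM.
    rewrite muE mulmnE mnm1E eqxx mul1n eqxx mulr1 big1 ?mpolyC1// => a ao.
    by rewrite mulmnE mnm1E eq_sym (negPf ao) expr0.
  have [mo|] := eqVneq m (mu o); last by rewrite mulr0 mpolyC0.
  case: muo; apply/mnmP => a; rewrite mulmnE mnm1E.
  have [<-|oa] := eqVneq o a; first by rewrite mul1n.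
  move: mum; rewrite mdegE (bigD1 o)//= mo => /eqP.
  rewrite -[X in _ == X]addn0 eqn_add2l sum_nat_eq0 => /forallP/(_ a).
  by rewrite eq_sym oa => /eqP->.
have [ms|ms] := boolP ((U_(o) *+ m)%MM \in msupp p).
  rewrite (bigD1_seq _ ms (msupp_uniq p))/= eqxx mulr1 big1 ?addr0// => mu.
  by move=> /negPf->; rewrite mulr0 mpolyC0.
rewrite (memN_msupp_eq0 ms) big_seq big1 ?mpolyC0// => mu mus.
by case: eqP mus ms => [->->|]//; rewrite mulr0 mpolyC0.
Qed.

End LastVariable.

Section KZUniqueness.
Variables (K : numFieldType) (n i m : nat) (c : K).
Hypothesis i_lt : (i.+2 <= n)%N.
Hypothesis cn : c * n%:R = m%:R.
Hypothesis c_nat : forall r : nat, c != r%:R.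
Variable F : {ffun 'I_i.+1 -> 'I_n} -> {ffun 'I_i -> 'I_n} -> {mpoly K[n]}.
Implicit Types (A : {ffun 'I_i.+1 -> 'I_n}) (B : {ffun 'I_i -> 'I_n}).
Hypothesis FA : forall B, altsum (F^~ B).
Hypothesis FB : forall A, altsum (F A).
Hypothesis F_act : forall w A B, msym w (F A B) = F (tact w A) (tact w B).
Hypothesis F_kz : forall a A B, (F A B)^`M(a) =
  c *: \sum_(j | j != a) ddiff a j (F A (tact (tperm a j) B)).

Let q A B a j := ddiff a j (F A (tact (tperm a j) B)).

(** Equivariance trades the reflection of the variables for one of A. This turns the Dunkl form of
    the equations into the KZ form. *)
Lemma kz_quot A B a j : ('X_a - 'X_j) * q A B a j =
  F A (tact (tperm a j) B) - F (tact (tperm a j) A) B.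
Proof. by rewrite ddiffE F_act -tactM tperm2 tact1. Qed.

(** Averaging (a, j) with (j, a) replaces X_a by (X_a - X_j) / 2, so by [kz_quot] only the two
    scalars of [casimir] remain. They differ by 2 n, and c n = m. *)
Lemma kz_euler A B : \sum_a 'X_a * (F A B)^`M(a) = m%:R *: F A B.
Proof.
pose S := \sum_a \sum_(j | j != a) 'X_a * q A B a j.
have -> : \sum_a 'X_a * (F A B)^`M(a) = c *: S.
  rewrite scaler_sumr; apply: eq_bigr => a _.
  by rewrite F_kz -scalerAr mulr_sumr.
have S2 : S = - \sum_a \sum_(j | j != a) 'X_j * q A B a j.
  rewrite {1}/S (exchange_big_dep xpredT)//= -sumrN; apply: eq_bigr => j _.
  rewrite -sumrN; apply: eq_big => [a|a ja]; first by rewrite eq_sym.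
  by rewrite /q (ddiff_swap _ ja) tpermC mulrN.
have SS : 2%:R *: S = (2%:R * n%:R) *: F A B.
  rewrite scaler_nat mulr2n {2}S2 -sumrB.
  under eq_bigr => a _.
    rewrite -sumrB.
    under eq_bigr do rewrite -mulrBl kz_quot.
    rewrite sumrB.
    over.
  rewrite sumrB (casimir (FB A)) (casimir (FA B)) -scalerBl; congr (_ *: _).
  by rewrite -natr1; ring.
have two : 2%:R != 0 :> K by rewrite pnatr_eq0.
by apply: (scalerI two); rewrite scalerA [2%:R * c]mulrC -scalerA SS !scalerA -cn;
  congr (_ *: _); ring.
Qed.

Lemma kz_homog A B mu : (F A B)@_mu != 0 -> mdeg mu = m.
Proof.
move=> Fmu; have := mcoeff_euler (F A B) mu; rewrite kz_euler mcoeffZ.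
by move=> /(mulIf Fmu)/eqP; rewrite eqr_nat => /eqP.
Qed.

Variable o : 'I_n.

(** Compare coefficients of X_o^(r - 1). Division by the monic X_o - X_j lowers the degree by one
    and keeps the top coefficient, while the derivative contributes r. For r = 0 the quotients
    vanish. *)
Lemma kz_lead r :
  (forall A B, (size (univar o (F A B)) <= r.+1)%N) ->
  forall A B, r%:R *: (univar o (F A B))`_r =
    c *: (\sum_(j | j != o) (univar o (F A (tact (tperm o j) B)))`_r -
          \sum_(j | j != o) (univar o (F (tact (tperm o j) A) B))`_r).
Proof.
move=> sz A B.
have Qr j : j != o ->
    (univar o (F A (tact (tperm o j) B)))`_r - (univar o (F (tact (tperm o j) A)
      B))`_r =
    if r is r'.+1 then (univar o (q A B o j))`_r' else 0.
  move=> jo; set Q := univar o (q A B o j).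
  have QE : ('X - ('X_j)%:P) * Q =
      univar o (F A (tact (tperm o j) B)) - univar o (F (tact (tperm o j) A) B).
    by rewrite -!univarB -kz_quot univarM univarB !univarX /univar_gen eqxx (negPf jo).
  have szQ : (size Q <= r)%N.
    have [->|Q0] := eqVneq Q 0; first by rewrite size_poly0.
    have: (size (('X - ('X_j)%:P) * Q)%R <= r.+1)%N.
      rewrite QE (leq_trans (size_polyD _ _))// size_polyN geq_max !sz//.
    by rewrite (size_monicM (monicXsubC _) Q0) size_XsubC.
  rewrite -coefB -QE mulrBl coefB coefXM coefCM (nth_default _ szQ) mulr0 subr0.
  by case: (r).
rewrite -sumrB (eq_bigr _ Qr); case: r {sz} Qr => [|r] Qr.
  by rewrite scale0r big1 ?scaler0.
rewrite scaler_nat -[LHS]coef_deriv univar_deriv F_kz univarZ univar_sum coefZ coef_sum.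
exact: mul_mpolyC.
Qed.

Lemma univar_altsum_A r B : altsum (fun A => (univar o (F A B))`_r).
Proof.
apply: (altsum_additive (g := fun p => (univar o p)`_r) _ (FA B)) => x y.
by rewrite univarD coefD.
Qed.

Lemma univar_altsum_B r A : altsum (fun B => (univar o (F A B))`_r).
Proof.
apply: (altsum_additive (g := fun p => (univar o p)`_r) _ (FB A)) => x y.
by rewrite univarD coefD.
Qed.

Lemma kz_bound : exists d, forall A B, (size (univar o (F A B)) <= d)%N.
Proof.
exists (\max_A \max_B size (univar o (F A B))) => A B.
by apply: leq_trans (leq_bigmax A); apply: (leq_bigmax B).
Qed.

(** Descent from an arbitrary bound: a top coefficient in degree d > m satisfies the eigenvalue
    equation with r != m, hence is 0. *)
Lemma kz_size A B : (size (univar o (F A B)) <= m.+1)%N.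
Proof.
have [d] := kz_bound; elim: d A B => [|d IHd] A B sz.
  by rewrite (leq_trans (sz A B)).
have [dm|dm] := leqP d m; first exact: leq_trans (sz A B) _.
apply: IHd => A' B'; apply/leq_sizeP => j dj.
have [-> {j dj}|jd] := eqVneq j d; last first.
  by apply: nth_default; apply: leq_trans (sz A' B') _; rewrite ltn_neqAle eq_sym jd.
have dm' : d != m by rewrite gtn_eqF.
apply: (lead_eq0 i_lt cn c_nat (univar_altsum_A d) (univar_altsum_B d) (kz_lead sz)).
move=> A1 B1 Ai Bi oA oB.
exact: (lead_in_out cn c_nat (univar_altsum_A d) (univar_altsum_B d) (kz_lead sz)).
Qed.

Lemma kz_top_coef A B : (univar o (F A B))`_m = ((F A B)@_(U_(o) *+ m)%MM)%:MP.
Proof. by apply: univar_coef_top => mu; apply: kz_homog. Qed.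

(** The same descent continued from m downwards: the hypothesis removes the coefficient of X_o^m,
    and no later exponent equals m. *)
Lemma kz_coef_eq0 : (forall A B, (F A B)@_(U_(o) *+ m)%MM = 0) ->
  forall A B, F A B = 0.
Proof.
move=> F0; have sz d : (d <= m.+1)%N -> forall A B,
  (size (univar o (F A B)) <= m.+1 - d)%N.
  elim: d => [_ A B|d IHd dm A B]; first by rewrite subn0 kz_size.
  have sz := IHd (ltnW dm); apply/leq_sizeP => j; rewrite subSS => dj.
  have dE : (m.+1 - d = (m - d).+1)%N by rewrite subSn.
  have [-> {j dj}|jd] := eqVneq j (m - d)%N; last first.
    apply: nth_default; apply: leq_trans (sz A B) _.
    by rewrite dE ltn_neqAle eq_sym jd.
  rewrite dE in sz.
  apply: (lead_eq0 i_lt cn c_nat (univar_altsum_A _) (univar_altsum_B _) (kz_lead sz)).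
  move=> A1 B1 Ai Bi oA oB; have [dm0|dm0] := eqVneq (m - d)%N m.
    by rewrite dm0 kz_top_coef F0 mpolyC0.
  exact: (lead_in_out cn c_nat (univar_altsum_A _) (univar_altsum_B _) (kz_lead sz)).
move=> A B; rewrite -[F A B](univarK o).
have := sz m.+1 (leqnn _) A B; rewrite subnn leqn0 size_poly_eq0 => /eqP->.
by rewrite horner0.
Qed.

Variable B0 : {ffun 'I_i -> 'I_n}.
Hypothesis B0_inj : injective B0.
Hypothesis oB0 : o \notin codom B0.

(** By homogeneity the coefficients of X_o^m are constants. Schur's lemma reduces those with o in A
    and not in B to a single number, and [lead_eq0] disposes of the rest. *)
Lemma kz_uniq : (F (tcons o B0) B0)@_(U_(o) *+ m)%MM = 0 ->
  forall A B, F A B = 0.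
Proof.
move=> F0; pose w A B : K^o := (F A B)@_(U_(o) *+ m)%MM.
have wA B : altsum (w^~ B).
  apply: (altsum_additive (g := fun p : {mpoly K[n]} => p@_(U_(o) *+ m)%MM : K^o)
    _ (FA B)) => x y.
  exact: mcoeffD.
have wB A : altsum (w A).
  apply: (altsum_additive (g := fun p : {mpoly K[n]} => p@_(U_(o) *+ m)%MM : K^o)
    _ (FB A)) => x y.
  exact: mcoeffD.
have cst_inj a : a%:MP = 0 :> {mpoly K[n]} -> a = 0.
  by move=> /eqP; rewrite mpolyC_eq0 => /eqP.
have w_act (s : 'S_n) A B : s o = o -> w (tact s A) (tact s B) = w A B.
  move=> so; rewrite /w -F_act mcoeff_sym; congr (_@_ _); apply/mnmP => a.
  rewrite mnmE !mulmnE !mnm1E -{1}so (inj_eq perm_inj)//.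
have w_in_in A B : injective A -> injective B ->
    o \in codom A -> o \in codom B -> w A B = 0.
  move=> Ai Bi oA oB; apply: cst_inj; rewrite -kz_top_coef.
  exact: (lead_in_in c_nat (univar_altsum_A _) (univar_altsum_B _) (kz_lead kz_size)).
apply: kz_coef_eq0 => A B; apply: cst_inj; rewrite -kz_top_coef.
apply: (lead_eq0 i_lt cn c_nat (univar_altsum_A _) (univar_altsum_B _)
  (kz_lead kz_size)).
move=> A1 B1 Ai Bi oA oB; rewrite kz_top_coef.
by rewrite [_@__](schur_in_out wA wB w_act w_in_in B0_inj oB0 F0 Ai Bi oA oB) mpolyC0.
Qed.

End KZUniqueness.

Lemma mcoeff_XM (K : numFieldType) n (a : 'I_n) (p : {mpoly K[n]}) mu :
  ('X_a * p)@_mu = if (0 < mu a)%N then p@_(mu - U_(a))%MM else 0.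
Proof.
case: ifPn => [mua|]; last first.
  rewrite -eqn0Ngt => /eqP mua; elim/mpolyind: p => [|r m p _ _ IHp].
    by rewrite mulr0 mcoeff0.
  rewrite mulrDr mcoeffD IHp addr0 -scalerAr -mpolyXD mcoeffZ mcoeffX.
  case: eqP => [muE|]; last by rewrite mulr0.
  by move: mua; rewrite -muE mnmDE mnm1E eqxx.
rewrite mulrC -{1}[mu](@submK _ U_(a)%MM); last by rewrite lep1mP -lt0n.
by rewrite addmC mcoeffMX.
Qed.

(** * Singular polynomials *)

Section BinomialSeries.
Variable K : numFieldType.
Implicit Types (e : K) (k : nat).

(** The coefficient of z^k in (1 - z)^e, that is (-1)^k times the binomial coefficient of e over
    k. *)
Definition bcoef e k : K := \prod_(l < k) ((l%:R - e) / l.+1%:R).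

Lemma bcoef0 e : bcoef e 0 = 1.
Proof. exact: big_ord0. Qed.

Lemma bcoefS e k : k.+1%:R * bcoef e k.+1 = (k%:R - e) * bcoef e k.
Proof.
have k0 : k.+1%:R != 0 :> K by rewrite pnatr_eq0.
by rewrite /bcoef big_ord_recr /= mulrCA [k.+1%:R * _]mulrC divfK// mulrC.
Qed.

Lemma bcoef_pascal e k : bcoef (e + 1) k.+1 = bcoef e k.+1 - bcoef e k.
Proof.
elim: k => [|k IHk].
  by rewrite /bcoef !big_ord_recl !big_ord0 /=; field.
have k0 : k.+2%:R != 0 :> K by rewrite pnatr_eq0.
apply: (mulfI k0); rewrite mulrBr !bcoefS IHk mulrBr.
have -> : (k.+1%:R - (e + 1)) = k%:R - e :> K by rewrite -natr1; ring.
by rewrite -[X in _ - X = _]bcoefS -[k.+2%:R]natr1; ring.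
Qed.

Lemma bcoef_deriv e k : k.+1%:R * bcoef e k.+1 = - e * bcoef (e - 1) k.
Proof.
rewrite bcoefS; elim: k => [|k IHk]; first by rewrite !bcoef0 sub0r.
have k0 : k.+1%:R != 0 :> K by rewrite pnatr_eq0.
apply: (mulfI k0); rewrite mulrCA bcoefS IHk [RHS]mulrCA bcoefS -natr1; ring.
Qed.

Lemma bcoef_neq0 e k : (forall r : nat, e != r%:R) -> bcoef e k != 0.
Proof.
move=> en; apply/prodf_neq0 => l _; rewrite mulf_neq0 ?invr_eq0 ?pnatr_eq0//.
by rewrite subr_eq0 eq_sym.
Qed.

End BinomialSeries.

Section GenPoly.
Variables (K : numFieldType) (n : nat).
Implicit Types (e : 'I_n -> K) (r : nat) (a : 'I_n) (mu : 'X_{1..n}).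

Definition gcoef e r (mu : 'X_{1..n}) : K :=
  if mdeg mu == r then \prod_a bcoef (e a) (mu a) else 0.

(* [gpoly e r] is the coefficient of z^r in \prod_a (1 - X_a z)^(e a). *)
Definition gpoly e r : {mpoly K[n]} :=
  \sum_(mu : 'X_{1..n < r.+1}) gcoef e r mu *: 'X_[mu].

Lemma gpolyE e r mu : (gpoly e r)@_mu = gcoef e r mu.
Proof.
have [mur|mur] := ltnP (mdeg mu) r.+1; first by rewrite /gpoly mcoeff_mpoly.
rewrite /gcoef gtn_eqF// /gpoly raddf_sum big1//= => nu _.
rewrite mcoeffZ mcoeffX; case: eqP => [nuE|]; last by rewrite mulr0.
by have := bmdeg nu; rewrite nuE ltnNge mur.
Qed.

Lemma eq_gpoly e e' r : e =1 e' -> gpoly e r = gpoly e' r.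
Proof. by move=> ee; congr gpoly; apply/funext. Qed.

Lemma gcoefSU e r a mu : (0 < mu a)%N ->
  gcoef e r (mu - U_(a))%MM =
  if mdeg mu == r.+1 then bcoef (e a) (mu a).-1 *
     \prod_(b | b != a) bcoef (e b) (mu b) else 0.
Proof.
move=> mua; have muE : mu = (mu - U_(a) + U_(a))%MM by rewrite submK// lep1mP -lt0n.
rewrite {2}muE mdegD mdeg1 addn1 eqSS /gcoef; case: eqP => // _.
rewrite (bigD1 a)//= mnmBE mnm1E eqxx subn1; congr (_ * _).
by apply: eq_bigr => b ba; rewrite mnmBE mnm1E eq_sym (negPf ba) subn0.
Qed.

Lemma gpoly_pascal e e' r a : (forall b, e' b = e b + (b == a)%:R) ->
  gpoly e' r.+1 = gpoly e r.+1 - 'X_a * gpoly e r.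
Proof.
move=> ee; apply/mpolyP => mu; rewrite mcoeffB mcoeff_XM !gpolyE.
have Pe : \prod_(b | b != a) bcoef (e' b) (mu b) = \prod_(b | b != a) bcoef (e b)
  (mu b).
  by apply: eq_bigr => b /negPf ba; rewrite ee ba addr0.
case: ifPn => [mua|]; last first.
  rewrite -eqn0Ngt subr0 => /eqP mua; rewrite /gcoef; case: eqP => // _.
  by rewrite (bigD1 a)//= [RHS](bigD1 a)//= Pe mua !bcoef0.
rewrite gcoefSU// /gcoef; case: eqP => [_|]; last by rewrite subr0.
rewrite (bigD1 a)//= [X in _ = X - _](bigD1 a)//= Pe -mulrBl ee eqxx.
by case: (mu a) mua => // k _; rewrite bcoef_pascal.
Qed.

Lemma gpoly_deriv e e' r a : (forall b, e' b = e b - (b == a)%:R) ->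
  (gpoly e r.+1)^`M(a) = - e a *: gpoly e' r.
Proof.
move=> ee; apply/mpolyP => mu; rewrite mcoeff_deriv mcoeffZ !gpolyE /gcoef.
rewrite mdegD mdeg1 addn1 eqSS; case: eqP => [_|]; last by rewrite mul0rn mulr0.
rewrite (bigD1 a)//= [in RHS](bigD1 a)//= mnmDE mnm1E eqxx addn1.
rewrite -mulrnAl -[_ *+ _]mulr_natl bcoef_deriv ee eqxx -mulrA.
congr (_ * (_ * _)); apply: eq_bigr => b ba.
by rewrite ee (negPf ba) subr0 mnmDE mnm1E eq_sym (negPf ba) addn0.
Qed.

Lemma gpoly0 e : gpoly e 0 = 1.
Proof.
apply/mpolyP => mu; rewrite gpolyE /gcoef mcoeff1 mdeg_eq0; case: eqP => // ->.
by rewrite big1// => a _; rewrite mnm0E bcoef0.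
Qed.

(** With P = prod_a (1 - X_a z)^(e a), this is the coefficient of z^r in sum_a e a P / (1 - X_a z) =
    (sum_a e a) P - z dP/dz. *)
Lemma gpoly_euler e (d : 'I_n -> 'I_n -> K) r :
  (forall a b, d a b = e b - (b == a)%:R) ->
  \sum_a e a *: gpoly (d a) r = (\sum_a e a - r%:R) *: gpoly e r.
Proof.
move=> de; case: r => [|r].
  rewrite subr0 gpoly0 scaler_suml; apply: eq_bigr => a _; by rewrite gpoly0.
have := mcoeff_euler (gpoly e r.+1).
have -> : \sum_a 'X_a * (gpoly e r.+1)^`M(a) =
   (\sum_a e a) *: gpoly e r.+1 - \sum_a e a *: gpoly (d a) r.+1.
  rewrite scaler_suml -sumrB; apply: eq_bigr => a _.
  rewrite (gpoly_deriv _ (de a)) -scalerAr -scalerBr.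
  rewrite (@gpoly_pascal (d a) e r a) => [|b]; last by rewrite de subrK.
  by rewrite addrAC subrr sub0r scalerN scaleNr.
move=> eul; apply/mpolyP => mu; have := eul mu; rewrite mcoeffB !mcoeffZ.
rewrite mulrBl gpolyE => E; rewrite (_ : r.+1%:R * _ = (mdeg mu)%:R * gcoef e r.+1 mu).
  by rewrite -E opprB addrC subrK.
by rewrite /gcoef; case: eqP => [->//|_]; rewrite !mulr0.
Qed.

Lemma msym_gpoly w e r : msym w (gpoly e r) = gpoly (fun a => e (w^-1%g a)) r.
Proof.
apply/mpolyP => mu; rewrite mcoeff_sym !gpolyE /gcoef mdeg_mperm; case: eqP => // _.
rewrite [RHS](reindex_inj (@perm_inj _ w)); apply: eq_bigr => a _ /=.
by rewrite permK mnmE.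
Qed.

End GenPoly.

Section SingularPolynomials.
Variables (K : numFieldType) (n m : nat) (c : K).
Hypothesis m_gt0 : (0 < m)%N.
Hypothesis cn : c * n%:R = m%:R.
Implicit Types (a j l : 'I_n).

Definition fpoly l : {mpoly K[n]} := gpoly (fun a => c - (a == l)%:R) m.

Lemma msym_fpoly w l : msym w (fpoly l) = fpoly (w l).
Proof.
rewrite /fpoly msym_gpoly; apply: eq_gpoly => a.
by rewrite -(inj_eq (@perm_inj _ w)) permKV.
Qed.

Let epair l j a : K := c - (a == l)%:R - (a == j)%:R.

(** Partial fractions: 1/(1 - X_j z) - 1/(1 - X_l z) = (X_j - X_l) z / ((1 - X_j z)(1 - X_l z)). The
    factor z lowers the degree to m - 1, and [epair] holds the exponents with both denominators. *)
Lemma fpoly_ddiff l j : l != j ->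
  ddiff l j (fpoly j) = - gpoly (epair l j) m.-1.
Proof.
move=> lj; apply: (ddiff_uniq lj); rewrite msym_fpoly tpermR /fpoly.
case: m m_gt0 => // r _; rewrite succnK.
rewrite (@gpoly_pascal _ _ (epair l j) _ r l) => [|b];
  last by rewrite /epair addrAC subrK.
rewrite [X in _ = _ - X](@gpoly_pascal _ _ (epair l j) _ r j) => [|b].
  by ring.
by rewrite /epair subrK.
Qed.

Lemma c_neq0 : c != 0.
Proof. by apply: contra_eqN cn => /eqP->; rewrite mul0r eq_sym pnatr_eq0 -lt0n. Qed.

(** [gpoly_euler] with all exponents c, where the scalar is c n - m = 0. *)
Lemma fpoly_sum0 : \sum_l fpoly l = 0.
Proof.
have := @gpoly_euler K n (fun=> c) (fun l a => c - (a == l)%:R) m (fun _ _ => erefl).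
rewrite sumr_const card_ord -[_ *+ n]mulr_natr cn subrr scale0r -scaler_sumr => /eqP.
by rewrite scaler_eq0 (negPf c_neq0) => /eqP.
Qed.

Lemma fpoly_fix l a j : l != a -> l != j -> msym (tperm a j) (fpoly l) = fpoly l.
Proof. by move=> la lj; rewrite msym_fpoly tpermD// eq_sym. Qed.

(** For a != l only j = l contributes, as the other transpositions fix f_l. For a = l, [gpoly_euler]
    is used in degree m - 1 for exponents with sum c n - 1, so its scalar is again 0. *)
Lemma fpoly_kz a l :
  (fpoly l)^`M(a) = c *: \sum_(j | j != a) ddiff a j (fpoly l).
Proof.
have [->|al] := eqVneq a l; last first.
  have la : l != a by rewrite eq_sym.
  rewrite (bigD1 l)//= [X in _ + X]big1 ?addr0 => [|j /andP[ja jl]]; last first.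
    by rewrite ddiff_fix 1?eq_sym// fpoly_fix// eq_sym.
  rewrite fpoly_ddiff// scalerN -scaleNr /fpoly.
  rewrite -{1}(prednK m_gt0) (@gpoly_deriv _ _ _ (epair l a) _ a).
    rewrite (negPf al) subr0; congr (_ *: _); apply: eq_gpoly => b.
    by rewrite /epair addrAC.
  by move=> b.
have E := @gpoly_euler K n (fun a => c - (a == l)%:R) (epair l) m.-1.
have {}E : \sum_j (c - (j == l)%:R) *: gpoly (epair l j) m.-1 = 0.
  rewrite E//; rewrite sumrB sumr_const card_ord -[_ *+ n]mulr_natr cn.
  rewrite (bigD1 l)//= eqxx big1 ?addr0 => [|j /negPf->//].
  by rewrite -{1}(prednK m_gt0) -natr1 addrK subrr scale0r.
rewrite /fpoly -{1}(prednK m_gt0) (@gpoly_deriv _ _ _ (epair l l) _ l)//.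
move: E; rewrite (bigD1 l)//= addrC => /eqP; rewrite addr_eq0 => /eqP E.
rewrite scaleNr -E scaler_sumr; apply: eq_bigr => j jl.
rewrite (negPf jl) subr0 (ddiff_swap _ jl) -/(fpoly l) fpoly_ddiff// opprK.
by congr (_ *: _); apply: eq_gpoly => b; rewrite /epair addrAC.
Qed.

Lemma fpoly_top o l : l != o -> (fpoly l)@_(U_(o) *+ m)%MM = bcoef c m.
Proof.
move=> lo; rewrite gpolyE /gcoef mdegMn mdeg1 mul1n eqxx (bigD1 o)//=.
rewrite eq_sym (negPf lo) subr0 mulmnE mnm1E eqxx mul1n big1 ?mulr1// => a ao.
by rewrite mulmnE mnm1E [o == a]eq_sym (negPf ao) bcoef0.
Qed.

Lemma fpoly_top_diag o : (fpoly o)@_(U_(o) *+ m)%MM = - ((n%:R - 1) * bcoef c m).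
Proof.
have := congr1 (mcoeff (U_(o) *+ m)%MM) fpoly_sum0; rewrite raddf_sum /= mcoeff0.
rewrite (bigD1 o)//= (eq_bigr (fun=> bcoef c m)) => [|l lo]; last exact: fpoly_top.
move=> /eqP; rewrite addr_eq0 => /eqP->; rewrite sumr_const cardC1 card_ord.
congr (- _); rewrite -[bcoef c m *+ _]mulr_natl; congr (_ * _).
by rewrite -subn1 natrB// (leq_trans _ (ltn_ord o)).
Qed.

End SingularPolynomials.

(** * Translation-invariant polynomials *)

Section Shift.
Variables (K : numFieldType) (n : nat).
Implicit Types p : {mpoly K[n]}.

Lemma sum_mderiv_xsubst p : \sum_a (xsubst p)^`M(a) = 0.
Proof.
rewrite /xsubst; elim/mpoly_gen_ind: p => [r|p q IHp IHq|j p IHp].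
- by rewrite mmapC big1// => a _; rewrite mderivC.
- rewrite mmapD; under eq_bigr do rewrite mderivD.
  by rewrite big_split /= IHp IHq addr0.
- rewrite rmorphM /= mmapXU; under eq_bigr do rewrite mderivM.
  rewrite big_split /= -mulr_sumr IHp mulr0 addr0 -mulr_suml.
  rewrite (_ : \sum_a _ = 0) ?mul0r// /xbar.
  under eq_bigr => a _ do rewrite mderivB mderivZ mderivXU (raddf_sum (mderiv a)) /=.
  rewrite sumrB (bigD1 j)//= eqxx big1 ?addr0; last first.
    by move=> a /negPf; rewrite eq_sym => ->.
  rewrite -scaler_sumr exchange_big /= (eq_bigr (fun=> 1)) => [|b _].
    have -> : \sum_(b < n) 1 = n%:R *: 1 :> {mpoly K[n]}.
      by rewrite sumr_const card_ord scaler_nat.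
    by rewrite scalerA mulVf ?scale1r ?subrr// (ord_natr_neq0 _ j).
  under eq_bigr do rewrite mderivXU.
  by rewrite (bigD1 b)//= eqxx big1 ?addr0// => a /negPf; rewrite eq_sym => ->.
Qed.

End Shift.

HB.lock Definition shift_exp (K : numFieldType) n (p : {mpoly K[n]}) :
    {poly {mpoly K[n]}} :=
  mmap (polyC \o @mpolyC n K) (fun a => ('X_a)%:P + 'X) p.

Section ShiftInvariance.
Variables (K : numFieldType) (n : nat).
Implicit Types p q : {mpoly K[n]}.

Lemma shift_expD p q : shift_exp (p + q) = shift_exp p + shift_exp q.
Proof. by rewrite shift_exp.unlock; apply: mmapD. Qed.

Lemma shift_expM p q : shift_exp (p * q) = shift_exp p * shift_exp q.
Proof. by rewrite shift_exp.unlock; apply: rmorphM. Qed.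

Lemma shift_expX a : shift_exp ('X_a : {mpoly K[n]}) = ('X_a)%:P + 'X.
Proof. by rewrite shift_exp.unlock; apply: mmapXU. Qed.

Lemma shift_expC (r : K) : shift_exp (r%:MP : {mpoly K[n]}) = r%:MP%:P.
Proof. by rewrite shift_exp.unlock; apply: mmapC. Qed.

Lemma shift_exp0 p : (shift_exp p).[0] = p.
Proof.
elim/mpoly_gen_ind: p => [r|p q IHp IHq|j p IHp].
- by rewrite shift_expC hornerC.
- by rewrite shift_expD hornerD IHp IHq.
- by rewrite shift_expM shift_expX hornerM IHp hornerD hornerC hornerX addr0.
Qed.

Lemma shift_exp_xbar p :
  (shift_exp p).[- (n%:R^-1 *: \sum_j 'X_j)] = xsubst p.
Proof.
rewrite /xsubst; elim/mpoly_gen_ind: p => [r|p q IHp IHq|j p IHp].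
- by rewrite shift_expC hornerC mmapC.
- by rewrite shift_expD hornerD IHp IHq mmapD.
- rewrite shift_expM shift_expX hornerM IHp hornerD hornerC hornerX.
  by rewrite rmorphM /= mmapXU.
Qed.

Lemma shift_exp_deriv p : (shift_exp p)^`() = shift_exp (\sum_a p^`M(a)).
Proof.
elim/mpoly_gen_ind: p => [r|p q IHp IHq|j p IHp].
- by rewrite shift_expC derivC big1 -?mpolyC0 ?shift_expC// => a _;
  rewrite mderivC mpolyC0.
- under eq_bigr do rewrite mderivD.
  by rewrite big_split !shift_expD derivD IHp IHq.
- under eq_bigr do rewrite mderivM mderivXU.
  rewrite big_split /= -mulr_sumr -mulr_suml (bigD1 j)//= eqxx big1; last first.
    by move=> a /negPf; rewrite eq_sym => ->.
  rewrite addr0 mul1r shift_expD !shift_expM derivM IHp shift_expX.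
  by rewrite derivD derivC derivX add0r mul1r.
Qed.

(** p(X_1 + t, ..., X_n + t) has zero derivative in t, so it is constant in t. At t = 0 it is p, and
    at minus the mean of the X_j it is [xsubst p]. *)
Lemma xsubst_id p : \sum_a p^`M(a) = 0 -> xsubst p = p.
Proof.
move=> Ep; rewrite -shift_exp_xbar -[RHS]shift_exp0.
have Q' : (shift_exp p)^`() = 0 by rewrite shift_exp_deriv Ep -mpolyC0 shift_expC.
have -> : shift_exp p = ((shift_exp p)`_0)%:P; last by rewrite !hornerC.
apply/polyP => -[|k]; rewrite coefC //=.
have := congr1 (fun q : {poly _} => q`_k) Q'; rewrite coef_deriv coef0.
by rewrite -scaler_nat => /eqP; rewrite scaler_eq0 pnatr_eq0 => /eqP.
Qed.

End ShiftInvariance.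

Lemma ddiff_sumZ (K : numFieldType) n (a j : 'I_n) (I : finType) (r : I -> K)
    (p : I -> {mpoly K[n]}) : a != j ->
  ddiff a j (\sum_l r l *: p l) = \sum_l r l *: ddiff a j (p l).
Proof.
move=> aj; apply: (ddiff_uniq aj); rewrite msym_sum mulr_sumr -sumrB.
by apply: eq_bigr => l _; rewrite msymZ -scalerBr -scalerAr ddiffE.
Qed.

Lemma tact_tcons n k w (j : 'I_n) (B : {ffun 'I_k -> 'I_n}) :
  tact w (tcons j B) = tcons (w j) (tact w B).
Proof.
by apply/ffunP=> p; rewrite !ffunE; case: unliftP => [q _|_]; rewrite ?ffunE.
Qed.

Section TConsAlternating.
Variables (K : numFieldType) (n k : nat) (W : lmodType K).
Variable g : {ffun 'I_k.+1 -> 'I_n} -> W.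
Hypothesis gP : altsum g.
Implicit Types (B : {ffun 'I_k -> 'I_n}) (a b : 'I_n) (w : 'S_n).

Lemma tcons_in B a : a \in codom B -> g (tcons a B) = 0.
Proof.
case/codomP=> p ->; case: gP => g1 _ _; apply: (g1 _ ord0 (lift ord0 p)) => //.
by rewrite !ffunE unlift_none liftK.
Qed.

Lemma tcons_swap B a b : a \in codom B -> b != a ->
  g (tcons a (tact (tperm a b) B)) = - g (tcons b B).
Proof.
case/codomP=> p -> bp.
have := altsum_tact gP (tcons b B) (neq_lift ord0 p).
rewrite !ffunE unlift_none liftK tact_tcons tpermL => <-.
by rewrite [tperm b _]tpermC.
Qed.

Lemma codom_tact w B a : (w a \in codom (tact w B)) = (a \in codom B).
Proof.
apply/codomP/codomP=> -[p pE]; exists p; last by rewrite pE ffunE.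
by move: pE; rewrite ffunE => /perm_inj.
Qed.

(** In wedge notation (e_a - e_b) /\ (B - s B) = 0, where s exchanges a and b: B - s B is divisible
    by e_a - e_b. *)
Lemma tcons_exchange B a b : a != b ->
  g (tcons a B) - g (tcons a (tact (tperm a b) B)) =
  g (tcons b B) - g (tcons b (tact (tperm a b) B)).
Proof.
move=> ab; have ba : b != a by rewrite eq_sym.
have [aB|aB] := boolP (a \in codom B).
  have bs : b \in codom (tact (tperm a b) B) by rewrite -{1}(tpermL a b) codom_tact.
  by rewrite (tcons_in aB) (tcons_swap aB ba) sub0r opprK (tcons_in bs) subr0.
have [bB|bB] := boolP (b \in codom B).
  have as_ : a \in codom (tact (tperm a b) B) by rewrite -{1}(tpermR a b) codom_tact.
  by rewrite (tcons_in bB) (tcons_in as_) tpermC (tcons_swap bB ab) sub0r opprK subr0.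
by rewrite tact_id// !subrr.
Qed.

End TConsAlternating.

Lemma altsum_comb (K : numFieldType) n k (I : finType) (V : lmodType K)
    (f : I -> {ffun 'I_k -> 'I_n} -> K^o) (x : I -> V) :
  (forall l, altsum (f l)) -> altsum (fun B => \sum_l f l B *: x l).
Proof.
move=> fP; split=> [B p q pq Bpq|B p q pq|B p].
- by rewrite big1// => l _; case: (fP l) => f1 _ _; rewrite (f1 _ _ _ pq Bpq) scale0r.
- rewrite -sumrN; apply: eq_bigr => l _.
  by case: (fP l) => _ f2 _; rewrite (f2 _ _ _ pq) scaleNr.
- rewrite exchange_big big1//= => l _; rewrite -scaler_suml.
  by case: (fP l) => _ _ ->; rewrite scale0r.
Qed.

(** * Homomorphisms of Verma modules *)

Section Homs.
Variables (K : numFieldType) (n i m : nat) (c : K).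
Hypothesis i_lt : (i.+2 <= n)%N.
Hypothesis m_gt0 : (0 < m)%N.
Hypothesis cn : c * n%:R = m%:R.
Hypothesis c_nat : forall r : nat, c != r%:R.
Local Notation h := (reflection K n).
Local Notation sig := (exterior i.+1 h).
Local Notation tau := (exterior i h).
Local Notation cst := (cher_cst n c).
Implicit Types (A : {ffun 'I_i.+1 -> 'I_n}) (B : {ffun 'I_i -> 'I_n}).

Let n_gt0 : (0 < n)%N. Proof. exact: leq_trans i_lt. Qed.

Definition ext_to_dunkl : verma c tau -> dunklmod n i c :=
  @to_dunkl K n c i tau (fun B t => ell B t).
Definition ext_of_dunkl : dunklmod n i c -> verma c tau :=
  @of_dunkl K n c i tau (@yframe K n i).

Lemma ext_to_dunkl_linear : linear ext_to_dunkl.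
Proof. apply: to_dunkl_linear; [exact: ellD|exact: ellZ|exact: ell_act]. Qed.

Lemma ext_of_dunkl_linear : linear ext_of_dunkl.
Proof. apply: of_dunkl_linear; exact: yframe_act. Qed.

Lemma ext_to_dunklK : cancel ext_to_dunkl ext_of_dunkl.
Proof.
apply: to_dunklK; [exact: ellD|exact: ellZ|exact: ell_act|exact: yframe_act|].
by move=> t; apply: ell_frame.
Qed.

Lemma ext_of_dunklK (u : dunklmod n i c) B :
  ext_to_dunkl (ext_of_dunkl u) B = \sum_B' ell B (yframe K B') *: xsubst (u B').
Proof. apply: of_dunklK; [exact: ellD|exact: ellZ|exact: ell_act]. Qed.

(** The image is fixed by the projection of [ext_of_dunklK]; its elements inherit translation
    invariance and the [altsum] property in B. *)
Lemma ext_to_dunkl_image x B : ext_to_dunkl x B = \sum_B' ell B (yframe K B')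
  *: xsubst (ext_to_dunkl x B').
Proof. by rewrite -{1}[x]ext_to_dunklK ext_of_dunklK. Qed.

(** On the image the correction term of [ybar] disappears, so singular vectors are killed by the
    Dunkl operators themselves. *)
Lemma sum_dunkl_ext x : \sum_a dunkl c a (ext_to_dunkl x) = 0.
Proof.
apply/ffunP=> B; rewrite sum_dunklE ext_to_dunkl_image.
under eq_bigr => a _ do rewrite (raddf_sum (mderiv a)) /=.
rewrite exchange_big big1 ?ffunE//= => B' _.
under eq_bigr do rewrite mderivZ.
by rewrite -scaler_sumr sum_mderiv_xsubst scaler0.
Qed.

Section Uniqueness.
Variable g : verma c sig -> verma c tau.
Hypothesis lg : linear g.

Definition hom_coord A B : {mpoly K[n]} := ext_to_dunkl (g (vpure c 1 (wedge
  (yvec K A) : sig))) B.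

Lemma hom_coord_altsumA B : altsum (hom_coord^~ B).
Proof.
apply: (altsum_additive (g := fun t : sig => ext_to_dunkl (g (vpure c 1 t)) B) _
  (@wedge_altsum K n i.+1)) => x y.
by rewrite vpureDr (linear_funD lg) (linear_funD ext_to_dunkl_linear) uaddE.
Qed.

Lemma hom_coord_altsumB A : altsum (hom_coord A).
Proof.
have -> : hom_coord A = fun B => \sum_B' ell B (yframe K B') *:
    xsubst (ext_to_dunkl (g (vpure c 1 (wedge (yvec K A) : sig))) B').
  by apply/funext => B; apply: ext_to_dunkl_image.
apply: (altsum_comb (f := fun B' B => ell B (yframe K B') : K^o)) => B'.
exact: ell_altsum.
Qed.

Lemma hom_coord_act w A B :
  msym w (hom_coord A B) = hom_coord (tact w A) (tact w B).
Proof.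
rewrite /hom_coord wedge_yvec_act -vpure_s (linear_funZ lg)
  (linear_funZ ext_to_dunkl_linear) dunklmod_sE.
by rewrite usymE tactK.
Qed.

Lemma hom_coord_kz a A B : (hom_coord A B)^`M(a) =
  c *: \sum_(j | j != a) ddiff a j (hom_coord A (tact (tperm a j) B)).
Proof.
apply/eqP; rewrite -subr_eq0; apply/eqP.
set u := ext_to_dunkl (g (vpure c 1 (wedge (yvec K A) : sig))).
have : ybar c a u = 0.
  rewrite -dunklmod_yE /u -(linear_funZ ext_to_dunkl_linear) -(linear_funZ lg) vpure_y.
  by rewrite (linear_fun0 lg) (linear_fun0 ext_to_dunkl_linear).
rewrite /ybar sum_dunkl_ext scaler0 subr0 => /ffunP/(_ B).
by rewrite dunklE => ->; rewrite ffunE.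
Qed.

Variables (o : 'I_n) (B0 : {ffun 'I_i -> 'I_n}).
Hypothesis B0_inj : injective B0.
Hypothesis oB0 : o \notin codom B0.

(** One coefficient is a linear functional on homomorphisms with trivial kernel, so Hom has
    dimension at most 1. *)
Lemma hom_eq0 : (hom_coord (tcons o B0) B0)@_(U_(o) *+ m)%MM = 0 ->
  forall x, g x = 0.
Proof.
move=> F0; have F_eq0 := kz_uniq i_lt cn c_nat hom_coord_altsumA hom_coord_altsumB
  hom_coord_act hom_coord_kz B0_inj oB0 F0.
have g0 A : g (vpure c 1 (wedge (yvec K A) : sig)) = 0.
  rewrite -[LHS]ext_to_dunklK (_ : ext_to_dunkl _ = 0)
    ?(linear_fun0 ext_of_dunkl_linear)//.
  by apply/ffunP => B; rewrite [LHS]F_eq0 ffunE.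
apply: (verma_ext (g := fun=> 0) lg) => [a u v|t]; first by rewrite scaler0 addr0.
rewrite [t](@ell_frame K n i.+1 _ n_gt0) vpure_sum (big_morph g (linear_funD lg)
  (linear_fun0 lg)).
rewrite big1// => A _; rewrite /yframe scalerA -vpure_cst (linear_funZ lg) g0.
exact: scaler0.
Qed.

End Uniqueness.

(** The Koszul differential sum_j f_j (x) (contraction of v by x_j), in coordinates: [tcons j]
    contracts with x_j in the first slot. *)
Definition koszul_dunkl (v : sig) : dunklmod n i c :=
  [ffun B => \sum_j ell (tcons j B) v *: fpoly m c j].

Lemma koszul_dunklE v B : koszul_dunkl v B = \sum_j ell (tcons j B) v *: fpoly m c j.
Proof. exact: ffunE. Qed.

Lemma koszul_dunklD u v : koszul_dunkl (u + v) = koszul_dunkl u + koszul_dunkl v.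
Proof.
apply/ffunP=> B; rewrite [RHS]uaddE !koszul_dunklE -big_split; apply: eq_bigr => j _ /=.
by rewrite ellD scalerDl.
Qed.

Lemma koszul_dunklZ a v : koszul_dunkl (a *: v) = cst a *: koszul_dunkl v.
Proof.
rewrite dunklmod_cstE; apply/ffunP=> B; rewrite uscaleE !koszul_dunklE scaler_sumr.
by apply: eq_bigr => j _; rewrite ellZ scalerA.
Qed.

Lemma koszul_dunkl_s w v : koszul_dunkl (sn_act w v) = cher_s c w *: koszul_dunkl v.
Proof.
rewrite dunklmod_sE; apply/ffunP=> B; rewrite usymE !koszul_dunklE msym_sum.
rewrite (reindex_inj (@perm_inj _ w)); apply: eq_bigr => j _ /=.
by rewrite -{1}[B](tactVK w) -tact_tcons ell_act msymZ msym_fpoly.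
Qed.

(* The Koszul differential of the singular polynomials is singular: the       *)
(* reflection terms cancel by [tcons_exchange].                               *)
Lemma dunkl_koszul a v : dunkl c a (koszul_dunkl v) = 0.
Proof.
apply/ffunP=> B; rewrite dunklE koszul_dunklE ffunE (raddf_sum (mderiv a)) /=.
under eq_bigr do rewrite mderivZ (fpoly_kz m_gt0 cn) scalerA mulrC -scalerA scaler_sumr.
rewrite -scaler_sumr exchange_big /= -scalerBr -sumrB big1 ?scaler0// => k ka.
have ak : a != k by rewrite eq_sym.
rewrite koszul_dunklE (ddiff_sumZ _ _ ak) -sumrB.
under eq_bigr do rewrite -scalerBl.
rewrite (bigD1 a)//= (bigD1 k)//= big1 ?addr0 => [|j /andP[ja jk]]; last first.
  by rewrite ddiff_fix ?scaler0// fpoly_fix.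
have -> : ddiff a k (fpoly m c k) = - ddiff a k (fpoly m c a).
  by rewrite -(ddiff_sym _ ak) msym_fpoly tpermL.
have E := @tcons_exchange K n i K^o _ (@ell_altsum K n i.+1 v) B a k ak.
rewrite scalerN; apply/eqP; rewrite subr_eq0; apply/eqP; congr (_ *: _).
exact: E.
Qed.

Lemma koszul_dunkl_y a v : cher_y c a *: koszul_dunkl v = 0.
Proof.
rewrite dunklmod_yE /ybar dunkl_koszul big1 ?scaler0 ?subr0// => j _.
exact: dunkl_koszul.
Qed.

Definition koszul_verma v : verma c tau := ext_of_dunkl (koszul_dunkl v).

Definition koszul_hom : verma c sig -> verma c tau := verma_lift koszul_verma.

Let koszul_vermaD u v : koszul_verma (u + v) = koszul_verma u + koszul_verma v.
Proof. by rewrite /koszul_verma koszul_dunklD (linear_funD ext_of_dunkl_linear). Qed.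
Let koszul_vermaZ a v : koszul_verma (a *: v) = cst a *: koszul_verma v.
Proof. by rewrite /koszul_verma koszul_dunklZ (linear_funZ ext_of_dunkl_linear). Qed.
Let koszul_verma_s w v : koszul_verma (sn_act w v) = cher_s c w *: koszul_verma v.
Proof. by rewrite /koszul_verma koszul_dunkl_s (linear_funZ ext_of_dunkl_linear). Qed.
Let koszul_verma_y a v : cher_y c a *: koszul_verma v = 0.
Proof. by rewrite -(linear_funZ ext_of_dunkl_linear)
  koszul_dunkl_y (linear_fun0 ext_of_dunkl_linear). Qed.

Lemma koszul_hom_linear : linear koszul_hom.
Proof. exact: verma_lift_linear. Qed.

Lemma koszul_hom_pure v : koszul_hom (vpure c 1 v) = koszul_verma v.
Proof. by rewrite /koszul_hom verma_lift_pure// scale1r. Qed.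

(** The contraction of v by x_j is an element of the i-th exterior power, so the projection from the
    permutation module leaves its coordinates unchanged. On wedges this is the Laplace expansion. *)
Lemma frame_tcons j B (v : sig) :
  \sum_B' ell B (yframe K B') * ell (tcons j B') v = ell (tcons j B) v.
Proof.
apply: (ell_hom_ext (f := fun v => \sum_B' ell B (yframe K B') * ell (tcons j B') v)
  (g := fun v => ell (tcons j B) v)) => [a u u'||{}v].
- rewrite scaler_sumr -big_split; apply: eq_bigr => B' _ /=.
  by rewrite ell_linear mulrDr; congr (_ + _); apply: mulrCA.
- exact: ell_linear.
rewrite ell_tcons; under eq_bigr do rewrite ell_tcons mulr_sumr.
rewrite exchange_big; apply: eq_bigr => a _ /=.
rewrite [t in ell B t](@ell_frame K n i _ n_gt0).
rewrite (big_morph _ (@ellD K n i B) (@ell0 K n i B)) !mulr_sumr;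
  apply: eq_bigr => B' _.
by rewrite [ell B (_ *: yframe K B')]ellZ; ring.
Qed.

(** [koszul_dunkl v] lies in the image of the embedding, so [ext_of_dunkl] loses nothing and
    nonvanishing can be read off from polynomials. *)
Lemma ext_to_dunkl_koszul v : ext_to_dunkl (koszul_verma v) = koszul_dunkl v.
Proof.
apply/ffunP=> B; rewrite ext_of_dunklK koszul_dunklE.
have -> : \sum_B' ell B (yframe K B') *: xsubst (koszul_dunkl v B') =
    \sum_B' \sum_j (ell B (yframe K B') * ell (tcons j B') v) *: fpoly m c j.
  apply: eq_bigr => B' _; rewrite xsubst_id.
    by rewrite koszul_dunklE scaler_sumr; apply: eq_bigr => j _; rewrite scalerA.
  rewrite -(sum_dunklE c) big1 ?ffunE// => a _; exact: dunkl_koszul.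
by rewrite exchange_big; apply: eq_bigr => j _ /=; rewrite -scaler_suml frame_tcons.
Qed.

Lemma koszul_hom_neq0 : exists x, koszul_hom x != 0.
Proof.
pose o : 'I_n := Ordinal (ltnW i_lt); pose z : 'I_n := Ordinal i_lt.
have i_le : (i <= n)%N by apply: leq_trans i_lt; apply: leqW.
pose B0 : {ffun 'I_i -> 'I_n} := [ffun p => widen_ord i_le p].
(* As z is outside [tcons o B0], subtracting y_z cancels the 1/n in the coordinates, and the matrix
   of pairings becomes the identity. *)
pose v : {ffun 'I_i.+1 -> h} := [ffun p => refl_y K (tcons o B0 p) - refl_y K z].
have CB p : (tcons o B0 p == z) = false.
  rewrite !ffunE; case: unliftP => [q _|_]; apply/negbTE; rewrite -val_eqE /=.
    by rewrite ffunE /= ltn_eqF// ltnS ltnW.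
  by rewrite ltn_eqF.
have Ci : injective (tcons o B0).
  apply: tcons_inj => [p q|]; first by rewrite !ffunE => /(congr1 val) /= /val_inj.
  apply/codomP => -[p] /(congr1 val); rewrite ffunE /= => ip.
  by have := ltn_ord p; rewrite -ip ltnn.
have ell1 : ell (tcons o B0) (wedge v) = 1.
  rewrite ell_wedge (_ : \matrix_(a, b) _ = 1%:M) ?det1//; apply/matrixP => a b.
  rewrite !mxE [v a]ffunE -scaleN1r addrC.
  rewrite [rcoord _ _](rcoord_linear (tcons o B0 b) (-1)) !rcoord_y CB.
  rewrite (inj_eq Ci) scaleN1r sub0r opprK [b == a]eq_sym.
  by rewrite addrCA subrr addr0.
exists (vpure c 1 (wedge v : sig)); rewrite koszul_hom_pure; apply/eqP => koszul0.
have := ext_to_dunkl_koszul (wedge v); rewrite koszul0 (linear_fun0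
  ext_to_dunkl_linear) => /ffunP/(_ B0).
rewrite koszul_dunklE ffunE => /(congr1 (mcoeff (U_(o) *+ m)%MM)).
rewrite mcoeff0 raddf_sum /= (bigD1 o)//= mcoeffZ (fpoly_top_diag m_gt0 cn).
rewrite (eq_bigr (fun j => ell (tcons j B0) (wedge v) * bcoef c m)) => [|j jo];
  last first.
  by rewrite mcoeffZ fpoly_top.
(* The coordinates with j != o sum to -1, so X_o^m has coefficient -(n - 1) - 1 = - n times
   [bcoef c m], which is nonzero since c is no natural number. *)
have S0 : \sum_j ell (tcons j B0) (wedge v) = 0.
  have [_ _ sum0] := @ell_altsum K n i.+1 (wedge v).
  rewrite -[RHS](sum0 (tcons o B0) ord0); apply: eq_bigr => j _; congr ell.
  by apply/ffunP => p; rewrite !ffunE; case: unliftP => [q ->|->]; rewrite ?eqxx.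
move: S0; rewrite -mulr_suml (bigD1 o)//= ell1 => /eqP.
rewrite addrC addr_eq0 => /eqP->.
have -> : 1 * - ((n%:R - 1) * bcoef c m) + -1 * bcoef c m = - (n%:R * bcoef c m) :> K.
  by ring.
move=> /esym/eqP; rewrite oppr_eq0 mulf_eq0 pnatr_eq0 eqn0Ngt n_gt0 /=.
by rewrite (negPf (bcoef_neq0 _ c_nat)).
Qed.

Lemma hom_one_dim : hom_one_dimensional (palg_cst (cherednik_rel c))
  (verma c sig) (verma c tau).
Proof.
pose f : {linear verma c sig -> verma c tau} :=
  HB.pack koszul_hom (GRing.isLinear.Build _ _ _ _ koszul_hom koszul_hom_linear).
exists f; split; first exact: koszul_hom_neq0.
move=> g.
pose o : 'I_n := Ordinal (ltnW i_lt).
have i_le : (i <= n)%N by apply: leq_trans i_lt; apply: leqW.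
pose B0 : {ffun 'I_i -> 'I_n} := [ffun p => widen_ord i_le p].
have B0_inj : injective B0.
  by move=> p q; rewrite !ffunE => /(congr1 val) /= /val_inj.
have oB0 : o \notin codom B0.
  apply/codomP => -[p] /(congr1 val); rewrite ffunE /= => ip.
  by have := ltn_ord p; rewrite -ip ltnn.
pose L (k : verma c sig -> verma c tau) : K :=
  (hom_coord k (tcons o B0) B0)@_(U_(o) *+ m)%MM.
have Lf : L koszul_hom != 0.
  apply/eqP => Lf; have [x] := koszul_hom_neq0.
  by rewrite (hom_eq0 koszul_hom_linear B0_inj oB0 Lf) eqxx.
(* The multiple for which the coefficient tested by [hom_eq0] cancels in the difference. *)
pose a := L g / L koszul_hom; exists a => v.
pose k x := g x - cst a *: koszul_hom x.
have lk : linear k.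
  move=> b x y; rewrite /k linearP koszul_hom_linear scalerDr scalerBr opprD addrACA.
  by rewrite !scalerA palg_cst_central.
apply/eqP; rewrite -subr_eq0; apply/eqP.
apply: (hom_eq0 lk B0_inj oB0); rewrite /hom_coord /k (linear_funD
  ext_to_dunkl_linear) -scaleNr.
rewrite (linear_funZ ext_to_dunkl_linear) -rmorphN -/(cher_cst n c _)
  dunklmod_cstE uaddE uscaleE.
by rewrite mcoeffD mcoeffZ -/(L g) -/(L koszul_hom) mulNr divfK ?subrr.
Qed.

End Homs.

Theorem proposition6p11 (R : realType) (n m : nat) (hn : (2 <= n)%N)
    (hm : (1 <= m)%N) (hmn : ~~ (n %| m)%N) (i : nat) (hi : (i <= n - 2)%N) :
  let c : R[i] := m%:R / n%:R in
  hom_one_dimensional (palg_cst (cherednik_rel c))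
    (verma c (exterior i.+1 (reflection R[i] n)))
    (verma c (exterior i (reflection R[i] n))).
Proof.
move=> c; have n0 : n%:R != 0 :> R[i] by rewrite pnatr_eq0 -lt0n ltnW.
have i_lt : (i.+2 <= n)%N by rewrite -[i.+2]addn2 -(subnK hn) leq_add2r.
apply: (@hom_one_dim _ n i m c) => //.
  by rewrite divfK.
move=> r; apply: contra hmn => /eqP cr; apply/dvdnP; exists r.
by apply/eqP; rewrite -(eqr_nat R[i]) natrM -cr divfK.
Qed.
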